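(* Let $n \geq 1$. The kernel of $\Psi_n$ is the principal two-sided ideal \[ \ker \Psi_n = \left(\Omega^{(2n+2)}_{2n+1,-1}\right) \] of $\mathrm U(W_{\geq -1})$. However, $\ker \Psi_n$ is not finitely generated as a left ideal of $\mathrm{U}(W_{\geq -1})$, nor as a right ideal of $\mathrm{U}(W_{\geq -1})$.
   Context: Let $\Bbbk$ be a field of characteristic $0$; all algebras are unital $\Bbbk$-algebras and $\otimes=\otimes_\Bbbk$. The one-sided Witt algebra is the Lie algebra $W_{\geq -1}=\Bbbk[t]\partial$, $\partial=\frac{d}{dt}$, with bracket $[f\partial,g\partial]=(fg'-f'g)\partial$. It has basis $e_i=t^{i+1}\partial$ ($i\geq -1$). For $n\ge -1$ let $W_{\geq n}=\mathrm{span}_\Bbbk\{e_i\mid i\geq n\}$. For $n\geq 0$ let $\mathfrak g_n=W_{\geq 0}/W_{\geq n}$, with basis $v_i=e_i+W_{\geq n}$, $0\leq i\leq n-1$. $\mathrm U(\cdot)$ denotes the universal enveloping algebra. $A_1$ is the first Weyl algebra, generated by $t,\partial$ with $\partial t-t\partial=1$, and $T_n=A_1\otimes \mathrm U(\mathfrak g_n)$. The $n$th orbit homomorphism is the algebra homomorphism $\Psi_n:\mathrm U(W_{\geq -1})\to T_n$ determined by $\Psi_n(f\partial)=f\partial+\sum_{i=0}^{n-1}\frac{f^{(i+1)}}{(i+1)!}v_i$ for $f\in\Bbbk[t]$. For integers $m\geq 0$, $s\geq -1$, $k\geq m-1$, the differentiator is $\Omega^{(m)}_{k,s}=\sum_{i=0}^m(-1)^i\binom{m}{i}e_{k-i}e_{s+i}\in\mathrm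 U(W_{\geq -1})$. $(x)$ denotes the two-sided ideal of $\mathrm U(W_{\geq -1})$ generated by $x$. *)

(* Defs.v *)
From HB Require Import structures.
From mathcomp Require Import all_boot all_order all_algebra.
From mathcomp Require Import zify ring boolp classical_sets.

Set Implicit Arguments.
Unset Strict Implicit.
Unset Printing Implicit Defensive.

Import GRing.Theory.
Local Open Scope ring_scope.
Local Open Scope quotient_scope.

HB.mixin Record isLieAlgebra (F : fieldType) L of GRing.Lmodule F L := {
  lie : L -> L -> L;
  lie_linearl : forall (c : F) (x y z : L),
    lie (c *: x + y) z = c *: lie x z + lie y z;
  lie_linearr : forall (c : F) (x y z : L),
    lie z (c *: x + y) = c *: lie z x + lie z y;
  liexx : forall x : L, lie x x = 0;
  lie_jacobi : forall x y z : L,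
    lie x (lie y z) + lie y (lie z x) + lie z (lie x y) = 0
}.

#[short(type="lieAlgType")]
HB.structure Definition LieAlgebra (F : fieldType) :=
  {L of GRing.Lmodule F L & isLieAlgebra F L}.

Section Presentation.
Variables (F : fieldType) (X : Type).

(* Noncommutative polynomial expressions in the generators X. *)
Inductive word : Type :=
  | Gen of X
  | Cst of F
  | Add of word & word
  | Mul of word & word.

HB.instance Definition _ := gen_eqMixin word.
HB.instance Definition _ := gen_choiceMixin word.

Variable R : word -> word -> Prop.

(* The smallest congruence that contains R and whose quotient is a unital     *)
(* associative F-algebra.                                                     *)
Inductive cong : word -> word -> Prop :=
  | cong_rel u v : R u v -> cong u v
  | cong_refl u : cong u u
  | cong_sym u v : cong u v -> cong v u
  | cong_trans u v w : cong u v -> cong v w -> cong u w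
  | cong_add u u' v v' : cong u u' -> cong v v' -> cong (Add u v) (Add u' v')
  | cong_mul u u' v v' : cong u u' -> cong v v' -> cong (Mul u v) (Mul u' v')
  | cong_addA u v w : cong (Add u (Add v w)) (Add (Add u v) w)
  | cong_addC u v : cong (Add u v) (Add v u)
  | cong_add0 u : cong (Add (Cst 0) u) u
  | cong_mulA u v w : cong (Mul u (Mul v w)) (Mul (Mul u v) w)
  | cong_mul1 u : cong (Mul (Cst 1) u) u
  | cong_mul0 u : cong (Mul (Cst 0) u) (Cst 0)
  | cong_mulDl u v w : cong (Mul (Add u v) w) (Add (Mul u w) (Mul v w))
  | cong_mulDr u v w : cong (Mul w (Add u v)) (Add (Mul w u) (Mul w v))
  | cong_cstC c u : cong (Mul (Cst c) u) (Mul u (Cst c))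
  | cong_cstD c d : cong (Cst (c + d)) (Add (Cst c) (Cst d))
  | cong_cstM c d : cong (Cst (c * d)) (Mul (Cst c) (Cst d)).

Definition congb u v := `[< cong u v >].

Lemma congb_equiv : equiv_class_of congb.
Proof.
split=> [u|u v|v u w]; first exact/asboolP/cong_refl.
  by apply/asboolP/asboolP => /cong_sym.
by move=> /asboolP h1 /asboolP h2; apply/asboolP/(cong_trans h1 h2).
Qed.

Canonical congb_equivRel := EquivRelPack congb_equiv.

(* The F-algebra generated by X subject to the relations u = v for R u v. It  *)
(* can be the zero ring, so the structure of algType, which requires 1 != 0,  *)
(* is only given to the instances below.                                      *)
Definition presented := {eq_quot congb}.

HB.instance Definition _ := Choice.on presented.
HB.instance Definition _ := EqQuotient.on presented.

Definition pcls (u : word) : presented := \pi_presented u.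
Definition pgen (x : X) : presented := pcls (Gen x).

Lemma pclsP u v : pcls u = pcls v <-> cong u v.
Proof.
split; first by move/eqP; rewrite /pcls eqmodE => /asboolP.
by move=> h; apply/eqP; rewrite /pcls eqmodE; apply/asboolP.
Qed.

Lemma pcls_rel u v : R u v -> pcls u = pcls v.
Proof. by move=> Ruv; apply/pclsP/cong_rel. Qed.

Lemma pclsK x : pcls (repr x) = x. Proof. exact: reprK. Qed.

Lemma cong_repr u : cong (repr (pcls u)) u.
Proof. by apply/pclsP; rewrite pclsK. Qed.

Definition padd (x y : presented) := pcls (Add (repr x) (repr y)).
Definition pmul (x y : presented) := pcls (Mul (repr x) (repr y)).
Definition pscale (c : F) (x : presented) := pcls (Mul (Cst c) (repr x)).
Definition popp (x : presented) := pscale (-1) x.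

Lemma paddE u v : padd (pcls u) (pcls v) = pcls (Add u v).
Proof. by apply/pclsP/cong_add; apply: cong_repr. Qed.

Lemma pmulE u v : pmul (pcls u) (pcls v) = pcls (Mul u v).
Proof. by apply/pclsP/cong_mul; apply: cong_repr. Qed.

Lemma pscaleE c u : pscale c (pcls u) = pcls (Mul (Cst c) u).
Proof. by apply/pclsP/cong_mul; [apply: cong_refl|apply: cong_repr]. Qed.

Let pE := (paddE, pmulE, pscaleE).

Lemma paddA : associative padd.
Proof.
move=> x y z; rewrite -(pclsK x) -(pclsK y) -(pclsK z) !pE.
exact/pclsP/cong_addA.
Qed.

Lemma paddC : commutative padd.
Proof.
by move=> x y; rewrite -(pclsK x) -(pclsK y) !pE; apply/pclsP/cong_addC.
Qed.

Lemma padd0 : left_id (pcls (Cst 0)) padd.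
Proof. by move=> x; rewrite -(pclsK x) !pE; apply/pclsP/cong_add0. Qed.

Lemma pscaleDl c d x : pscale (c + d) x = padd (pscale c x) (pscale d x).
Proof.
rewrite -(pclsK x) !pE; apply/pclsP.
apply: cong_trans (cong_mulDl _ _ _).
by apply: cong_mul; [apply: cong_cstD|apply: cong_refl].
Qed.

Lemma pscale1 x : pscale 1 x = x.
Proof. by rewrite -(pclsK x) !pE; apply/pclsP/cong_mul1. Qed.

Lemma paddN : left_inverse (pcls (Cst 0)) popp padd.
Proof.
move=> x; rewrite /popp -{2}(pscale1 x) -pscaleDl addNr -(pclsK x) !pE.
exact/pclsP/cong_mul0.
Qed.

HB.instance Definition _ := GRing.isZmodule.Build presented
  paddA paddC padd0 paddN.

Lemma pmulA : associative pmul.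
Proof.
move=> x y z; rewrite -(pclsK x) -(pclsK y) -(pclsK z) !pE.
exact/pclsP/cong_mulA.
Qed.

Lemma pmul1 : left_id (pcls (Cst 1)) pmul.
Proof. by move=> x; rewrite -(pclsK x) !pE; apply/pclsP/cong_mul1. Qed.

Lemma pmulr1 : right_id (pcls (Cst 1)) pmul.
Proof.
move=> x; rewrite -[RHS]pmul1 -(pclsK x) !pE; apply/pclsP/cong_sym.
exact: cong_cstC.
Qed.

Lemma pmulDl : left_distributive pmul +%R.
Proof.
move=> x y z; rewrite /GRing.add /= -(pclsK x) -(pclsK y) -(pclsK z) !pE.
exact/pclsP/cong_mulDl.
Qed.

Lemma pmulDr : right_distributive pmul +%R.
Proof.
move=> x y z; rewrite /GRing.add /= -(pclsK x) -(pclsK y) -(pclsK z) !pE.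
exact/pclsP/cong_mulDr.
Qed.

HB.instance Definition _ := GRing.Zmodule_isPzRing.Build presented
  pmulA pmul1 pmulr1 pmulDl pmulDr.

Lemma pscaleA c d x : pscale c (pscale d x) = pscale (c * d) x.
Proof.
rewrite -(pclsK x) !pE; apply/pclsP.
apply: cong_trans (cong_mulA _ _ _) _.
by apply: cong_mul; [apply/cong_sym/cong_cstM|apply: cong_refl].
Qed.

Lemma pscaleDr : right_distributive pscale +%R.
Proof.
move=> c x y; rewrite /GRing.add /= -(pclsK x) -(pclsK y) !pE.
exact/pclsP/cong_mulDr.
Qed.

Lemma pscaleDl_add x : {morph pscale^~ x : c d / c + d}.
Proof. by move=> c d; apply: pscaleDl. Qed.

HB.instance Definition _ := GRing.Zmodule_isLmodule.Build F presented
  pscaleA pscale1 pscaleDr pscaleDl_add.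

Lemma presented_scaleAl (c : F) (x y : presented) : c *: (x * y) = c *: x * y.
Proof.
rewrite /GRing.scale /GRing.mul /= -(pclsK x) -(pclsK y) !pE.
exact/pclsP/cong_mulA.
Qed.

Lemma presented_scaleAr (c : F) (x y : presented) :
  c *: (x * y) = x * (c *: y).
Proof.
rewrite /GRing.scale /GRing.mul /= -(pclsK x) -(pclsK y) !pE; apply/pclsP.
apply: cong_trans (cong_mulA _ _ _) _; apply: cong_trans (cong_sym (cong_mulA _ _ _)).
by apply: cong_mul; [apply: cong_cstC|apply: cong_refl].
Qed.

Lemma pclsD u v : pcls (Add u v) = pcls u + pcls v.
Proof. by rewrite /GRing.add /= paddE. Qed.

Lemma pclsM u v : pcls (Mul u v) = pcls u * pcls v.
Proof. by rewrite /GRing.mul /= pmulE. Qed.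

Lemma pclsC c : pcls (Cst c) = c *: (1 : presented).
Proof.
rewrite /GRing.scale /GRing.one /= pscaleE -pmulE.
by rewrite pmulr1.
Qed.

Lemma pcls_scale c u : pcls (Mul (Cst c) u) = c *: pcls u.
Proof. by rewrite /GRing.scale /= pscaleE. Qed.

Section Action.
Variables (T : Type) (act : X -> (T -> F) -> T -> F) (S : (T -> F) -> Prop).

Let lincomb (c : F) (b b' : T -> F) : T -> F := fun i => c * b i + b' i.

Fixpoint wact (u : word) (b : T -> F) : T -> F :=
  match u with
  | Gen x => act x b
  | Cst c => fun i => c * b i
  | Add u v => fun i => wact u b i + wact v b i
  | Mul u v => wact u (wact v b)
  end.

Hypothesis S0 : S (fun=> 0).
Hypothesis SD : forall c b b', S b -> S b' -> S (lincomb c b b').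
Hypothesis Sact : forall x b, S b -> S (act x b).
Hypothesis actD : forall x c b b',
  act x (lincomb c b b') = lincomb c (act x b) (act x b').
Hypothesis actR : forall u v, R u v -> forall b, S b -> wact u b = wact v b.

Lemma wact_stable u b : S b -> S (wact u b).
Proof.
elim: u b => [x|c|u IHu v IHv|u IHu v IHv] b Sb /=.
- exact: Sact.
- have := SD c Sb S0; congr S; apply/funext => i.
  by rewrite /lincomb addr0.
- have := SD 1 (IHu _ Sb) (IHv _ Sb); congr S; apply/funext => i.
  by rewrite /lincomb mul1r.
- exact/IHu/IHv.
Qed.

Lemma wactD u c b b' : wact u (lincomb c b b') = lincomb c (wact u b) (wact u b').
Proof.
elim: u c b b' => [x|d|u IHu v IHv|u IHu v IHv] c b b' /=.
- exact: actD.
- by apply/funext => i; rewrite /lincomb mulrDr mulrCA.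
- apply/funext => i; rewrite IHu IHv /lincomb mulrDr.
  by rewrite -!addrA; congr (_ + _); rewrite addrCA.
- by rewrite IHv IHu.
Qed.

Lemma wact_cong u v : cong u v -> forall b, S b -> wact u b = wact v b.
Proof.
elim=> //= {u v}.
- by move=> u v _ IH b Sb; rewrite IH.
- by move=> u v w _ IH _ IH' b Sb; rewrite IH // IH'.
- by move=> u u' v v' _ IH _ IH' b Sb; rewrite IH // IH'.
- move=> u u' v v' _ IH _ IH' b Sb.
  by rewrite IH' // IH //; apply: wact_stable.
- by move=> u v w b _; apply/funext => i; rewrite addrA.
- by move=> u v b _; apply/funext => i; rewrite addrC.
- by move=> u b _; apply/funext => i; rewrite mul0r add0r.
- by move=> u b _; apply/funext => i; rewrite mul1r.
- by move=> u b _; apply/funext => i; rewrite !mul0r.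
- move=> u v w b _.
  have -> : (fun i => wact u b i + wact v b i) =
            lincomb 1 (wact u b) (wact v b).
    by apply/funext => i; rewrite /lincomb mul1r.
  by rewrite wactD; apply/funext => i; rewrite /lincomb mul1r.
- move=> c u b _.
  have b0 : wact u (fun=> 0) = fun=> 0.
    have e : (fun=> 0) = lincomb (-1) b b :> (T -> F).
      by apply/funext => i; rewrite /lincomb mulN1r addNr.
    by rewrite {1}e wactD; apply/funext => i; rewrite /lincomb mulN1r addNr.
  have -> : (fun i => c * b i) = lincomb c b (fun=> 0).
    by apply/funext => i; rewrite /lincomb addr0.
  by rewrite wactD b0; apply/funext => i; rewrite /lincomb addr0.
- by move=> c d b _; apply/funext => i; rewrite mulrDl.
- by move=> c d b _; apply/funext => i; rewrite mulrA.
Qed.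

Lemma presented_neq0_act b i : S b -> b i != 0 -> 1 != 0 :> presented.
Proof.
move=> Sb; apply: contra_neq => h.
have /wact_cong/(_ b Sb)/(congr1 (@^~ i)) /= : cong (Cst 1) (Cst 0).
  exact/pclsP.
by rewrite mul1r mul0r.
Qed.

End Action.

Section Lift.
Variables (A : algType F) (f : X -> A).

Fixpoint weval (u : word) : A :=
  match u with
  | Gen x => f x
  | Cst c => c *: 1
  | Add u v => weval u + weval v
  | Mul u v => weval u * weval v
  end.

Hypothesis fR : forall u v, R u v -> weval u = weval v.

Lemma weval_cong u v : cong u v -> weval u = weval v.
Proof.
elim=> //= {u v}.
- by move=> u v w _ -> _ ->.
- by move=> u u' v v' _ -> _ ->.
- by move=> u u' v v' _ -> _ ->.
- by move=> u v w; rewrite addrA.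
- by move=> u v; rewrite addrC.
- by move=> u; rewrite scale0r add0r.
- by move=> u v w; rewrite mulrA.
- by move=> u; rewrite scale1r mul1r.
- by move=> u; rewrite scale0r mul0r.
- by move=> u v w; rewrite mulrDl.
- by move=> u v w; rewrite mulrDr.
- by move=> c u; rewrite -scalerAl -scalerAr mul1r mulr1.
- by move=> c d; rewrite scalerDl.
- by move=> c d; rewrite -scalerAl mul1r scalerA.
Qed.

Definition plift of (forall u v, R u v -> weval u = weval v) :=
  fun x : presented => weval (repr x).

Local Notation lft := (plift fR).

Lemma plift_cls u : lft (pcls u) = weval u.
Proof. exact: weval_cong (cong_repr u). Qed.

Lemma plift_gen x : lft (pgen x) = f x.
Proof. exact: plift_cls. Qed.

Lemma plift_linear : linear lft.
Proof.
move=> c x y; rewrite -(pclsK x) -(pclsK y).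
rewrite -pcls_scale -pclsD !plift_cls /=.
by rewrite -scalerAl mul1r.
Qed.

Lemma plift_monoid_morphism : monoid_morphism lft.
Proof.
split=> [|x y]; first by rewrite /GRing.one /= plift_cls /= scale1r.
by rewrite -(pclsK x) -(pclsK y) -pclsM !plift_cls.
Qed.

HB.instance Definition _ := GRing.isLinear.Build F presented A *:%R lft
  plift_linear.
HB.instance Definition _ := GRing.isMonoidMorphism.Build presented A lft
  plift_monoid_morphism.

Lemma presented_neq0_lift : 1 != 0 :> presented.
Proof.
apply: contra_neq (oner_neq0 A) => h.
by rewrite -[1]plift_monoid_morphism.1 h linear0.
Qed.

End Lift.
End Presentation.

Arguments Cst {F X}.
Arguments Gen {F X}.

Section Enveloping.
Variables (F : fieldType) (L : lieAlgType F).

Inductive env_rel : word F L -> word F L -> Prop :=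
  | env_rel_linear c x y :
      env_rel (Gen (c *: x + y)) (Add (Mul (Cst c) (Gen x)) (Gen y))
  | env_rel_lie x y :
      env_rel (Gen (lie x y))
        (Add (Mul (Gen x) (Gen y)) (Mul (Cst (-1)) (Mul (Gen y) (Gen x)))).

Definition envelope := presented env_rel.

Lemma envelope_neq0 : 1 != 0 :> presented env_rel.
Proof.
apply: (@presented_neq0_lift _ _ _ F^o (fun=> 0)) => u v [c x y|x y] /=.
  by rewrite mulr0 addr0.
by rewrite !mulr0 addr0.
Qed.

HB.instance Definition _ := GRing.PzRing.on envelope.
HB.instance Definition _ := GRing.Lmodule.on envelope.
HB.instance Definition _ := GRing.PzSemiRing_isNonZero.Build envelope envelope_neq0.
HB.instance Definition _ := GRing.Lmodule_isLalgebra.Build F envelope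
  (@presented_scaleAl _ _ _).
HB.instance Definition _ := GRing.Lalgebra_isAlgebra.Build F envelope
  (@presented_scaleAr _ _ _).

Definition env_in (x : L) : envelope := pgen env_rel x.

Lemma env_in_linear : linear env_in.
Proof.
move=> c x y; rewrite /env_in /pgen.
rewrite (pcls_rel (env_rel_linear c x y)).
by rewrite pclsD pcls_scale.
Qed.
HB.instance Definition _ := GRing.isLinear.Build F L envelope *:%R env_in
  env_in_linear.

Lemma env_in_lie x y :
  env_in (lie x y) = env_in x * env_in y - env_in y * env_in x.
Proof.
rewrite /env_in /pgen.
rewrite (pcls_rel (env_rel_lie x y)).
by rewrite pclsD pcls_scale !pclsM scaleN1r.
Qed.

Section EnvLift.
Variables (A : algType F) (f : L -> A).
Hypothesis f_lin : linear f.
Hypothesis f_lie : forall x y, f (lie x y) = f x * f y - f y * f x.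

Lemma env_lift_subproof u v : env_rel u v -> weval f u = weval f v.
Proof.
case=> [c x y|x y] /=; first by rewrite f_lin -scalerAl mul1r.
by rewrite f_lie -scalerAl mul1r scaleN1r.
Qed.

Definition env_lift : envelope -> A := plift env_lift_subproof.

HB.instance Definition _ := GRing.Linear.on env_lift.
HB.instance Definition _ := GRing.RMorphism.on env_lift.

Lemma env_lift_in x : env_lift (env_in x) = f x.
Proof. exact: plift_gen. Qed.

End EnvLift.
End Enveloping.

Section Weyl.
Variable F : fieldType.

Inductive weyl_gen := WeylT | WeylD.

Inductive weyl_rel : word F weyl_gen -> word F weyl_gen -> Prop :=
  | weyl_rel_comm :
      weyl_rel (Mul (Gen WeylD) (Gen WeylT))
               (Add (Mul (Gen WeylT) (Gen WeylD)) (Cst 1)).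

Definition weyl := presented weyl_rel.

Let weyl_act (x : weyl_gen) (b : nat -> F) : nat -> F :=
  match x with
  | WeylT => fun i => if i is j.+1 then b j else 0
  | WeylD => fun i => i.+1%:R * b i.+1
  end.

Lemma weyl_neq0 : 1 != 0 :> presented weyl_rel.
Proof.
apply: (@presented_neq0_act _ _ _ nat weyl_act (fun=> True) _ _ _ _ _
          (fun=> 1) 0 I (oner_neq0 F)) => //.
  move=> [] c b b'; apply/funext => -[|i] /=; rewrite ?mulr0 ?addr0 //.
    by rewrite !mul1r.
  by rewrite mulrDr mulrCA.
move=> u v [] b _; apply/funext => -[|i] /=; first by rewrite add0r.
by rewrite -addn1 natrD mulrDl.
Qed.

HB.instance Definition _ := GRing.PzRing.on weyl.
HB.instance Definition _ := GRing.Lmodule.on weyl.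
HB.instance Definition _ := GRing.PzSemiRing_isNonZero.Build weyl weyl_neq0.
HB.instance Definition _ := GRing.Lmodule_isLalgebra.Build F weyl
  (@presented_scaleAl _ _ _).
HB.instance Definition _ := GRing.Lalgebra_isAlgebra.Build F weyl
  (@presented_scaleAr _ _ _).

Definition weylT : weyl := pgen weyl_rel WeylT.
Definition weylD : weyl := pgen weyl_rel WeylD.

Lemma weyl_comm : weylD * weylT - weylT * weylD = 1.
Proof.
apply/eqP; rewrite subr_eq addrC; apply/eqP.
rewrite /weylD /weylT /pgen -!pclsM.
rewrite (pcls_rel weyl_rel_comm).
by rewrite pclsD pclsC scale1r.
Qed.

End Weyl.

Lemma exists_functional (F : fieldType) (V : lmodType F) (v : V) :
  v != 0 -> exists p : V -> F, scalar p /\ p v = 1.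
Proof.
move=> v0.
pose P (M : set V) := ~ M v /\ forall c x y, M x -> M y -> M (c *: x + y).
have [|M [[Mv ML] Mmax]] := @Zorn_bigcup _ P.
  move=> Q QP Qtot; split=> [[X QX Xv]|c x y [X QX Xx] [Y QY Yy]].
    by case: (QP _ QX).
  case: (Qtot _ _ QX QY) => [XY|YX].
    by exists Y => //; apply: (QP _ QY).2 => //; apply: XY.
  by exists X => //; apply: (QP _ QX).2 => //; apply: YX.
have M0 : M 0.
  apply: contrapT => nM0; apply: (Mmax [set 0]%classic).
    split=> [x Mx|/(_ 0 erefl)//]; case: nM0.
    by have := ML (-1) _ _ Mx Mx; rewrite scaleN1r addNr.
  split=> [/= v0'|c x y /= -> ->]; last by rewrite scaler0 addr0.
  by rewrite v0' eqxx in v0.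
have MZ c x : M x -> M (c *: x) by move=> Mx; rewrite -[_ *: _]addr0; apply: ML.
have MD x y : M x -> M y -> M (x + y).
  by move=> Mx My; rewrite -[x]scale1r; apply: ML.
have ex x : exists c, M (x - c *: v).
  have [Mx|nMx] := pselect (M x); first by exists 0; rewrite scale0r subr0.
  pose N (y : V) := exists c, M (y - c *: x).
  have NM : (M `<` N)%classic.
    split=> [y My|h]; first by exists 0; rewrite scale0r subr0.
    by apply: nMx; apply: h; exists 1; rewrite scale1r subrr.
  have [c Mc] : N v.
    apply: contrapT => nNv; apply: (Mmax N NM); split=> // a y z [c Mc] [d Md].
    exists (a * c + d); have := ML a _ _ Mc Md; congr M.
    by rewrite scalerBr scalerA scalerDl opprD addrACA.
  have c0 : c != 0.
    by apply/eqP => c0; apply: Mv; move: Mc; rewrite c0 scale0r subr0.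
  exists c^-1; have := MZ (- c^-1) _ Mc; congr M.
  by rewrite scalerBr scalerA mulNr mulVf // !scaleNr opprK scale1r addrC.
have [p pP] := choice ex.
have uniq x c d : M (x - c *: v) -> M (x - d *: v) -> c = d.
  move=> Mc Md; apply/eqP; rewrite -subr_eq0; apply/negPn/negP => cd; apply: Mv.
  have := MZ (c - d)^-1 _ (MD _ _ Md (MZ (-1) _ Mc)); congr M.
  rewrite scaleN1r opprB [c *: v - x]addrC addrACA subrr add0r addrC.
  by rewrite -scalerBl scalerA mulVf ?scale1r.
exists p; split=> [c x y|].
  apply: uniq (pP _) _; have := ML c _ _ (pP x) (pP y); congr M.
  by rewrite scalerBr scalerA scalerDl opprD addrACA.
by apply: uniq (pP _) _; rewrite scale1r subrr.
Qed.

(* The tensor product of two algebras over F: generated by the symbols a (x)  *)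
(* b, bilinear in (a, b) and multiplied componentwise. These products show    *)
(* that the symbols span, so as a vector space this is the quotient of the    *)
(* free vector space on A * B by the bilinearity relations.                   *)
Section Tensor.
Variables (F : fieldType) (A B : algType F).

Inductive tensor_rel : word F (A * B) -> word F (A * B) -> Prop :=
  | tensor_rel_linearl c a a' b :
      tensor_rel (Gen (c *: a + a', b))
        (Add (Mul (Cst c) (Gen (a, b))) (Gen (a', b)))
  | tensor_rel_linearr c a b b' :
      tensor_rel (Gen (a, c *: b + b'))
        (Add (Mul (Cst c) (Gen (a, b))) (Gen (a, b')))
  | tensor_rel_mul a a' b b' :
      tensor_rel (Gen (a * a', b * b')) (Mul (Gen (a, b)) (Gen (a', b')))
  | tensor_rel_one : tensor_rel (Gen (1, 1)) (Cst 1).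

Definition tensor := presented tensor_rel.

Let tensor_act (x : A * B) (b : A * B -> F) : A * B -> F :=
  fun y => b (y.1 * x.1, y.2 * x.2).

Lemma tensor_neq0 : 1 != 0 :> presented tensor_rel.
Proof.
have [p [plin p1]] := exists_functional (oner_neq0 A).
have [q [qlin q1]] := exists_functional (oner_neq0 B).
pose S (b : A * B -> F) :=
  (forall y, scalar (fun x => b (x, y))) /\ (forall x, scalar (fun y => b (x, y))).
apply: (@presented_neq0_act _ _ _ _ tensor_act S _ _ _ _ _
          (fun x => p x.1 * q x.2) (1, 1)).
- by split=> [y|x] c z z' /=; rewrite mulr0 addr0.
- move=> c b b' [b1 b2] [b1' b2']; split=> [y|x] d z z' /=.
    by rewrite b1 b1' !mulrDr [c * (d * _)]mulrCA addrACA.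
  by rewrite b2 b2' !mulrDr [c * (d * _)]mulrCA addrACA.
- move=> [x1 x2] b [b1 b2]; split=> [y|x] d z z'; rewrite /tensor_act /=.
    by rewrite mulrDl -scalerAl b1.
  by rewrite mulrDl -scalerAl b2.
- by [].
- move=> u v [c a a' b|c a b b'|a a' b b'|] f [f1 f2]; apply/funext => -[x y].
  + by rewrite /= /tensor_act /= mulrDr -scalerAr f1.
  + by rewrite /= /tensor_act /= mulrDr -scalerAr f2.
  + by rewrite /= /tensor_act /= !mulrA.
  + by rewrite /= /tensor_act /= !mulr1 mul1r.
- split=> [y|x] c z z' /=; first by rewrite plin mulrDl mulrA.
  by rewrite qlin mulrDr mulrCA.
- by rewrite /= p1 q1 mulr1 oner_neq0.
Qed.

HB.instance Definition _ := GRing.PzRing.on tensor.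
HB.instance Definition _ := GRing.Lmodule.on tensor.
HB.instance Definition _ := GRing.PzSemiRing_isNonZero.Build tensor tensor_neq0.
HB.instance Definition _ := GRing.Lmodule_isLalgebra.Build F tensor
  (@presented_scaleAl _ _ _).
HB.instance Definition _ := GRing.Lalgebra_isAlgebra.Build F tensor
  (@presented_scaleAr _ _ _).

Definition tens (a : A) (b : B) : tensor := pgen tensor_rel (a, b).

Lemma tens_linearl b : linear (tens^~ b).
Proof.
move=> c a a'; rewrite /tens /pgen.
rewrite (pcls_rel (tensor_rel_linearl c a a' b)).
by rewrite pclsD pcls_scale.
Qed.

Lemma tens_linearr a : linear (tens a).
Proof.
move=> c b b'; rewrite /tens /pgen.
rewrite (pcls_rel (tensor_rel_linearr c a b b')).
by rewrite pclsD pcls_scale.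
Qed.

HB.instance Definition _ a := GRing.isLinear.Build F B tensor *:%R (tens a)
  (tens_linearr a).

Lemma tensM a a' b b' : tens a b * tens a' b' = tens (a * a') (b * b').
Proof.
rewrite /tens /pgen -pclsM; apply/pclsP/cong_sym/cong_rel.
exact: tensor_rel_mul.
Qed.

Lemma tens11 : tens 1 1 = 1.
Proof.
rewrite /tens /pgen (pcls_rel tensor_rel_one).
by rewrite pclsC scale1r.
Qed.

End Tensor.

(* f : witt F stands for the vector field f * d/dt of the Witt algebra. *)
Section Witt.
Variable F : fieldType.

Definition witt : Type := {poly F}.
HB.instance Definition _ := GRing.Lmodule.on witt.

Definition witt_lie (f g : witt) : witt :=
  (f : {poly F}) * g^`() - f^`() * g.

Lemma witt_lie_linearl c f g h :
  witt_lie (c *: f + g) h = c *: witt_lie f h + witt_lie g h.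
Proof.
rewrite /witt_lie derivD derivZ !mulrDl -!scalerAl scalerBr opprD.
by rewrite !addrA; congr (_ - _); rewrite addrAC.
Qed.

Lemma witt_liexx f : witt_lie f f = 0.
Proof. by rewrite /witt_lie mulrC subrr. Qed.

Lemma witt_lieC f g : witt_lie f g = - witt_lie g f.
Proof. by rewrite /witt_lie opprB mulrC [g * _]mulrC. Qed.

Lemma witt_lie_linearr c f g h :
  witt_lie h (c *: f + g) = c *: witt_lie h f + witt_lie h g.
Proof.
by rewrite witt_lieC witt_lie_linearl opprD -scalerN -!witt_lieC.
Qed.

Lemma witt_lie_jacobi f g h :
  witt_lie f (witt_lie g h) + witt_lie g (witt_lie h f)
  + witt_lie h (witt_lie f g) = 0.
Proof.
rewrite /witt_lie !derivB !derivM; ring.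
Qed.

Lemma witt_lie_mon i j :
  witt_lie 'X^(i.+1) 'X^(j.+1) = (j%:R - i%:R) *: 'X^((i + j).+1).
Proof.
rewrite /witt_lie !derivXn /= mulrnAl mulrnAr -!exprD addSn addnS.
by rewrite scalerBl !scaler_nat !mulrSr opprD addrACA subrr addr0.
Qed.

HB.instance Definition _ := isLieAlgebra.Build F witt
  witt_lie_linearl witt_lie_linearr witt_liexx witt_lie_jacobi.

(* e_i = t^(i+1) * d/dt; the value is junk for i < -1. *)
Definition witt_e (i : int) : witt := 'X^`|(i + 1)%R|%N.

(* W_{>= n} for n >= 0, that is, the span of the e_i with i >= n. *)
Definition witt_ge (n : nat) : {pred witt} :=
  [pred f : {poly F} | [forall i : 'I_n.+1, f`_i == 0]].

Lemma witt_geP n (f : {poly F}) :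
  reflect (forall i, (i <= n)%N -> f`_i = 0) (f \in witt_ge n).
Proof.
apply: (iffP forallP) => [h i le_in|h i].
  by apply/eqP; rewrite -ltnS in le_in; exact: (h (Ordinal le_in)).
by apply/eqP/h; rewrite -ltnS.
Qed.

Lemma witt_ge_submod n : submod_closed (witt_ge n).
Proof.
split=> [|c f g /witt_geP hf /witt_geP hg]; apply/witt_geP => i le_in.
  by rewrite coef0.
by rewrite coefD coefZ hf // hg // mulr0 addr0.
Qed.
HB.instance Definition _ n :=
  GRing.isSubmodClosed.Build F witt (witt_ge n) (witt_ge_submod n).

Lemma witt_ge_lie n f g :
  f \in witt_ge 0 -> g \in witt_ge n -> lie f g \in witt_ge n.
Proof.
move=> /witt_geP hf /witt_geP hg; apply/witt_geP => i le_in.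
rewrite /lie /= /witt_lie coefB.
have -> : ((f : {poly F}) * g^`())`_i = 0.
  rewrite coefM big1 // => -[[|j] /= ltj] _; first by rewrite hf ?mul0r.
  rewrite coef_deriv hg ?mul0rn ?mulr0 //.
  lia.
rewrite sub0r coefM big1 ?oppr0 // => j _.
by rewrite hg ?mulr0 // (leq_trans (leq_subr _ _)).
Qed.

End Witt.

Arguments witt_e {F} i.
Arguments witt_ge F n : clear implicits.

Section Witt0.
Variable F : fieldType.

(* W_{>= 0}. *)
Record witt0 := Witt0 { witt0_val :> witt F; _ : witt0_val \in witt_ge F 0 }.

HB.instance Definition _ := [isSub for witt0_val].
HB.instance Definition _ := [Choice of witt0 by <:].
HB.instance Definition _ := [SubChoice_isSubLmodule of witt0 by <:].

Lemma witt0_lie_subproof (x y : witt0) : lie (val x) (val y) \in witt_ge F 0.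
Proof. exact: witt_ge_lie (valP x) (valP y). Qed.

Definition witt0_lie (x y : witt0) : witt0 := Witt0 (witt0_lie_subproof x y).

Lemma witt0_lie_linearl c x y z :
  witt0_lie (c *: x + y) z = c *: witt0_lie x z + witt0_lie y z.
Proof. by apply: val_inj; rewrite /= lie_linearl. Qed.

Lemma witt0_lie_linearr c x y z :
  witt0_lie z (c *: x + y) = c *: witt0_lie z x + witt0_lie z y.
Proof. by apply: val_inj; rewrite /= lie_linearr. Qed.

Lemma witt0_liexx x : witt0_lie x x = 0.
Proof. by apply: val_inj; rewrite /= liexx. Qed.

Lemma witt0_lie_jacobi x y z :
  witt0_lie x (witt0_lie y z) + witt0_lie y (witt0_lie z x)
  + witt0_lie z (witt0_lie x y) = 0.
Proof. by apply: val_inj; rewrite /= lie_jacobi. Qed.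

HB.instance Definition _ := isLieAlgebra.Build F witt0
  witt0_lie_linearl witt0_lie_linearr witt0_liexx witt0_lie_jacobi.

End Witt0.

(* g_n = W_{>= 0} / W_{>= n}. *)
Section WittQuot.
Variables (F : fieldType) (n : nat).

Definition witt0_ge : {pred witt0 F} := [pred x | val x \in witt_ge F n].

Lemma witt0_geE x : (x \in witt0_ge) = (val x \in witt_ge F n).
Proof. by []. Qed.

Lemma witt0_ge_submod : submod_closed witt0_ge.
Proof.
split=> [|c x y]; rewrite !witt0_geE ?raddf0 ?rpred0 // => hx hy.
by rewrite linearP /= rpredD // rpredZ.
Qed.
HB.instance Definition _ :=
  GRing.isSubmodClosed.Build F (witt0 F) witt0_ge witt0_ge_submod.

Definition witt_quot := Quotient.quot witt0_ge.
HB.instance Definition _ := GRing.Zmodule.on witt_quot.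

Definition wq (x : witt0 F) : witt_quot := \pi_witt_quot x.

Lemma wqP x y : wq x = wq y <-> val (x - y) \in witt_ge F n.
Proof.
split=> [/eqP|h]; last apply/eqP; by rewrite /wq -Quotient.idealrBE.
Qed.

Lemma wqK x : wq (repr x) = x. Proof. exact: reprK. Qed.

Lemma wqB : {morph wq : x y / x - y}.
Proof. exact: raddfB. Qed.

Definition wq_scale (c : F) (x : witt_quot) := wq (c *: repr x).
Definition wq_lie (x y : witt_quot) := wq (lie (repr x) (repr y)).

Lemma wq_repr x : val (repr (wq x) - x) \in witt_ge F n.
Proof. by apply/wqP; rewrite wqK. Qed.

Lemma wq_scaleE c x : wq_scale c (wq x) = wq (c *: x).
Proof. by apply/wqP; rewrite -scalerBr linearZ /= rpredZ // wq_repr. Qed.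

Lemma wq_lieE x y : wq_lie (wq x) (wq y) = wq (lie x y).
Proof.
apply/wqP; set x' := repr _; set y' := repr _.
have -> : lie x' y' - lie x y = lie x' (y' - y) - lie y (x' - x).
  have lieB (z u v : witt0 F) : lie z (u - v) = lie z u - lie z v.
    by rewrite addrC -scaleN1r lie_linearr scaleN1r addrC.
  have lieC (u v : witt0 F) : lie u v = - lie v u.
    by apply: val_inj; apply: witt_lieC.
  by rewrite !lieB [lie y x']lieC [lie y x]lieC opprK opprD opprK addrA subrK.
rewrite raddfB rpredB //; apply: witt_ge_lie; do ?exact: valP; exact: wq_repr.
Qed.

Lemma wq_scaleA c d x : wq_scale c (wq_scale d x) = wq_scale (c * d) x.
Proof. by rewrite -(wqK x) !wq_scaleE scalerA. Qed.

Lemma wq_scale1 x : wq_scale 1 x = x.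
Proof. by rewrite -(wqK x) wq_scaleE scale1r. Qed.

Lemma wqD : {morph wq : x y / x + y}.
Proof. exact: raddfD. Qed.

Lemma wq_scaleDr : right_distributive wq_scale +%R.
Proof.
by move=> c x y; rewrite -(wqK x) -(wqK y) !wq_scaleE -!wqD -scalerDr wq_scaleE.
Qed.

Lemma wq_scaleDl x : {morph wq_scale^~ x : c d / c + d}.
Proof. by move=> c d; rewrite -(wqK x) !wq_scaleE -wqD -scalerDl. Qed.

HB.instance Definition _ := GRing.Zmodule_isLmodule.Build F witt_quot
  wq_scaleA wq_scale1 wq_scaleDr wq_scaleDl.

Lemma wq_linear : linear wq.
Proof. by move=> c x y; rewrite wqD -wq_scaleE. Qed.
HB.instance Definition _ := GRing.isLinear.Build F (witt0 F) witt_quot *:%R wq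
  wq_linear.

Lemma wq_lie_linearl c x y z :
  wq_lie (c *: x + y) z = c *: wq_lie x z + wq_lie y z.
Proof.
rewrite -(wqK x) -(wqK y) -(wqK z) -linearP !wq_lieE.
by rewrite lie_linearl linearP.
Qed.

Lemma wq_lie_linearr c x y z :
  wq_lie z (c *: x + y) = c *: wq_lie z x + wq_lie z y.
Proof.
rewrite -(wqK x) -(wqK y) -(wqK z) -linearP !wq_lieE.
by rewrite lie_linearr linearP.
Qed.

Lemma wq_liexx x : wq_lie x x = 0.
Proof. by rewrite -(wqK x) wq_lieE liexx linear0. Qed.

Lemma wq_lie_jacobi x y z :
  wq_lie x (wq_lie y z) + wq_lie y (wq_lie z x) + wq_lie z (wq_lie x y) = 0.
Proof.
by rewrite -(wqK x) -(wqK y) -(wqK z) !wq_lieE -!linearD lie_jacobi linear0.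
Qed.

HB.instance Definition _ := isLieAlgebra.Build F witt_quot
  wq_lie_linearl wq_lie_linearr wq_liexx wq_lie_jacobi.

Lemma witt0_mon_subproof i : ('X^(i.+1) : witt F) \in witt_ge F 0.
Proof. by apply/witt_geP => j; rewrite leqn0 => /eqP ->; rewrite coefXn. Qed.

(* v_i is the class of e_i = t^(i+1) * d/dt. *)
Definition witt_v (i : nat) : witt_quot := wq (Witt0 (witt0_mon_subproof i)).

Lemma witt_v_ge i : (n <= i)%N -> witt_v i = 0.
Proof.
move=> le_ni; rewrite -(linear0 wq); apply/wqP; rewrite subr0.
by apply/witt_geP => j le_jn; rewrite coefXn ltn_eqF // ltnS (leq_trans le_jn).
Qed.

Lemma witt_v_lie i j :
  lie (witt_v i) (witt_v j) = (j%:R - i%:R) *: witt_v (i + j).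
Proof.
rewrite /lie /= wq_lieE -linearZ_LR; congr wq; apply: val_inj.
exact: witt_lie_mon.
Qed.

End WittQuot.

Section Nderiv.
Variable F : fieldType.
Implicit Types p q : {poly F}.

Lemma nderivMX p k : (p * 'X)^`N(k.+1) = p^`N(k) + p^`N(k.+1) * 'X.
Proof. by have := nderivnMXaddC k p 0; rewrite polyC0 addr0. Qed.

Lemma nderivM p q k :
  (p * q)^`N(k) = \sum_(i < k.+1) p^`N(i) * q^`N(k - i).
Proof.
elim/poly_ind: p k => [|p c IH] k.
  by rewrite mul0r linear0 big1 // => i _; rewrite linear0 mul0r.
have -> : (p * 'X + c%:P) * q = p * q * 'X + c *: q.
  by rewrite mulrDl mulrAC mul_polyC.
rewrite linearD /= linearZ /= big_ord_recl /= subn0 nderivn0 mulrDl mul_polyC.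
rewrite [RHS]addrAC; congr (_ + _).
case: k => [|k].
  by rewrite big_ord0 addr0 !nderivn0 mulrAC.
rewrite nderivMX !IH [X in _ + X * _]big_ord_recl /= subn0 nderivn0 mulrDl addrCA mulrAC.
congr (_ + _); rewrite big_distrl /= -big_split /=.
apply: eq_bigr => i _; rewrite /bump /= !add1n subSS nderivnMXaddC mulrDl.
by rewrite mulrAC.
Qed.

Lemma deriv_nderiv p k : (p^`N(k))^`() = p^`N(k.+1) *+ k.+1.
Proof.
apply/polyP => i; rewrite coef_deriv coefMn !coef_nderivn -!mulrnA.
rewrite addnS addSn; congr (_ *+ _).
have := mul_bin_left (k + i).+1 k; rewrite -addnS addKn addnS.
by rewrite [RHS]mulnC => <-; rewrite mulnC.
Qed.

Lemma nderiv_deriv p k : (p^`())^`N(k) = p^`N(k.+1) *+ k.+1.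
Proof.
apply/polyP => i; rewrite coefMn !coef_nderivn coef_deriv -!mulrnA.
rewrite addSn; congr (_ *+ _).
by rewrite mul_bin_diag mulnC.
Qed.

Lemma nderiv_witt_lie (f g : {poly F}) k :
  (witt_lie f g)^`N(k.+1) =
    f * (g^`N(k.+1))^`() - (f^`N(k.+1))^`() * g
    + \sum_(i < k.+1) (f^`N(i.+1) * g^`N((k - i).+1)) *+ (k - i)
    - \sum_(i < k.+1) (f^`N(i.+1) * g^`N((k - i).+1)) *+ i.
Proof.
rewrite /witt_lie linearB /= !nderivM !deriv_nderiv.
rewrite big_ord_recl /= subn0 nderivn0 nderiv_deriv.
rewrite [X in _ - X]big_ord_recr /= subnn nderivn0 nderiv_deriv.
rewrite [X in _ - (X + _)](eq_bigr (fun i : 'I_k.+1 =>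
  (f^`N(i.+1) * g^`N((k - i).+1)) *+ i + f^`N(i.+1) * g^`N((k - i).+1))); last first.
  by move=> i _; rewrite nderiv_deriv mulrnAl mulrSr subSn // -ltnS.
rewrite [X in _ + X - _](eq_bigr (fun i : 'I_k.+1 =>
  (f^`N(i.+1) * g^`N((k - i).+1)) *+ (k - i) + f^`N(i.+1) * g^`N((k - i).+1))); last first.
  by move=> i _; rewrite /bump /= add1n subSS nderiv_deriv mulrnAr mulrSr.
rewrite !big_split /=; ring.
Qed.

End Nderiv.

Lemma sum_diag (V : zmodType) n (H : nat -> nat -> V) :
  (forall i j, (n <= i + j)%N -> H i j = 0) ->
  \sum_(i < n) \sum_(j < n) H i j =
  \sum_(k < n) \sum_(i < k.+1) H i (k - i)%N.
Proof.
move=> H0.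
transitivity (\sum_(i < n) \sum_(k < n | (i <= k)%N) H i (k - i)%N).
  apply: eq_bigr => i _.
  rewrite -(big_mkord xpredT (H i)) (@big_cat_nat _ _ _ (n - i)) //=; last first.
    exact: leq_subr.
  rewrite [X in _ + X]big_nat_cond [X in _ + X]big1 ?addr0; last first.
    by move=> j /andP[/andP[hj _] _]; apply: H0; rewrite -leq_subLR.
  rewrite -(big_mkord (fun k => i <= k)%N (fun k => H i (k - i)%N)).
  rewrite [RHS](@big_cat_nat _ _ _ i) //=; last exact: ltnW.
  rewrite [X in _ = X + _]big_nat_cond [X in _ = X + _]big1 ?add0r; last first.
    by move=> k /andP[/andP[_ hk]]; rewrite leqNgt hk.
  rewrite (_ : \sum_(i <= k < n | _) _ =
               \sum_(0 + i <= k < n | (i <= k)%N) H i (k - i)%N); last by rewrite add0n.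
  rewrite big_addn.
  by apply: eq_big => [k|k _]; rewrite ?leq_addl ?addnK // add0n.
rewrite (exchange_big_dep xpredT) //=; apply: eq_bigr => k _.
by rewrite (big_ord_widen n (fun i => H i (k - i)%N)).
Qed.

Section Orbit.
Variables (F : fieldType) (n : nat).

(* T_n. *)
Definition orbit_alg := tensor (weyl F) (envelope (witt_quot F n)).
HB.instance Definition _ := GRing.Algebra.on orbit_alg.

Hypothesis charF0 : [pchar F] =i pred0.

Definition orbit_fun (f : witt F) : orbit_alg :=
  tens (horner_alg (weylT F) f * weylD F) 1
  + \sum_(i < n) tens (horner_alg (weylT F) ((i.+1)`!%:R^-1 *: f^`(i.+1)))
                      (env_in (witt_v F n i)).

Let E (p : {poly F}) : orbit_alg := tens (horner_alg (weylT F) p) 1.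
Let D : orbit_alg := tens (weylD F) 1.
Let V i : orbit_alg := tens 1 (env_in (witt_v F n i)).

Let E_linear : linear E.
Proof. by move=> c p q; rewrite /E linearP /= mulr_algl tens_linearl. Qed.
Let ED p q : E (p + q) = E p + E q.
Proof. by have := E_linear 1 p q; rewrite !scale1r. Qed.
Let EZ c p : E (c *: p) = c *: E p.
Proof.
have E0 : E 0 = 0.
  by have := ED 0 0; rewrite addr0 => /(congr1 (+%R^~ (- E 0))); rewrite subrr addrK.
by have := E_linear c p 0; rewrite E0 !addr0.
Qed.
Let EB p q : E (p - q) = E p - E q.
Proof. by rewrite ED -scaleN1r EZ scaleN1r. Qed.
Let EMn p k : E (p *+ k) = E p *+ k.
Proof. by rewrite -scaler_nat EZ scaler_nat. Qed.
Let E_sum k (p : nat -> {poly F}) : E (\sum_(i < k) p i) = \sum_(i < k) E (p i).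
Proof.
elim: k => [|k IH]; last by rewrite !big_ord_recr ED IH.
by rewrite !big_ord0; have := EB 0 0; rewrite !subrr.
Qed.
Let EM p q : E (p * q) = E p * E q.
Proof. by rewrite /E tensM rmorphM mulr1. Qed.

Let weyl_DE (p : {poly F}) : weylD F * horner_alg (weylT F) p =
  horner_alg (weylT F) p * weylD F + horner_alg (weylT F) p^`().
Proof.
elim/poly_ind: p => [|p c IH].
  by rewrite derivC !rmorph0 mulr0 mul0r addr0.
rewrite derivMXaddC !rmorphD !rmorphM /= !horner_algX !horner_algC.
have DT : weylD F * weylT F = weylT F * weylD F + 1.
  by rewrite -(weyl_comm F) addrC subrK.
rewrite mulrDr mulrA IH mulrDl -mulrA DT mulrDr mulr1 mulrA -scalerAr mulr1.
rewrite mulrDl mulr_algl -!addrA; congr (_ + _).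
by rewrite addrA addrC.
Qed.

Let DE p : D * E p = E p * D + E p^`().
Proof.
rewrite /D /E !tensM !mulr1 weyl_DE.
by have := @tens_linearl _ (weyl F) (envelope (witt_quot F n)) 1 1 (horner_alg (weylT F) p * weylD F)
  (horner_alg (weylT F) p^`()); rewrite !scale1r; apply.
Qed.
Let DV i : D * V i = V i * D.
Proof. by rewrite /D /V !tensM !mulr1 !mul1r. Qed.
Let VE i p : V i * E p = E p * V i.
Proof. by rewrite /E /V !tensM !mulr1 !mul1r. Qed.
Let VV i j : V i * V j - V j * V i = (j%:R - i%:R) *: V (i + j)%N.
Proof.
by rewrite /V !tensM !mulr1 -linearB -env_in_lie witt_v_lie !linearZ.
Qed.
Let V0 i : (n <= i)%N -> V i = 0.
Proof. by move=> le_ni; rewrite /V witt_v_ge // !linear0. Qed.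

Let orbit_funE f :
  orbit_fun f = E f * D + \sum_(i < n) E f^`N(i.+1) * V i.
Proof.
rewrite /orbit_fun /E /D /V tensM mulr1; congr (_ + _).
apply: eq_bigr => i _; rewrite tensM mulr1 mul1r; congr tens; congr horner_alg.
rewrite nderivn_def -scaler_nat scalerA mulVf ?scale1r //.
by rewrite (pcharf0P _).1 // -lt0n fact_gt0.
Qed.

Let R (f g : {poly F}) : orbit_alg :=
  E (f * g^`()) * D + \sum_(j < n) E (f * (g^`N(j.+1))^`()) * V j
  + \sum_(i < n) \sum_(j < n) E (f^`N(i.+1) * g^`N(j.+1)) * (V i * V j).
Let S (f g : {poly F}) : orbit_alg :=
  E (f * g) * D * D
  + (\sum_(j < n) E (f * g^`N(j.+1)) * V j * D
     + \sum_(j < n) E (g * f^`N(j.+1)) * V j * D).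

Let SC f g : S f g = S g f.
Proof. by rewrite /S [f * g]mulrC [X in _ + X]addrC. Qed.

Let orbit_prod (f g : witt F) : orbit_fun f * orbit_fun g = S f g + R f g.
Proof.
rewrite !orbit_funE mulrDl !mulrDr.
have -> : E f * D * (E g * D) = E (f * g) * D * D + E (f * g^`()) * D.
  by rewrite mulrA -[E f * D * E g]mulrA DE mulrDr mulrDl !EM !mulrA.
have -> : E f * D * (\sum_(i < n) E g^`N(i.+1) * V i) =
    \sum_(j < n) E (f * g^`N(j.+1)) * V j * D
    + \sum_(j < n) E (f * (g^`N(j.+1))^`()) * V j.
  rewrite big_distrr -big_split /=; apply: eq_bigr => i _.
  rewrite mulrA -[E f * D * _]mulrA DE mulrDr mulrDl mulrA -EM -EM.
  by rewrite -mulrA DV mulrA.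
have -> : (\sum_(i < n) E f^`N(i.+1) * V i) * (E g * D) =
    \sum_(j < n) E (g * f^`N(j.+1)) * V j * D.
  rewrite big_distrl /=; apply: eq_bigr => i _.
  by rewrite mulrA -[E _ * V i * E g]mulrA VE mulrA -EM [f^`N(_) * g]mulrC.
have -> : (\sum_(i < n) E f^`N(i.+1) * V i) * (\sum_(i < n) E g^`N(i.+1) * V i)
    = \sum_(i < n) \sum_(j < n) E (f^`N(i.+1) * g^`N(j.+1)) * (V i * V j).
  rewrite big_distrl /=; apply: eq_bigr => i _.
  rewrite big_distrr /=; apply: eq_bigr => j _.
  by rewrite mulrA -[E _ * V i * E _]mulrA VE mulrA -EM -mulrA.
by rewrite /S /R [LHS](AC ((2*2)*2) ((1*(3*5))*((2*4)*6))%AC).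
Qed.

Lemma orbit_lie (f g : witt F) :
  orbit_fun (lie f g) = orbit_fun f * orbit_fun g - orbit_fun g * orbit_fun f.
Proof.
rewrite !orbit_prod SC opprD addrACA subrr add0r orbit_funE.
have -> : R f g - R g f =
    E (witt_lie f g) * D
    + \sum_(k < n) E (f * (g^`N(k.+1))^`() - (f^`N(k.+1))^`() * g) * V k
    + (\sum_(i < n) \sum_(j < n) E (f^`N(i.+1) * g^`N(j.+1)) * (V i * V j)
       - \sum_(i < n) \sum_(j < n) E (g^`N(i.+1) * f^`N(j.+1)) * (V i * V j)).
  rewrite /R !opprD addrACA; congr (_ + _); rewrite addrACA; congr (_ + _).
    by rewrite -mulrBl -EB /witt_lie [f^`() * g]mulrC.
  rewrite -sumrB; apply: eq_bigr => k _.
  by rewrite -mulrBl -EB [_^`() * g]mulrC.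
rewrite [X in _ - X]exchange_big -sumrB /= -addrA; congr (_ + _).
rewrite [X in _ = _ + X](eq_bigr (fun i : 'I_n => \sum_(j < n)
    (j%:R - i%:R) *: (E (f^`N(i.+1) * g^`N(j.+1)) * V (i + j)%N))); last first.
  move=> i _; rewrite -sumrB; apply: eq_bigr => j _.
  by rewrite [g^`N(_) * _]mulrC -mulrBr VV scalerAr.
rewrite (sum_diag (H := fun i j =>
    (j%:R - i%:R) *: (E (f^`N(i.+1) * g^`N(j.+1)) * V (i + j)%N))); last first.
  by move=> i j le_n; rewrite V0 // mulr0 scaler0.
rewrite -big_split /=; apply: eq_bigr => k _.
rewrite [lie f g]/(witt_lie f g) nderiv_witt_lie -addrA ED mulrDl; congr (_ + _).
rewrite -sumrB (E_sum _ (fun i => (f^`N(i.+1) * g^`N((k - i).+1)) *+ (k - i)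
  - (f^`N(i.+1) * g^`N((k - i).+1)) *+ i)) big_distrl /=.
apply: eq_bigr => i _.
have le_ik : (i <= k)%N by rewrite -ltnS.
rewrite EB (EMn _ (k - i)) (EMn _ i) (subnKC le_ik) scalerBl !scaler_nat.
by rewrite mulrBl !mulrnAl.
Qed.

Lemma orbit_linear : linear orbit_fun.
Proof.
move=> c f g; rewrite !orbit_funE E_linear mulrDl scalerDr scalerAl.
rewrite addrACA; congr (_ + _); rewrite scaler_sumr -big_split /=.
apply: eq_bigr => i _.
by rewrite linearP E_linear mulrDl scalerAl.
Qed.

(* Psi_n. *)
Definition orbit_hom : envelope (witt F) -> orbit_alg :=
  env_lift orbit_linear orbit_lie.
HB.instance Definition _ := GRing.Linear.on orbit_hom.
HB.instance Definition _ := GRing.RMorphism.on orbit_hom.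

Lemma orbit_hom_in f : orbit_hom (env_in f) = orbit_fun f.
Proof. exact: env_lift_in. Qed.

End Orbit.

(* Omega^(m)_{k,s}, meant for s >= -1 and k >= m - 1. *)
Definition differentiator (F : fieldType) (m : nat) (k s : int) :
    envelope (witt F) :=
  \sum_(i < m.+1)
    ((-1) ^+ i *+ 'C(m, i) : F) *:
      (env_in (witt_e (k - i%:Z)) * env_in (witt_e (s + i%:Z))).

Section Ideals.
Variable R : pzRingType.

(* y lies in the two-sided ideal generated by x. *)
Definition principal_ideal (x y : R) : Prop :=
  exists (m : nat) (a b : 'I_m -> R), y = \sum_i a i * x * b i.

(* I is a left (resp. right) ideal with finitely many generators. *)
Definition left_fg (I : R -> Prop) : Prop :=
  exists (m : nat) (g : 'I_m -> R),
    forall y, I y <-> exists a : 'I_m -> R, y = \sum_i a i * g i.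

Definition right_fg (I : R -> Prop) : Prop :=
  exists (m : nat) (g : 'I_m -> R),
    forall y, I y <-> exists a : 'I_m -> R, y = \sum_i g i * a i.

End Ideals.

(* Main.v *)
Require Import Defs.
From HB Require Import structures.
From mathcomp Require Import all_boot all_order all_algebra.
From mathcomp Require Import ssrcomplements mpoly.
From mathcomp Require Import ring zify.
From mathcomp Require boolp.

Set Implicit Arguments.
Unset Strict Implicit.
Unset Printing Implicit Defensive.

Import GRing.Theory.
Local Open Scope ring_scope.

(** Write an element f d/dt . g d/dt of the enveloping algebra U as f(x) g(y).
    The orbit homomorphism applies to both factors derivatives of order at most n,
    and one more to the second, and then restricts to the diagonal x = y, so it
    kills (x - y)^(2n+2) k[x, y]. The differentiator is (x - y)^(2n+2), and the
    adjoint action produces all of (x - y)^(2n+2) k[x, y] from it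
    ([principal_ideal_wprod]).

    These relations suffice. Interpolation at the 2n+2 exponents 0, ..., n and
    d - n, ..., d expresses x^a y^b, with a, b > n and a + b = d, modulo
    (x - y)^(2n+2), by monomials one of whose exponents is at most n. Hence U is
    spanned, modulo the ideal of the differentiator, by sorted products of the
    t^i d/dt in which at most one exponent i exceeds n ([normal_spanT]). Their
    images are independent ([normal_orbit_free]): the orbit algebra acts on
    functions of n-jets, every t^b d/dt by a vector field, and products of vector
    fields are detected by their principal symbols. In suitable coordinates z of
    the cotangent space the symbols of 1, t, ..., t^n are z_0, ..., z_n, whereas
    that of t^b with b > n is a polynomial in the base point t with leading term
    a nonzero multiple of t^b z_0, which separates the monomials
    ([normal_symbols_free]).

    If the kernel were a finitely generated left ideal, the space of linear
    functionals on it that vanish on the products of a vector field with an element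
    of the kernel would be finite-dimensional. It is not: the next orbit
    homomorphism, of level n + 1, maps (x - y)^(2n+2) h(x, y) to a nonzero multiple
    of h(t, t) v_n^2 ([orbit_hom_succ]). In a module in which v_n acts by the
    multiplication by a monomial, up to sign, the multiples of v_n^2 become
    densities in t, with vector fields acting by Lie derivatives. Integration over
    t, which is the constant term after a Fourier transform, is invariant, and
    applying it to the images of different vectors of the module gives infinitely
    many functionals ([coinvariant_functionals]). The antipode of U fixes the
    differentiator and exchanges left and right ideals. *)

(** * Enveloping algebras *)

Section Envelope.
Variables (F : fieldType) (L : lieAlgType F).

Lemma env_ind (P : envelope L -> Prop) :
  (forall x, P (env_in x)) -> (forall c, P (c *: 1)) ->
  (forall u v, P u -> P v -> P (u + v)) ->
  (forall u v, P u -> P v -> P (u * v)) ->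
  forall u, P u.
Proof.
move=> Pgen Pcst Padd Pmul u; rewrite -(pclsK u).
elim: (repr u) => [x|c|v Pv w Pw|v Pv w Pw].
- exact: Pgen.
- by rewrite pclsC; exact: Pcst.
- by rewrite pclsD; exact: Padd.
- by rewrite pclsM; exact: Pmul.
Qed.

(** Reversing the product under a separate name turns the antipode into a lift
    from the universal property. *)
Definition converse_envelope : Type := envelope L.
HB.instance Definition _ := GRing.Lmodule.on converse_envelope.

Definition converse_mul (u v : converse_envelope) : converse_envelope :=
  (v : envelope L) * u.

Lemma converse_mulA : associative converse_mul.
Proof. by move=> u v w; rewrite /converse_mul mulrA. Qed.
Lemma converse_mul1 : left_id (1 : envelope L) converse_mul.
Proof. by move=> u; rewrite /converse_mul mulr1. Qed.
Lemma converse_mulr1 : right_id (1 : envelope L) converse_mul.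
Proof. by move=> u; rewrite /converse_mul mul1r. Qed.
Lemma converse_mulDl : left_distributive converse_mul +%R.
Proof. by move=> u v w; rewrite /converse_mul mulrDr. Qed.
Lemma converse_mulDr : right_distributive converse_mul +%R.
Proof. by move=> u v w; rewrite /converse_mul mulrDl. Qed.
HB.instance Definition _ := GRing.Zmodule_isNzRing.Build converse_envelope
  converse_mulA converse_mul1 converse_mulr1 converse_mulDl converse_mulDr
  (oner_neq0 (envelope L)).

Lemma converse_scaleAl (c : F) (u v : converse_envelope) :
  c *: converse_mul u v = converse_mul (c *: u) v.
Proof. exact: (scalerAr c (v : envelope L) (u : envelope L)). Qed.
HB.instance Definition _ :=
  GRing.Lmodule_isLalgebra.Build F converse_envelope converse_scaleAl.

Lemma converse_scaleAr (c : F) (u v : converse_envelope) :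
  c *: converse_mul u v = converse_mul u (c *: v).
Proof. exact: (scalerAl c (v : envelope L) (u : envelope L)). Qed.
HB.instance Definition _ :=
  GRing.Lalgebra_isAlgebra.Build F converse_envelope converse_scaleAr.

Definition env_opp (x : L) : converse_envelope := - env_in x.

Lemma env_opp_linear : linear env_opp.
Proof. by move=> c x y; rewrite /env_opp linearP opprD scalerN. Qed.

Lemma env_opp_lie x y :
  env_opp (lie x y) = env_opp x * env_opp y - env_opp y * env_opp x.
Proof.
by rewrite /env_opp env_in_lie opprB; congr (_ - _); exact: (esym (mulrNN _ _)).
Qed.

Definition antipode (u : envelope L) : envelope L :=
  env_lift env_opp_linear env_opp_lie u.

Lemma antipode_in x : antipode (env_in x) = - env_in x.
Proof. exact: (env_lift_in env_opp_linear env_opp_lie). Qed.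

Lemma antipode_linear : linear antipode.
Proof. by move=> c x y; rewrite /antipode linearP. Qed.
HB.instance Definition _ := GRing.isLinear.Build F (envelope L) (envelope L)
  *:%R antipode antipode_linear.

Lemma antipodeM u v : antipode (u * v) = antipode v * antipode u.
Proof. by rewrite /antipode rmorphM. Qed.

Lemma antipode1 : antipode 1 = 1.
Proof. by rewrite /antipode rmorph1. Qed.

Lemma antipodeK : involutive antipode.
Proof.
elim/env_ind => [x|c|u v IHu IHv|u v IHu IHv].
- by rewrite antipode_in linearN /= antipode_in opprK.
- by rewrite linearZ /= antipode1 linearZ /= antipode1.
- by rewrite !linearD /= IHu IHv.
- by rewrite !antipodeM IHu IHv.
Qed.

Lemma zero_linear : linear (fun _ : L => 0 : F^o).
Proof. by move=> c x y; rewrite scaler0 addr0. Qed.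

Lemma zero_lie (x y : L) : 0 = 0 * 0 - 0 * 0 :> F^o.
Proof. by rewrite mul0r subrr. Qed.

Definition augmentation (u : envelope L) : F^o := env_lift zero_linear zero_lie u.

(** A functional that vanishes on the image of every generator sees an element
    of the enveloping algebra only through its constant term. *)
Lemma augmentation_action (V : lmodType F) (act : envelope L -> V -> V)
    (S : V -> Prop) (l : V -> F) :
  (forall u v x, act (u + v) x = act u x + act v x) ->
  (forall u v x, act (u * v) x = act u (act v x)) ->
  (forall c x, act (c *: 1) x = c *: x) ->
  (forall c x, S x -> S (c *: x)) -> (forall x y, S x -> S y -> S (x + y)) ->
  (forall x y, l (x + y) = l x + l y) -> (forall c x, l (c *: x) = c * l x) ->
  (forall f x, S x -> S (act (env_in f) x)) ->
  (forall f x, S x -> l (act (env_in f) x) = 0) ->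
  forall u x, S x -> S (act u x) /\ l (act u x) = augmentation u * l x.
Proof.
move=> actD actM act1 SZ SD lD lZ Sf lf u x Sx.
elim/env_ind: u x Sx => [f|c|u v IHu IHv|u v IHu IHv] x Sx.
- by rewrite lf // /augmentation env_lift_in mul0r; split=> //; exact: Sf.
- rewrite act1 lZ /augmentation linearZ rmorph1 /=; split; first exact: SZ.
  by rewrite /GRing.scale /= mulr1.
- have [Su eu] := IHu _ Sx; have [Sv ev] := IHv _ Sx.
  rewrite actD lD eu ev /augmentation linearD mulrDl; split=> //; exact: SD.
- have [Sv ev] := IHv _ Sx; have [Su eu] := IHu _ Sv.
  by rewrite actM eu ev /augmentation rmorphM mulrA.
Qed.

End Envelope.

Section PrincipalIdeal.
Variables (F : fieldType) (A : algType F) (w : A).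

Lemma principal_ideal0 : principal_ideal w 0.
Proof. by exists 0, (fun=> 0), (fun=> 0); rewrite big_ord0. Qed.

Lemma principal_ideal_gen : principal_ideal w w.
Proof. by exists 1, (fun=> 1), (fun=> 1); rewrite big_ord1 mul1r mulr1. Qed.

Lemma principal_idealD x y :
  principal_ideal w x -> principal_ideal w y -> principal_ideal w (x + y).
Proof.
move=> [m [a [b ->]]] [m' [a' [b' ->]]].
exists (m + m')%N.
exists (fun i => match split i with inl j => a j | inr j => a' j end).
exists (fun i => match split i with inl j => b j | inr j => b' j end).
rewrite big_split_ord /=; congr (_ + _); apply: eq_bigr => i _.
  by rewrite (unsplitK (inl _ i)).
by rewrite (unsplitK (inr _ i)).
Qed.

Lemma principal_idealMl x y : principal_ideal w y -> principal_ideal w (x * y).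
Proof.
move=> [m [a [b ->]]]; exists m, (fun i => x * a i), b.
by rewrite big_distrr /=; apply: eq_bigr => i _; rewrite !mulrA.
Qed.

Lemma principal_idealMr x y : principal_ideal w x -> principal_ideal w (x * y).
Proof.
move=> [m [a [b ->]]]; exists m, a, (fun i => b i * y).
by rewrite big_distrl /=; apply: eq_bigr => i _; rewrite !mulrA.
Qed.

Lemma principal_idealZ c x : principal_ideal w x -> principal_ideal w (c *: x).
Proof. by move=> Ix; rewrite -[x]mul1r scalerAl; exact: principal_idealMl. Qed.

Lemma principal_idealB x y :
  principal_ideal w x -> principal_ideal w y -> principal_ideal w (x - y).
Proof.
by move=> Ix Iy; rewrite -scaleN1r; apply: principal_idealD => //;
  exact: principal_idealZ.
Qed.

Lemma principal_ideal_sum I (r : seq I) (P : pred I) (f : I -> A) :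
  (forall i, P i -> principal_ideal w (f i)) ->
  principal_ideal w (\sum_(i <- r | P i) f i).
Proof.
move=> If; elim/big_rec: _ => [|i x Pi Ix]; first exact: principal_ideal0.
by apply: principal_idealD => //; exact: If.
Qed.

End PrincipalIdeal.

(** * Quadratic elements as polynomials in two variables *)

Section CharZero.
Variables (F : fieldType) (charF0 : [pchar F] =i pred0).

Lemma natr_inj : injective (fun k : nat => k%:R : F).
Proof.
have inj_le k l : (k <= l)%N -> k%:R = l%:R :> F -> k = l.
  move=> le_kl /eqP; rewrite -(subnKC le_kl) natrD eq_sym -subr_eq0 addrAC subrr.
  by rewrite add0r (pcharf0P _).1 // => /eqP ->; rewrite addn0.
move=> k l e; case: (leqP k l) => [|/ltnW] le_kl; first exact: inj_le.
by symmetry; apply: inj_le.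
Qed.

Lemma natr_neq0 k : (0 < k)%N -> k%:R != 0 :> F.
Proof. by rewrite (pcharf0P _).1 // lt0n. Qed.

End CharZero.

Section LinearExtension.
Variables (F : fieldType) (k : nat) (V : lmodType F) (v : 'X_{1..k} -> V).

Definition mpoly_lin (p : {mpoly F[k]}) : V := \sum_(m <- msupp p) p@_m *: v m.

Lemma mpoly_linw d (p : {mpoly F[k]}) : (msize p <= d)%N ->
  mpoly_lin p = \sum_(m : 'X_{1..k < d}) p@_m *: v m.
Proof.
pose I : subFinType _ := 'X_{1..k < d}.
move=> le_pd; rewrite /mpoly_lin (big_mksub I) /=.
- by rewrite big_rmcond //= => m /memN_msupp_eq0 ->; rewrite scale0r.
- exact: msupp_uniq.
- by move=> m /msize_mdeg_lt /leq_trans; apply.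
Qed.

Lemma mpoly_lin_linear : linear mpoly_lin.
Proof.
move=> c p q; set d := maxn (msize (c *: p + q)) (maxn (msize p) (msize q)).
rewrite !(@mpoly_linw d) ?leq_max ?leqnn ?orbT // scaler_sumr -big_split /=.
by apply: eq_bigr => m _; rewrite mcoeffD mcoeffZ scalerDl scalerA.
Qed.
HB.instance Definition _ := GRing.isLinear.Build F {mpoly F[k]} V *:%R mpoly_lin
  mpoly_lin_linear.

Lemma mpoly_linX m : mpoly_lin 'X_[m] = v m.
Proof. by rewrite /mpoly_lin msuppX big_seq1 mcoeffX eqxx scale1r. Qed.

End LinearExtension.

Section VariableDerivative.
Variables (F : fieldType) (k : nat).

Lemma mderivU (i j : 'I_k) : ('X_i)^`M(j) = (i == j)%:R :> {mpoly F[k]}.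
Proof.
rewrite mderivX mnm1E; have [->|_] := eqVneq i j; last by rewrite scale0r.
rewrite scale1r (_ : (_ - _)%MM = 0%MM) ?mpolyX0 //; apply/mnmP => l.
by rewrite mnmBE subnn mnm0E.
Qed.

End VariableDerivative.

Section TwoVariables.
Variable F : fieldType.

Local Notation x := ('X_ord0 : {mpoly F[2]}).
Local Notation y := ('X_ord_max : {mpoly F[2]}).

Lemma mpoly2X (m : 'X_{1..2}) : 'X_[m] = x ^+ m ord0 * y ^+ m ord_max.
Proof.
rewrite mpolyXE_id big_ord_recr big_ord1 /=.
by congr ('X_ _ ^+ m _ * _); apply: val_inj.
Qed.

Lemma mpoly2_ind (P : {mpoly F[2]} -> Prop) :
  P 0 -> (forall c p q, P p -> P q -> P (c *: p + q)) ->
  (forall a b, P (x ^+ a * y ^+ b)) -> forall p, P p.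
Proof.
move=> P0 PD Pm; elim/mpolyind => [|c m p _ _ Pp]; first exact: P0.
by apply: PD => //; rewrite mpoly2X; exact: Pm.
Qed.

Lemma mpoly2_linear_eq (V : lmodType F) (f g : {mpoly F[2]} -> V) :
  linear f -> linear g ->
  (forall a b, f (x ^+ a * y ^+ b) = g (x ^+ a * y ^+ b)) -> f =1 g.
Proof.
move=> fL gL fg; elim/mpoly2_ind => [|c p q IHp IHq|a b]; last exact: fg.
  have h0 (h : {mpoly F[2]} -> V) : linear h -> h 0 = 0.
    by move=> hL; have := hL (-1) 0 0; rewrite scaleN1r addNr scaleN1r addNr.
  by rewrite !h0.
by rewrite fL gL IHp IHq.
Qed.

Lemma mnm2E a b : ((U_(ord0) *+ a + U_(ord_max) *+ b)%MM : 'X_{1..2}) ord0 = a /\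
  ((U_(ord0) *+ a + U_(ord_max) *+ b)%MM : 'X_{1..2}) ord_max = b.
Proof. by rewrite !mnmDE !mulmnE !mnm1E /= !mul1n !mul0n addn0. Qed.

Lemma mpoly2_mon a b :
  x ^+ a * y ^+ b = 'X_[(U_(ord0) *+ a + U_(ord_max) *+ b)%MM].
Proof. by rewrite mpolyXD -!mpolyXn. Qed.

(** The polynomial f(x) g(y) stands for the product of f d/dt and g d/dt in the
    enveloping algebra; the differentiators become multiples of powers of
    x - y. *)
Definition wprod : {mpoly F[2]} -> envelope (witt F) :=
  mpoly_lin (fun m => env_in ('X^(m ord0) : witt F) * env_in ('X^(m ord_max) : witt F)).
HB.instance Definition _ := GRing.Linear.on wprod.

Definition ew (a : nat) : envelope (witt F) := env_in ('X^a : witt F).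

Lemma wprod_mon a b : wprod (x ^+ a * y ^+ b) = ew a * ew b.
Proof. by rewrite mpoly2_mon /wprod mpoly_linX; have [-> ->] := mnm2E a b. Qed.

(** Restriction to the diagonal x = y of the divided partial derivative of
    order (i, j). *)
Definition diag_deriv (i j : nat) : {mpoly F[2]} -> {poly F} :=
  mpoly_lin (fun m => ('X^(m ord0))^`N(i) * ('X^(m ord_max))^`N(j)).
HB.instance Definition _ i j := GRing.Linear.on (diag_deriv i j).

Lemma diag_deriv_mon i j a b :
  diag_deriv i j (x ^+ a * y ^+ b) = ('X^a)^`N(i) * ('X^b)^`N(j).
Proof.
by rewrite mpoly2_mon /diag_deriv mpoly_linX; have [-> ->] := mnm2E a b.
Qed.

Lemma nderivMX_pred (p : {poly F}) i :
  (p * 'X)^`N(i) = p^`N(i) * 'X + (if i is k.+1 then p^`N(k) else 0).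
Proof. by case: i => [|i]; rewrite ?nderivn0 ?addr0 // nderivMX addrC. Qed.

(** The terms in which x - y stays undifferentiated vanish on the diagonal. *)
Lemma diag_deriv_sub i j p : diag_deriv i j ((x - y) * p) =
  (if i is k.+1 then diag_deriv k j p else 0) -
  (if j is k.+1 then diag_deriv i k p else 0).
Proof.
move: p; apply: mpoly2_linear_eq => [c p q|c p q|a b].
- by rewrite mulrDr -scalerAr linearP.
- case: i j => [|i] [|j].
  + by rewrite !subr0 scaler0 addr0.
  + by rewrite !sub0r linearP opprD scalerN.
  + by rewrite !subr0 linearP.
  + by rewrite !linearP addrACA -scalerDr.
have -> : (x - y) * (x ^+ a * y ^+ b) = x ^+ a.+1 * y ^+ b - x ^+ a * y ^+ b.+1.
  by rewrite !exprS; ring.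
rewrite linearB /= !diag_deriv_mon !exprSr !nderivMX_pred.
case: i j => [|i] [|j]; rewrite ?diag_deriv_mon; ring.
Qed.

Lemma diag_deriv_vanish m i j p : (i + j < m)%N ->
  diag_deriv i j ((x - y) ^+ m * p) = 0.
Proof.
elim: m i j => [|m IH] i j // lt_ijm.
rewrite exprS -mulrA diag_deriv_sub.
by case: i j lt_ijm => [|i] [|j] h; rewrite ?IH ?subr0 //; lia.
Qed.

Lemma diag_deriv_lead i j p :
  diag_deriv i j ((x - y) ^+ (i + j) * p) =
  ((-1) ^+ j *+ 'C(i + j, j)) *: diag_deriv 0 0 p.
Proof.
move: {-2}(i + j)%N (erefl (i + j)%N) => m; elim: m i j => [|m IH] i j.
  by case: i j => [|i] [|j] //; rewrite mul1r bin0 expr0 mulr1n scale1r.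
move=> e; rewrite exprS -mulrA diag_deriv_sub.
case: i j e => [|i] [|j] //= e.
- rewrite IH; last by lia.
  have -> : m = j by lia.
  by rewrite add0n in e *; rewrite !binn sub0r !mulr1n exprS mulN1r scaleNr.
- rewrite IH; last by lia.
  by rewrite subr0 !bin0.
rewrite !IH; [|lia|lia].
by rewrite binS mulrnDr scalerDl exprS mulN1r !mulNrn !scaleNr.
Qed.

Lemma wprod_sub m : wprod ((x - y) ^+ m) =
  \sum_(i < m.+1) ((-1) ^+ i *+ 'C(m, i)) *: (ew (m - i) * ew i).
Proof.
rewrite exprBn linear_sum /=; apply: eq_bigr => i _.
rewrite -mulrA -mulrnAl -!wprod_mon -linearZ /=; congr wprod.
by rewrite -mul_mpolyC mpolyCMn rmorphXn rmorphN1.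
Qed.

Lemma differentiator_wprod m :
  differentiator F m.+1 m%:Z (-1) = wprod ((x - y) ^+ m.+1).
Proof.
rewrite wprod_sub /differentiator; apply: eq_bigr => i _; congr (_ *: (_ * _)).
  congr env_in; rewrite /witt_e; congr ('X^ _).
  by have := ltn_ord i; lia.
congr env_in; rewrite /witt_e; congr ('X^ _).
lia.
Qed.

Lemma env_inZ c (p : {poly F}) :
  env_in (c *: p : witt F) = c *: env_in (p : witt F).
Proof. exact: (linearZ_LR (@env_in F (witt F)) c p). Qed.

Lemma ew_comm a b : ew a * ew b - ew b * ew a = (b%:R - a%:R) *: ew (a + b).-1.
Proof.
rewrite -env_in_lie -linearZ /=; congr env_in; rewrite /lie /= /witt_lie.
rewrite !derivXn mulrnAr mulrnAl -!exprD scalerBl !scaler_nat.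
by case: a b => [|a] [|b]; rewrite ?mulr0n ?addnS ?addSn ?addn0.
Qed.

Lemma mderivXn_gen (p : {mpoly F[2]}) i m :
  (p ^+ m)^`M(i) = (p ^+ m.-1 * p^`M(i)) *+ m.
Proof.
elim: m => [|m IH]; first by rewrite expr0 mderivC mulr0n.
rewrite exprS mderivM IH /=; case: m {IH} => [|m]; first by rewrite mulr0n mulr0 addr0 mulrC.
by rewrite /= mulrnAr mulrA -exprS [RHS]mulrS; congr (_ + _); rewrite mulrC.
Qed.

Lemma mderiv_xy : [/\ x^`M(ord0) = 1, x^`M(ord_max) = 0,
  y^`M(ord0) = 0 & y^`M(ord_max) = 1].
Proof. by rewrite !mderivU. Qed.

(** The action of t^(c+1) d/dt on quadratic elements, as a differential
    operator in the two variables. *)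
Definition ad2 (c : nat) (p : {mpoly F[2]}) : {mpoly F[2]} :=
  x ^+ c.+1 * p^`M(ord0) + y ^+ c.+1 * p^`M(ord_max)
  - (x ^+ c + y ^+ c) * p *+ c.+1.

Lemma ad2_linear c : linear (ad2 c).
Proof.
move=> a p q; rewrite /ad2 !mderivD !mderivZ -!mul_mpolyC; ring.
Qed.

Lemma wprod_ad2 c p : wprod (ad2 c p) = ew c.+1 * wprod p - wprod p * ew c.+1.
Proof.
move: p; apply: mpoly2_linear_eq => [a p q|a p q|a b].
- by rewrite ad2_linear linearP.
- by rewrite linearP mulrDr mulrDl scalerBr opprD addrACA -scalerAr -scalerAl.
have [dxx dxy dyx dyy] := mderiv_xy.
have -> : ad2 c (x ^+ a * y ^+ b) =
    (a%:R - c.+1%:R) *: (x ^+ (c + a) * y ^+ b)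
    + (b%:R - c.+1%:R) *: (x ^+ a * y ^+ (c + b)).
  rewrite /ad2 !mderivM !mderivXn_gen dxx dxy dyx dyy.
  have e z d : z ^+ c.+1 * z ^+ d.-1 *+ d = z ^+ c * z ^+ d *+ d :> {mpoly F[2]}.
    by case: d => // d; rewrite -!exprD addSnnS.
  rewrite !mulr0 !mul0rn !mul0r !mulr0 !addr0 !add0r !mulr1.
  rewrite [x ^+ c.+1 * _]mulrA [y ^+ c.+1 * _]mulrCA.
  rewrite [x ^+ c.+1 * _]mulrnAr [y ^+ c.+1 * _]mulrnAr !e.
  rewrite !scalerBl !scaler_nat !exprD; ring.
rewrite linearP linearZ /= !wprod_mon.
have -> : ew c.+1 * (ew a * ew b) - ew a * ew b * ew c.+1 =
   (ew c.+1 * ew a - ew a * ew c.+1) * ew b + ew a * (ew c.+1 * ew b - ew b * ew c.+1).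
  by rewrite mulrBl mulrBr !mulrA addrA subrK.
by rewrite !ew_comm -scalerAl -scalerAr.
Qed.

Lemma ad2_mul c p q : ad2 c (p * q) =
  p * ad2 c q + (x ^+ c.+1 * p^`M(ord0) + y ^+ c.+1 * p^`M(ord_max)) * q.
Proof. by rewrite /ad2 !mderivM; ring. Qed.

Lemma ad2_sub c m : (0 < m)%N -> ad2 c ((x - y) ^+ m) =
  ((\sum_(i < c.+1) x ^+ (c - i) * y ^+ i) *+ m - (x ^+ c + y ^+ c) *+ c.+1)
  * (x - y) ^+ m.
Proof.
case: m => // m _; have [dxx dxy dyx dyy] := mderiv_xy.
rewrite /ad2 !mderivXn_gen !mderivB dxx dxy dyx dyy /= subr0 sub0r.
have := subrXX x y c.+1; rewrite /=.
set S := \sum_(i < _) _; set q := (x - y) ^+ m => e.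
have -> : x ^+ c.+1 * (q * 1 *+ m.+1) + y ^+ c.+1 * (q * -1 *+ m.+1) =
    (x ^+ c.+1 - y ^+ c.+1) * q *+ m.+1 by ring.
by rewrite e exprS -/q; ring.
Qed.

Section IdealOfDifferentiator.
Hypothesis charF0 : [pchar F] =i pred0.

(** For odd m the polynomial (x - y)^m is antisymmetric, so twice its value is a
    sum of commutators, and a commutator only sees first derivatives on the
    diagonal. *)
Lemma wprod_sub_odd m : (1 < m)%N -> odd m -> wprod ((x - y) ^+ m) = 0.
Proof.
move=> m_gt1 m_odd; set w := wprod _.
have e : w + w = 0; last first.
  have /eqP : (2%:R : F) *: w = 0 by rewrite scaler_nat mulr2n.
  by rewrite scaler_eq0 (negPf (natr_neq0 charF0 _)) // => /eqP.
have {1}-> : w = - \sum_(i < m.+1) ((-1) ^+ i *+ 'C(m, i)) *: (ew i * ew (m - i)).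
  rewrite /w wprod_sub (reindex_inj rev_ord_inj) -sumrN; apply: eq_bigr => i _ /=.
  have le_im : (i <= m)%N by rewrite -ltnS.
  rewrite subSS bin_sub // subKn // -scaleNr; congr (_ *: _).
  rewrite -mulNrn; congr (_ *+ _).
  rewrite -[(-1) ^+ (m - i)]signr_odd oddB // m_odd -[(-1) ^+ i]signr_odd.
  by case: (odd i); rewrite /= ?expr0 ?expr1 ?opprK.
rewrite /w wprod_sub addrC -sumrB.
under eq_bigr => i _ do rewrite -scalerBr ew_comm.
transitivity (env_in (diag_deriv 0 1 ((x - y) ^+ m * 1)
    - diag_deriv 1 0 ((x - y) ^+ m * 1) : witt F)); last first.
  by rewrite !diag_deriv_vanish ?subrr ?linear0.
rewrite mulr1 exprBn (linear_sum (diag_deriv 0 1)) (linear_sum (diag_deriv 1 0)).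
rewrite -sumrB linear_sum /=.
apply: eq_bigr => i _; have le_im : (i <= m)%N by rewrite -ltnS.
have -> : (-1) ^+ i * x ^+ (m - i) * y ^+ i *+ 'C(m, i) =
   ((-1) ^+ i *+ 'C(m, i)) *: (x ^+ (m - i) * y ^+ i).
  by rewrite -mul_mpolyC mpolyCMn rmorphXn rmorphN1 mulrnAl mulrA.
rewrite (linearZ_LR (diag_deriv 0 1)) (linearZ_LR (diag_deriv 1 0)) /=.
transitivity (env_in (((-1) ^+ i *+ 'C(m, i)) *:
    ((i%:R - (m - i)%:R) *: ('X^((m - i + i).-1) : witt F)))).
  by rewrite !env_inZ.
congr env_in.
rewrite !diag_deriv_mon -scalerBr; congr (_ *: _).
rewrite !nderivn0 !poly.nderivn1 !derivXn subnK // mulrnAr mulrnAl -!exprD.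
rewrite scalerBl !scaler_nat; congr (_ - _).
  case: (i : nat) le_im => [|k] le_km; rewrite ?mulr0n //=.
  by rewrite (_ : m.-1 = m - k.+1 + k)%N //; lia.
case e: (m - i)%N => [|k]; rewrite ?mulr0n //= (_ : m.-1 = k + i)%N //.
lia.
Qed.

Variable m0 : nat.
Hypotheses (m0_ge4 : (4 <= m0)%N) (m0_even : ~~ odd m0).

Let I := principal_ideal (wprod ((x - y) ^+ m0)).
Let K p := I (wprod p).

Let KD c p q : K p -> K q -> K (c *: p + q).
Proof.
by move=> Kp Kq; rewrite /K linearP; apply: principal_idealD => //;
  exact: principal_idealZ.
Qed.

Let K0 : K 0.
Proof. by rewrite /K linear0; exact: principal_ideal0. Qed.

Let K_ad c p : K p -> K (ad2 c p).
Proof.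
move=> Kp; rewrite /K wprod_ad2; apply: principal_idealB.
  exact: principal_idealMl.
exact: principal_idealMr.
Qed.

(** Acting on (x - y)^m twice with t^2 d/dt and once with t^3 d/dt gives two
    symmetric quadratic multiples of it. Their span contains (x - y)^(m+2) since
    the determinant m^2 - 9 m + 12 has no integer root. *)
Let K_sub_step m : (4 <= m)%N -> K ((x - y) ^+ m) -> K ((x - y) ^+ m.+2).
Proof.
move=> m_ge4 Kq; have [dxx dxy dyx dyy] := mderiv_xy.
have m_gt0 : (0 < m)%N by lia.
set D : F := 9%:R * m%:R - m%:R ^+ 2 - 12%:R.
have D0 : D != 0.
  apply/negP => /eqP e.
  have /(natr_inj charF0) : (9 * m)%:R = (m * m + 12)%:R :> F.
    by rewrite natrD !natrM; apply/eqP; rewrite -subr_eq0 -e /D; apply/eqP; ring.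
  have [m_ge9|] := leqP 9 m; first by nia.
  by clear -m_ge4; move: m_ge4; do 9 case: m => [//|m].
have Kxy : K ((x + y) * (x - y) ^+ m).
  have /(KD (m%:R - 2%:R)^-1) := K_ad 1 Kq => /(_ _ K0).
  rewrite addr0 ad2_sub // big_ord_recr big_ord1 /= !subnn !expr0 !expr1.
  have D2 : m%:R - 2%:R != 0 :> F by rewrite -natrB ?natr_neq0 //; lia.
  congr K; rewrite mul1r mulr1; apply: (canLR (scalerK D2)).
  by rewrite -!mul_mpolyC mpolyCB !mpolyC_nat; ring.
have e : (x - y) ^+ m.+2 = (D^-1 * (3%:R * m%:R - 6%:R)) *: ad2 1 ((x + y) * (x - y) ^+ m)
   + (- (D^-1 * (4%:R * m%:R - 6%:R)) *: ad2 2 ((x - y) ^+ m) + 0).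
  rewrite addr0 -!scalerA scaleNr -scalerA -scalerBr; apply: (canRL (scalerK D0)).
  rewrite ad2_mul !ad2_sub // !big_ord_recr !big_ord0 /=.
  rewrite !mderivD dxx dxy dyx dyy -!mul_mpolyC.
  rewrite !mpolyCD !mpolyCN !mpolyCM !mpolyC_nat !exprS !expr0. 
  ring.
by rewrite e; apply: KD; [exact: K_ad|apply: KD => //; exact: K_ad].
Qed.

Let K_sub m : (m0 <= m)%N -> K ((x - y) ^+ m).
Proof.
move=> le_m; have [m_odd|m_even] := boolP (odd m).
  by rewrite /K wprod_sub_odd //; [exact: principal_ideal0|lia].
have -> : m = (m0 + (m - m0)./2.*2)%N by rewrite halfK; lia.
elim: (_./2) => [|k IH]; first by rewrite addn0; exact: principal_ideal_gen.
by rewrite doubleS !addnS; apply: K_sub_step => //; lia.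
Qed.

(** Modulo higher powers of x - y, which have cofactors of lower degree, only the
    diagonal value of the cofactor counts, and t^(c+1) d/dt applied to (x - y)^m
    has the diagonal value t^c with the nonzero factor (m - 2) (c + 1). *)
Let K_mon c m a b : (m0 <= m)%N -> (a + b)%N = c ->
  K (x ^+ a * y ^+ b * (x - y) ^+ m).
Proof.
elim: c m a b => [|c IH] m a b le_m e_ab.
  have [-> ->] : a = 0%N /\ b = 0%N by lia.
  by rewrite !expr0 !mul1r; exact: K_sub.
have diff a' b' : (a' + b')%N = c.+1 ->
    K (x ^+ c.+1 * (x - y) ^+ m - x ^+ a' * y ^+ b' * (x - y) ^+ m).
  elim: b' a' => [|b' IHb] a' e.
    by rewrite addn0 in e; rewrite e mulr1 subrr.
  have /IHb h : (a'.+1 + b' = c.+1)%N by lia.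
  have /(KD 1 h) : K (x ^+ a' * y ^+ b' * (x - y) ^+ m.+1) by apply: IH; lia.
  congr K; rewrite scale1r !exprS; ring.
suff Kx : K (x ^+ c.+1 * (x - y) ^+ m).
  have := KD (-1) (diff _ _ e_ab) Kx; congr K.
  by rewrite scaleN1r opprB subrK.
have m_gt0 : (0 < m)%N by lia.
have := K_ad c.+1 (K_sub le_m); rewrite ad2_sub // => Kad.
have Ksum : K (\sum_(i < c.+2) (x ^+ c.+1 * (x - y) ^+ m
    - x ^+ (c.+1 - i) * y ^+ i * (x - y) ^+ m)).
  elim/big_rec: _ => [|i p _ Kp]; first exact: K0.
  rewrite -[X in K (X + _)]scale1r; apply: KD => //; apply: diff.
  by have := ltn_ord i; lia.
have Ky : K (x ^+ c.+1 * (x - y) ^+ m - x ^+ 0 * y ^+ c.+1 * (x - y) ^+ m).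
  exact: diff.
have D0 : ((m - 2) * c.+2)%:R != 0 :> F by rewrite natr_neq0 // muln_gt0; lia.
have := KD (((m - 2) * c.+2)%:R^-1 : F) (KD m%:R Ksum (KD (- c.+2%:R) Ky Kad)) K0.
congr K; rewrite addr0; apply: (canLR (scalerK D0)).
rewrite sumrB sumr_const card_ord -mulr_suml -!mul_mpolyC.
rewrite mpolyCN !mpolyC_nat expr0 mul1r -[_ *+ c.+2 - _]/(_ - _).
set S := \sum_(i < _) _.
rewrite -[_ *+ c.+2]mulr_natl natrM natrB; last by lia.
ring.
Qed.

Lemma principal_ideal_wprod m p : (m0 <= m)%N ->
  principal_ideal (wprod ((x - y) ^+ m0)) (wprod (p * (x - y) ^+ m)).
Proof.
move=> le_m; elim/mpoly2_ind: p => [|c p q Kp Kq|a b].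
- by rewrite mul0r; exact: K0.
- by rewrite mulrDl -scalerAl; exact: KD.
- exact: (K_mon le_m (erefl _)).
Qed.

End IdealOfDifferentiator.
End TwoVariables.

(** * The orbit homomorphism on quadratic elements *)

Section HornerAlg.
Variables (F : fieldType) (A : algType F).
Implicit Types (u tau delta : A) (p : {poly F}).

Lemma horner_alg_comm u tau p : u * tau = tau * u ->
  u * horner_alg tau p = horner_alg tau p * u.
Proof.
move=> cu; elim/poly_ind: p => [|p c IH]; first by rewrite !rmorph0 mulr0 mul0r.
rewrite !rmorphD !rmorphM /= !horner_algX !horner_algC mulrDr mulrDl mulrA IH.
by rewrite -!mulrA cu mulr_algr mulr_algl.
Qed.

Lemma horner_alg_deriv tau delta p : delta * tau - tau * delta = 1 ->
  delta * horner_alg tau p = horner_alg tau p * delta + horner_alg tau p^`().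
Proof.
move=> /eqP; rewrite subr_eq addrC => /eqP dt; elim/poly_ind: p => [|p c IH].
  by rewrite derivC !rmorph0 mulr0 mul0r addr0.
rewrite derivMXaddC !rmorphD !rmorphM /= !horner_algX !horner_algC.
rewrite mulrDr mulrA IH mulrDl -mulrA dt mulrDr mulr1 mulrA -scalerAr mulr1.
rewrite mulrDl mulr_algl -!addrA; congr (_ + _).
by rewrite addrA addrC.
Qed.

End HornerAlg.

Section OrbitQuadratic.
Variables (F : fieldType) (charF0 : [pchar F] =i pred0) (N : nat).

Local Notation x := ('X_ord0 : {mpoly F[2]}).
Local Notation y := ('X_ord_max : {mpoly F[2]}).

Definition orbit_poly (p : {poly F}) : orbit_alg F N :=
  tens (horner_alg (weylT F) p) 1.

(** Numbered so that the orbit homomorphism pairs the i-th element with the i-th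
    divided derivative. *)
Definition orbit_jet (i : nat) : orbit_alg F N :=
  if i is k.+1 then tens 1 (env_in (witt_v F N k)) else tens (weylD F) 1.

Lemma orbit_poly_linear : linear orbit_poly.
Proof. by move=> c p q; rewrite /orbit_poly linearP /= mulr_algl tens_linearl. Qed.
HB.instance Definition _ := GRing.isLinear.Build F {poly F} (orbit_alg F N) *:%R
  orbit_poly orbit_poly_linear.

Lemma orbit_polyM p q : orbit_poly (p * q) = orbit_poly p * orbit_poly q.
Proof. by rewrite /orbit_poly tensM rmorphM mulr1. Qed.

Lemma orbit_jet_poly i p : orbit_jet i * orbit_poly p =
  orbit_poly p * orbit_jet i + (if i is _.+1 then 0 else orbit_poly p^`()).
Proof.
case: i => [|i]; rewrite /orbit_jet /orbit_poly !tensM !mulr1 ?mul1r ?addr0 //.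
rewrite (horner_alg_deriv _ (weyl_comm F)).
have := @tens_linearl _ (weyl F) (envelope (witt_quot F N)) 1 1
  (horner_alg (weylT F) p * weylD F) (horner_alg (weylT F) p^`()).
by rewrite !scale1r; apply.
Qed.

Lemma orbit_hom_ew (f : {poly F}) : orbit_hom N charF0 (env_in (f : witt F)) =
  \sum_(i < N.+1) orbit_poly f^`N(i) * orbit_jet i.
Proof.
rewrite orbit_hom_in /orbit_fun big_ord_recl /= nderivn0; congr (_ + _).
  by rewrite /orbit_poly tensM mulr1.
apply: eq_bigr => i _; rewrite /orbit_poly /bump add1n /= tensM mulr1 mul1r.
congr tens; congr horner_alg.
rewrite -[(f^`(i))^`()]/(f^`(i.+1)) poly.nderivn_def -scaler_nat scalerA mulVf ?scale1r //.
by rewrite natr_neq0 // fact_gt0.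
Qed.

(** The second sum is due to the commutators of d/dt with the coefficients of the
    second factor. *)
Lemma orbit_hom_wprod p : orbit_hom N charF0 (wprod p) =
  \sum_(i < N.+1) \sum_(j < N.+1)
     orbit_poly (diag_deriv i j p) * (orbit_jet i * orbit_jet j)
  + \sum_(j < N.+1) orbit_poly (diag_deriv 0 j.+1 p) * orbit_jet j *+ j.+1.
Proof.
move: p; apply: mpoly2_linear_eq => [c p q|c p q|a b].
- by rewrite !linearP.
- rewrite scalerDr addrACA; congr (_ + _).
    rewrite scaler_sumr -big_split /=; apply: eq_bigr => i _.
    rewrite scaler_sumr -big_split /=; apply: eq_bigr => j _.
    by rewrite !linearP mulrDl scalerAl.
  rewrite scaler_sumr -big_split /=; apply: eq_bigr => j _.
  by rewrite !linearP mulrDl mulrnDl -scalerAl scalerMnr.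
rewrite wprod_mon rmorphM /= !orbit_hom_ew big_distrl /=.
transitivity (\sum_(i < N.+1) (\sum_(j < N.+1)
     orbit_poly (diag_deriv i j (x ^+ a * y ^+ b)) * (orbit_jet i * orbit_jet j)
   + if (i : nat) is _.+1 then 0 else
     \sum_(j < N.+1) orbit_poly (diag_deriv 0 j.+1 (x ^+ a * y ^+ b)) * orbit_jet j *+ j.+1)).
  apply: eq_bigr => i _; rewrite big_distrr /=.
  under eq_bigr => j _.
    rewrite -mulrA [orbit_jet i * _]mulrA orbit_jet_poly mulrDl mulrDr.
    rewrite -[orbit_poly _ * _ * _]mulrA [orbit_poly _ * (orbit_poly _ * _)]mulrA.
    rewrite -orbit_polyM -diag_deriv_mon.
  over.
  rewrite big_split /=; congr (_ + _).
  case: (i : nat) => [|k]; last by rewrite big1 // => j _; rewrite mul0r mulr0.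
  apply: eq_bigr => j _; rewrite diag_deriv_mon deriv_nderiv linearMn /= mulrnAl.
  by rewrite mulrnAr mulrA -orbit_polyM.
rewrite big_split /=; congr (_ + _).
by rewrite big_ord_recl [X in _ + X]big1 ?addr0.
Qed.

End OrbitQuadratic.

Section OrbitDifferentiator.
Variables (F : fieldType) (charF0 : [pchar F] =i pred0) (n : nat).

Local Notation x := ('X_ord0 : {mpoly F[2]}).
Local Notation y := ('X_ord_max : {mpoly F[2]}).

(** On the diagonal, only derivatives of total order at most 2 n occur. *)
Lemma orbit_hom_vanish p :
  orbit_hom n charF0 (wprod ((x - y) ^+ (2 * n + 2) * p)) = 0.
Proof.
rewrite orbit_hom_wprod [X in X + _]big1 => [|i _]; last first.
  rewrite big1 // => j _; rewrite diag_deriv_vanish ?linear0 ?mul0r //.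
  by have := ltn_ord i; have := ltn_ord j; lia.
rewrite big1 ?addr0 // => j _; rewrite diag_deriv_vanish ?linear0 ?mul0r ?mul0rn //.
by have := ltn_ord j; lia.
Qed.

(** One jet higher a single derivative of total order 2 n + 2 appears, the one
    of order n + 1 in both variables. *)
Lemma orbit_hom_succ p : (1 <= n)%N ->
  orbit_hom n.+1 charF0 (wprod ((x - y) ^+ (2 * n + 2) * p)) =
  ((-1) ^+ n.+1 *+ 'C(2 * n + 2, n.+1)) *:
    (orbit_poly n.+1 (diag_deriv 0 0 p) *
       (orbit_jet F n.+1 n.+1 * orbit_jet F n.+1 n.+1)).
Proof.
move=> n_gt0; rewrite orbit_hom_wprod [X in _ + X]big1 => [|j _]; last first.
  rewrite diag_deriv_vanish ?linear0 ?mul0r ?mul0rn //.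
  by have := ltn_ord j; lia.
rewrite addr0 (bigD1 ord_max) //= [X in _ + X]big1 ?addr0 => [|i i_max]; last first.
  rewrite big1 // => j _; rewrite diag_deriv_vanish ?linear0 ?mul0r //.
  have : (i : nat) != n.+1 by apply: contra_neq i_max => ?; exact: val_inj.
  by have := ltn_ord i; have := ltn_ord j; lia.
rewrite (bigD1 ord_max) //= [X in _ + X]big1 ?addr0 => [|j j_max]; last first.
  rewrite diag_deriv_vanish ?linear0 ?mul0r //.
  have : (j : nat) != n.+1 by apply: contra_neq j_max => ?; exact: val_inj.
  by have := ltn_ord j; lia.
rewrite (_ : 2 * n + 2 = n.+1 + n.+1)%N; last by lia.
by rewrite diag_deriv_lead linearZ /= scalerAl.
Qed.

End OrbitDifferentiator.

Section OrbitLift.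
Variables (F : fieldType) (N : nat) (A : algType F).
Variables (tau delta : A) (nu : nat -> A).
Hypothesis tau_delta : delta * tau - tau * delta = 1.
Hypothesis nu_tau : forall i, nu i * tau = tau * nu i.
Hypothesis nu_delta : forall i, nu i * delta = delta * nu i.
Hypothesis nu_lie : forall i j,
  nu i * nu j - nu j * nu i = (j%:R - i%:R) *: nu (i + j)%N.
Hypothesis nu_vanish : forall i, (N <= i)%N -> nu i = 0.

Definition weyl_gen_lift (g : weyl_gen) : A :=
  match g with WeylT => tau | WeylD => delta end.

Lemma weyl_lift_subproof u v :
  weyl_rel u v -> weval weyl_gen_lift u = weval weyl_gen_lift v.
Proof.
by case=> /=; rewrite scale1r -tau_delta addrC subrK.
Qed.

Let weyl_lift : weyl F -> A := plift weyl_lift_subproof.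
HB.instance Definition _ := GRing.Linear.on weyl_lift.
HB.instance Definition _ := GRing.RMorphism.on weyl_lift.

Let weyl_liftT : weyl_lift (weylT F) = tau.
Proof. exact: plift_gen. Qed.
Let weyl_liftD : weyl_lift (weylD F) = delta.
Proof. exact: plift_gen. Qed.

Let nu_quot (u : witt_quot F N) : A :=
  \sum_(i < N) (witt0_val (repr u))`_i.+1 *: nu i.

Let nu_quotE (g : witt0 F) :
  nu_quot (wq N g) = \sum_(i < N) (witt0_val g)`_i.+1 *: nu i.
Proof.
apply: eq_bigr => i _; congr (_ *: _); apply/eqP; rewrite -subr_eq0 -coefB.
by apply/eqP; have /witt_geP := wq_repr N g; apply.
Qed.

Let nu_quot_linear : linear nu_quot.
Proof.
move=> c u v; rewrite -(wqK u) -(wqK v) -linearP !nu_quotE scaler_sumr -big_split.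
by apply: eq_bigr => i _; rewrite /= coefD coefZ scalerDl scalerA.
Qed.

Let nu_quot_lie u v : nu_quot (lie u v) = nu_quot u * nu_quot v - nu_quot v * nu_quot u.
Proof.
rewrite -(wqK u) -(wqK v); move: (repr u) (repr v) => g h {u v}.
rewrite [lie _ _]wq_lieE !nu_quotE.
have g0 : (witt0_val g)`_0 = 0 by have /witt_geP := valP g; apply.
have h0 : (witt0_val h)`_0 = 0 by have /witt_geP := valP h; apply.
pose H i j := ((witt0_val g)`_i.+1 * (witt0_val h)`_j.+1 * (j%:R - i%:R)) *: nu (i + j)%N.
transitivity (\sum_(i < N) \sum_(j < N) H i j); last first.
  rewrite !big_distrl /= [X in _ - X](eq_bigr (fun i : 'I_N => \sum_(j < N)
    ((witt0_val h)`_i.+1 * (witt0_val g)`_j.+1) *: (nu i * nu j))); last first.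
    move=> i _; rewrite big_distrr; apply: eq_bigr => j _ /=.
    by rewrite -scalerAl -scalerAr scalerA.
  rewrite [X in _ - X]exchange_big -sumrB /=; apply: eq_bigr => i _.
  rewrite big_distrr -sumrB; apply: eq_bigr => j _ /=.
  by rewrite -scalerAl -scalerAr scalerA [X in _ - X *: _]mulrC -scalerBr nu_lie scalerA.
rewrite (sum_diag (H := H)) => [|i j le_N]; last first.
  by rewrite /H nu_vanish // scaler0.
apply: eq_bigr => k _; rewrite /H.
under eq_bigr => i _.
  rewrite subnKC; last by rewrite -ltnS.
over.
rewrite -scaler_suml; congr (_ *: _).
rewrite /lie /= /witt_lie coefB !coefM.
rewrite big_ord_recl g0 mul0r add0r [X in _ - X]big_ord_recr /= subnn h0 mulr0 addr0.
rewrite -sumrB; apply: eq_bigr => i _; have le_ik : (i <= k)%N by rewrite -ltnS.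
rewrite /bump add1n subSS !coef_deriv subSn //.
rewrite mulrnAr mulrnAl -mulr_natr -[_ *+ i.+1]mulr_natr -mulrBr.
by rewrite -!natr1 opprD addrACA subrr addr0.
Qed.

Let nu_lift : envelope (witt_quot F N) -> A := env_lift nu_quot_linear nu_quot_lie.
HB.instance Definition _ := GRing.Linear.on nu_lift.
HB.instance Definition _ := GRing.RMorphism.on nu_lift.

Let nu_lift_v k : (k < N)%N -> nu_lift (env_in (witt_v F N k)) = nu k.
Proof.
move=> lt_kN; rewrite /nu_lift env_lift_in nu_quotE (bigD1 (Ordinal lt_kN)) //=.
rewrite coefXn eqxx scale1r big1 ?addr0 // => i ne_ik.
rewrite coefXn eqSS (_ : (i == k :> nat) = false) ?scale0r //.
by apply: contra_neqF ne_ik => /eqP ?; exact: val_inj.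
Qed.

Let lift_comm a b : weyl_lift a * nu_lift b = nu_lift b * weyl_lift a.
Proof.
have comm_quot c u : (forall i, nu i * c = c * nu i) -> nu_quot u * c = c * nu_quot u.
  move=> h; rewrite /nu_quot big_distrl big_distrr /=; apply: eq_bigr => i _.
  by rewrite -scalerAl -scalerAr h.
have comm_lift c : (forall i, nu i * c = c * nu i) -> nu_lift b * c = c * nu_lift b.
  move=> h; elim/env_ind: b => [u|d|u v IHu IHv|u v IHu IHv].
  - by rewrite /nu_lift env_lift_in comm_quot.
  - by rewrite linearZ rmorph1 /= -scalerAl -scalerAr mul1r mulr1.
  - by rewrite linearD mulrDl mulrDr IHu IHv.
  - by rewrite rmorphM -mulrA IHv !mulrA IHu.
rewrite -(pclsK a); elim: (repr a) => [[]|c|u IHu v IHv|u IHu v IHv].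
- by rewrite [weyl_lift _]weyl_liftT comm_lift.
- by rewrite [weyl_lift _]weyl_liftD comm_lift.
- by rewrite pclsC linearZ rmorph1 /= -scalerAl -scalerAr mul1r mulr1.
- by rewrite pclsD linearD mulrDl mulrDr IHu IHv.
- by rewrite pclsM rmorphM -mulrA IHv mulrA IHu !mulrA.
Qed.

Let tensor_gen_lift (ab : weyl F * envelope (witt_quot F N)) : A :=
  weyl_lift ab.1 * nu_lift ab.2.

Let tensor_lift_subproof u v :
  tensor_rel u v -> weval tensor_gen_lift u = weval tensor_gen_lift v.
Proof.
rewrite /tensor_gen_lift; case=> [c a a' b|c a b b'|a a' b b'|] /=.
- by rewrite linearP mulrDl -!scalerAl mul1r.
- by rewrite linearP mulrDr -scalerAr -scalerAl mul1r.
- rewrite !rmorphM -!mulrA; congr (_ * _).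
  by rewrite !mulrA lift_comm.
- by rewrite !rmorph1 mulr1 scale1r.
Qed.

Definition jet_image (i : nat) : A := if i is k.+1 then nu k else delta.

(** A representation of the orbit algebra amounts to a pair satisfying the Weyl
    relation and a commuting family satisfying the relations of the v_i. *)
Lemma orbit_alg_lift (charF0 : [pchar F] =i pred0) :
  exists rho : {lrmorphism orbit_alg F N -> A},
  [/\ forall p, rho (orbit_poly N p) = horner_alg tau p,
      forall i, (i <= N)%N -> rho (orbit_jet F N i) = jet_image i
    & forall f : {poly F}, rho (orbit_hom N charF0 (env_in (f : witt F))) =
        \sum_(i < N.+1) horner_alg tau f^`N(i) * jet_image i].
Proof.
pose rho0 : orbit_alg F N -> A := plift tensor_lift_subproof.
pose rho_lin := GRing.isLinear.Build F (orbit_alg F N) A *:%R rho0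
  (plift_linear tensor_lift_subproof).
pose rho_mul := GRing.isMonoidMorphism.Build (orbit_alg F N) A rho0
  (plift_monoid_morphism tensor_lift_subproof).
pose rho : {lrmorphism orbit_alg F N -> A} := HB.pack rho0 rho_lin rho_mul.
have rhoE p : rho (orbit_poly N p) = horner_alg tau p.
  rewrite /rho /= /rho0 /orbit_poly /tens plift_gen /tensor_gen_lift /= rmorph1 mulr1.
  elim/poly_ind: p => [|p c IH]; first by rewrite !rmorph0.
  by rewrite !rmorphD !rmorphM /= !horner_algX !horner_algC IH weyl_liftT linearZ rmorph1.
have rhoJ i : (i <= N)%N -> rho (orbit_jet F N i) = jet_image i.
  case: i => [|i] lt_iN; rewrite /rho /= /rho0 /tens plift_gen /tensor_gen_lift /= rmorph1.
    by rewrite mulr1 weyl_liftD.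
  by rewrite mul1r nu_lift_v.
exists rho; split=> // f; rewrite orbit_hom_ew.
have rhoD k (h : nat -> orbit_alg F N) :
  rho (\sum_(i < k) h i) = \sum_(i < k) rho (h i) by exact: linear_sum.
have rhoM u v : rho (u * v) = rho u * rho v by exact: rmorphM.
rewrite (rhoD _ (fun i => orbit_poly N f^`N(i) * orbit_jet F N i)).
by apply: eq_bigr => i _; rewrite rhoM rhoE rhoJ // -ltnS.
Qed.

End OrbitLift.

(** * A spanning set modulo the differentiators *)

Section Interpolation.
Variables (F : fieldType) (charF0 : [pchar F] =i pred0).

Lemma natr_prod_ffact j i :
  \prod_(k < i) (j%:R - k%:R) = (j ^_ i)%:R :> F.
Proof.
elim: i => [|i IH]; first by rewrite big_ord0 ffactn0.
rewrite big_ord_recr /= IH ffactnSr natrM.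
have [le_ij|lt_ji] := leqP i j; first by rewrite natrB.
by rewrite ffact_small ?mul0r.
Qed.

(** A combination of the C(j, i) with i < M is a polynomial in j of degree below
    M, so it vanishes identically if it vanishes at M nodes; its values at
    j = 0, 1, ... then kill the coefficients one after the other. *)
Lemma binomial_nodes_free M (node : 'I_M -> nat) (u : 'rV[F]_M) :
  injective node -> (forall j, \sum_i u 0 i * 'C(node j, i)%:R = 0) -> u = 0.
Proof.
move=> node_inj u0.
pose bp i : {poly F} := i`!%:R^-1 *: \prod_(k < i) ('X - k%:R%:P).
have bpE i j : (bp i).[j%:R] = 'C(j, i)%:R.
  rewrite hornerZ horner_prod (eq_bigr (fun k : 'I_i => j%:R - k%:R)).
    rewrite natr_prod_ffact -bin_ffact natrM mulrC mulfK //.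
    by rewrite natr_neq0 // fact_gt0.
  by move=> k _; rewrite hornerXsubC.
have size_bp i : (size (bp i) <= i.+1)%N.
  apply: leq_trans (size_scale_leq _ _) _.
  by rewrite size_prod_XsubC /index_enum -enumT size_enum_ord.
pose P : {poly F} := \sum_i u 0 i *: bp i.
have PE j : P.[j%:R] = \sum_i u 0 i * 'C(j, i)%:R.
  by rewrite horner_sum; apply: eq_bigr => i _; rewrite hornerZ bpE.
have P0 : P = 0.
  apply/eqP; apply: contraT => nzP.
  have := @max_poly_roots _ P [seq (node j)%:R | j : 'I_M] nzP.
  rewrite size_map size_enum_ord ltnNge; move=> /(_ _ _) /negP; case.
  - apply/allP => _ /mapP [j _ ->]; rewrite /root PE; exact/eqP.
  - rewrite map_inj_uniq ?enum_uniq // => j k /(natr_inj charF0); exact: node_inj.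
  apply: leq_trans (size_sum _ _ _) _; apply/bigmax_leqP => i _.
  apply: leq_trans (size_scale_leq _ _) _; exact: leq_trans (size_bp _) _.
have uE (k : nat) : forall i : 'I_M, (i < k)%N -> u 0 i = 0.
  elim: k => // k IH i; rewrite ltnS leq_eqVlt => /orP[/eqP e|]; last exact: IH.
  have := PE i; rewrite P0 horner0 (bigD1 i) //= binn mulr1 big1 ?addr0 // => i' ne.
  have [lt|le] := ltnP i' k; first by rewrite IH ?mul0r.
  rewrite bin_small ?mulr0 // ltn_neqAle e le andbT -e.
  by apply: contra_neq ne => ?; exact: val_inj.
by apply/rowP => i; rewrite mxE (uE i.+1).
Qed.

Lemma nderiv_dvd (f : {poly F}) M :
  (forall l, (l < M)%N -> (f^`N(l)).[1] = 0) -> exists h, f = ('X - 1) ^+ M * h.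
Proof.
elim: M f => [|M IH] f f0; first by exists f; rewrite mul1r.
have /factor_theorem [g fE] : root f 1 by apply/eqP; rewrite -[f]nderivn0 f0.
have [l lt_lM|h gE] := IH g.
  have := f0 l.+1 lt_lM; rewrite fE mulrBr linearB /= nderivMX polyC1 mulr1.
  by rewrite hornerD hornerN hornerD hornerMX mulr1 addrK.
by exists h; rewrite fE gE polyC1 exprSr mulrAC.
Qed.

(** Vanishing to order M at 1 is a linear system in the coefficients, with the
    matrix of the binomial coefficients at the nodes. *)
Lemma interpolation_at_one M (node : 'I_M -> nat) a : injective node ->
  exists (c : 'I_M -> F) h, 'X^a - \sum_j c j *: 'X^(node j) = ('X - 1) ^+ M * h.
Proof.
move=> node_inj.
pose B : 'M[F]_M := \matrix_(i, j) 'C(node j, i)%:R.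
have Bunit : B \in unitmx.
  rewrite -row_free_unit; apply: inj_row_free => u uB0.
  apply: (binomial_nodes_free node_inj) => j.
  have /rowP /(_ j) := uB0; rewrite !mxE => e; rewrite -[RHS]e.
  by apply: eq_bigr => i _; rewrite mxE.
pose c : 'cV[F]_M := invmx B *m \col_i 'C(a, i)%:R.
exists (fun j => c j 0); apply: nderiv_dvd => l lt_lM.
have nX k : (('X^k)^`N(l)).[1] = 'C(k, l)%:R :> F.
  by rewrite nderivnXn hornerMn hornerXn expr1n.
rewrite linearB hornerD hornerN nX linear_sum horner_sum.
apply/eqP; rewrite subr_eq0; apply/eqP.
have /colP /(_ (Ordinal lt_lM)) : B *m c = \col_i 'C(a, i)%:R.
  by rewrite /c mulKVmx.
rewrite !mxE /= => <-; apply: eq_bigr => j _.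
by rewrite linearZ hornerZ nX mxE mulrC.
Qed.

End Interpolation.

Section Homogenization.
Variable F : fieldType.

Local Notation x := ('X_ord0 : {mpoly F[2]}).
Local Notation y := ('X_ord_max : {mpoly F[2]}).

Definition homogenize (d : nat) (f : {poly F}) : {mpoly F[2]} :=
  \sum_(j < d.+1) f`_j *: (x ^+ j * y ^+ (d - j)).

Lemma homogenize_linear d : linear (homogenize d).
Proof.
move=> c f g; rewrite /homogenize scaler_sumr -big_split; apply: eq_bigr => j _.
by rewrite coefD coefZ scalerDl scalerA.
Qed.
HB.instance Definition _ d := GRing.isLinear.Build F {poly F} {mpoly F[2]} *:%R
  (homogenize d) (homogenize_linear d).

Lemma homogenizeXn d a : (a <= d)%N -> homogenize d 'X^a = x ^+ a * y ^+ (d - a).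
Proof.
move=> le_ad; rewrite /homogenize (bigD1 (Ordinal (le_ad : a < d.+1)%N)) //=.
rewrite coefXn eqxx scale1r big1 ?addr0 // => j ne.
rewrite coefXn (_ : (j == a :> nat) = false) ?scale0r //.
by apply: contra_neqF ne => /eqP ?; exact: val_inj.
Qed.

Lemma homogenizeM d (f : {poly F}) : (size f <= d.+1)%N ->
  homogenize d.+1 (('X - 1) * f) = (x - y) * homogenize d f.
Proof.
move=> size_f; rewrite !mulrBl mul1r linearB /=; congr (_ - _).
  rewrite /homogenize big_ord_recl coefXM /= scale0r add0r mulr_sumr.
  apply: eq_bigr => j _; rewrite coefXM /= -scalerAr; congr (_ *: _).
  by rewrite exprS mulrA.
rewrite /homogenize big_ord_recr /= nth_default // scale0r addr0 mulr_sumr.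
apply: eq_bigr => j _; rewrite -scalerAr; congr (_ *: _).
rewrite subSn; last by rewrite -ltnS.
by rewrite exprS mulrCA.
Qed.

Lemma homogenizeMn M d (f : {poly F}) : (size f <= d.+1)%N ->
  homogenize (M + d) (('X - 1) ^+ M * f) = (x - y) ^+ M * homogenize d f.
Proof.
move=> size_f; elim: M => [|M IH]; first by rewrite !mul1r.
rewrite addSn !exprS -!mulrA homogenizeM ?IH //.
apply: leq_trans (size_polyMleq _ _) _.
have -> : size (('X - 1 : {poly F}) ^+ M) = M.+1.
  by rewrite -polyC1 size_exp_XsubC.
by lia.
Qed.

End Homogenization.

Section Spanning.
Variables (F : fieldType) (charF0 : [pchar F] =i pred0) (n : nat).

Local Notation x := ('X_ord0 : {mpoly F[2]}).
Local Notation y := ('X_ord_max : {mpoly F[2]}).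

(** The exponents 0, ..., n and d - n, ..., d number 2 n + 2, so interpolation
    at these nodes trades x^a y^b for monomials with a small exponent. *)
Lemma monomial_reduction a b : (n < a)%N -> (n < b)%N ->
  exists (c : 'I_(2 * n + 2) -> F) (node : 'I_(2 * n + 2) -> nat) h,
  (forall j, node j <= a + b /\ (node j <= n \/ a + b - node j <= n))%N /\
  x ^+ a * y ^+ b = \sum_j c j *: (x ^+ node j * y ^+ (a + b - node j))
     + (x - y) ^+ (2 * n + 2) * h.
Proof.
move=> lt_na lt_nb; set M := (2 * n + 2)%N; set d := (a + b)%N.
pose node (j : 'I_M) := if (j <= n)%N then (j : nat) else (d - (j - n.+1))%N.
have node_inj : injective node.
  move=> j k; rewrite /node => e; apply: ord_inj.
  have := ltn_ord j; have := ltn_ord k; move: e; rewrite /M /d.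
  move: (nat_of_ord j) (nat_of_ord k) => {}j {}k.
  by clear -lt_na lt_nb; case: (leqP j n) => ?; case: (leqP k n) => ? /=; lia.
have [c [h e]] := interpolation_at_one charF0 a node_inj.
have node_small j : (node j <= d /\ (node j <= n \/ d - node j <= n))%N.
  rewrite /node; have := ltn_ord j; move: (nat_of_ord j) => k.
  by rewrite /M /d; clear -lt_na lt_nb; case: (leqP k n); lia.
exists c, node, (homogenize (d - M) h); split=> //.
have nodeP j : (node j <= d)%N by have [] := node_small j.
have size_h : (size h <= (d - M).+1)%N.
  have [->|nzh] := eqVneq h 0; first by rewrite size_poly0.
  have : (size ((('X - 1 : {poly F}) ^+ M * h)%R : {poly F}) <= d.+1)%N.
    rewrite -e; apply: leq_trans (size_polyD _ _) _.
    rewrite size_polyXn size_polyN geq_max ltnS leq_addr /=.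
    apply: leq_trans (size_sum _ _ _) _; apply/bigmax_leqP => j _.
    by apply: leq_trans (size_scale_leq _ _) _; rewrite size_polyXn ltnS.
  have nz1 : ('X - 1 : {poly F}) ^+ M != 0 by rewrite -polyC1 expf_neq0 // polyXsubC_eq0.
  rewrite size_mul // -polyC1 size_exp_XsubC; move: (size h) => k.
  by rewrite /M /d; clear -lt_na lt_nb; lia.
rewrite -homogenizeMn // -e (_ : (M + (d - M) = d)%N); last by rewrite /M /d; lia.
rewrite linearB (linear_sum (homogenize d)) /= homogenizeXn ?leq_addr // [(d - a)%N]addKn addrC.
rewrite -addrA [- _ + _]addrC -sumrB big1 ?addr0 // => j _.
by rewrite linearZ /= homogenizeXn // subrr.
Qed.

Let U := envelope (witt F).
Implicit Types (s : seq nat) (u v : U).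

Definition mon s : U := \prod_(i <- s) ew F i.

Lemma mon_cat s1 s2 : mon (s1 ++ s2) = mon s1 * mon s2.
Proof. exact: big_cat. Qed.

Lemma mon_cons a s : mon (a :: s) = ew F a * mon s.
Proof. exact: big_cons. Qed.

Lemma mon_pair a b : mon [:: a; b] = ew F a * ew F b.
Proof. by rewrite mon_cons /mon big_seq1. Qed.

(** The Poincare-Birkhoff-Witt filtration. *)
Inductive env_filt (r : nat) : U -> Prop :=
  | env_filt0 : env_filt r 0
  | env_filtD c s u : (size s <= r)%N -> env_filt r u -> env_filt r (c *: mon s + u).

Lemma env_filt_add r u v : env_filt r u -> env_filt r v -> env_filt r (u + v).
Proof.
elim=> [|c s w size_s _ IH] Fv; first by rewrite add0r.
by rewrite -addrA; apply: env_filtD => //; exact: IH.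
Qed.

Lemma env_filt_mon r c s : (size s <= r)%N -> env_filt r (c *: mon s).
Proof. by move=> size_s; rewrite -[_ *: _]addr0; apply: env_filtD => //; exact: env_filt0. Qed.

Lemma env_filt_mon_mul r c s u : env_filt r u ->
  env_filt (size s + r) (c *: mon s * u).
Proof.
elim=> [|d s' v size_s _ IH]; first by rewrite mulr0; exact: env_filt0.
rewrite mulrDr; apply: env_filt_add => //.
rewrite -scalerAl -scalerAr scalerA -mon_cat; apply: env_filt_mon.
by rewrite size_cat leq_add2l.
Qed.

Lemma env_filt_le r r' u : (r <= r')%N -> env_filt r u -> env_filt r' u.
Proof.
move=> le_r; elim=> [|c s v size_s _ IH]; first exact: env_filt0.
by apply: env_filtD => //; exact: leq_trans le_r.
Qed.

Lemma env_filt_mul r r' u v : env_filt r u -> env_filt r' v -> env_filt (r + r') (u * v).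
Proof.
move=> Fu Fv; elim: Fu => [|c s w size_s _ IH]; first by rewrite mul0r; exact: env_filt0.
rewrite mulrDl; apply: env_filt_add => //.
by apply: env_filt_le (env_filt_mon_mul c s Fv); rewrite leq_add2r.
Qed.

Lemma env_filt_exhaustive u : exists r, env_filt r u.
Proof.
elim/env_ind: u => [f|c|u v [r Fu] [r' Fv]|u v [r Fu] [r' Fv]].
- exists 1; rewrite -[f]coefK poly_def.
  rewrite (linear_sum (@env_in F (witt F))).
  elim/big_rec: _ => [|i u _ Fu]; first exact: env_filt0.
  suff : env_filt 1 (f`_i *: ew F i + u) by rewrite /ew -env_inZ.
  apply: env_filt_add => //.
  by have := @env_filt_mon 1 f`_i [:: (i : nat)] isT; rewrite /mon big_seq1.
- by exists 0; have := @env_filt_mon 0 c [::] isT; rewrite /mon big_nil.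
- exists (maxn r r'); apply: env_filt_add.
    by apply: env_filt_le Fu; rewrite leq_maxl.
  by apply: env_filt_le Fv; rewrite leq_maxr.
by exists (r + r'); exact: env_filt_mul.
Qed.

Lemma mon_swap a b s : env_filt (size s).+1 (mon (a :: b :: s) - mon (b :: a :: s)).
Proof.
rewrite !mon_cons !mulrA -mulrBl ew_comm -scalerAl -mon_cons.
exact: env_filt_mon.
Qed.

Lemma env_filt_opp r u : env_filt r u -> env_filt r (- u).
Proof.
elim=> [|c s v size_s _ IH]; first by rewrite oppr0; exact: env_filt0.
by rewrite opprD -scaleNr; exact: env_filtD.
Qed.

Lemma mon_insert a s1 s2 :
  env_filt (size s1 + size s2) (mon (s1 ++ a :: s2) - mon (a :: s1 ++ s2)).
Proof.
elim: s1 => [|b s1 IH]; first by rewrite subrr; exact: env_filt0.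
rewrite -[X in X - _](subrK (mon (b :: a :: s1 ++ s2))) -addrA; apply: env_filt_add.
  rewrite !mon_cons -mulrBr -mon_cons.
  have := env_filt_mon_mul 1 [:: b] IH.
  by rewrite scale1r /mon big_seq1 -/(mon _).
by have := mon_swap b a (s1 ++ s2); rewrite size_cat.
Qed.

(** The commutator of two generators is a multiple of a single generator. *)
Lemma mon_perm s s' : perm_eq s s' -> env_filt (size s).-1 (mon s - mon s').
Proof.
elim: s s' => [|a s IH] s' /=.
  by rewrite perm_sym => /perm_nilP ->; rewrite subrr; exact: env_filt0.
move=> pss'; have /splitPr s'E : a \in s' by rewrite -(perm_mem pss') mem_head.
case: s'E pss' => s1 s2 pss'.
have pss : perm_eq s (s1 ++ s2).
  by rewrite -(perm_cons a); apply: perm_trans pss' _; rewrite -cat1s perm_catCA.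
rewrite -[X in X - _](subrK (mon (a :: s1 ++ s2))) -addrA; apply: env_filt_add.
  rewrite !mon_cons -mulrBr.
  case: s IH pss {pss'} => [|b s] IH pss.
    rewrite (_ : _ - _ = 0) ?mulr0; first exact: env_filt0.
    by move: pss; rewrite perm_sym => /perm_nilP ->; rewrite subrr.
  have := env_filt_mon_mul 1 [:: a] (IH _ pss).
  by rewrite scale1r /mon big_seq1 -/(mon _).
rewrite -opprB; apply: env_filt_opp.
by rewrite (perm_size pss) size_cat; exact: mon_insert.
Qed.

(** The words to which neither a commutation nor the relation of
    [monomial_reduction] applies. *)
Definition normal s := sorted leq s && (count (ltn n) s <= 1)%N.

Let I := principal_ideal (wprod ((x - y) ^+ (2 * n + 2))).

Definition normal_span u := exists v (S : seq (seq nat)) (c : seq nat -> F),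
  [/\ I v, uniq S, all normal S & u = v + \sum_(s <- S) c s *: mon s].

Lemma normal_span_ideal v : I v -> normal_span v.
Proof. by move=> Iv; exists v, [::], (fun=> 0); rewrite big_nil addr0. Qed.

Lemma normal_span_mon c s u : normal s -> normal_span u -> normal_span (c *: mon s + u).
Proof.
move=> normal_s [v [S [d [Iv uniqS normalS ->]]]].
have [sS|sS] := boolP (s \in S).
  exists v, S, (fun s' => d s' + (if s' == s then c else 0)); split=> //.
  rewrite addrCA; congr (_ + _).
  rewrite !(bigD1_seq s) //= eqxx scalerDl addrA [c *: _ + _]addrC; congr (_ + _).
  by apply: eq_bigr => s' /negPf ->; rewrite addr0.
exists v, (s :: S), (fun s' => if s' == s then c else d s').
rewrite /= sS uniqS normal_s normalS big_cons eqxx addrCA; split=> //.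
congr (_ + (_ + _)); rewrite !big_seq; apply: eq_bigr => s' s'S.
by case: eqP => // e; rewrite -e s'S in sS.
Qed.

Lemma normal_span_add u v : normal_span u -> normal_span v -> normal_span (u + v).
Proof.
move=> Nu [w [S [d [Iw _ normalS ->]]]].
have Nuw : normal_span (u + w).
  case: Nu => [v' [S' [c [Iv' uniqS' normalS' ->]]]].
  by exists (v' + w), S', c; split=> //; [exact: principal_idealD|rewrite addrAC].
rewrite addrA; elim: S normalS => [|s S IH] /=; first by rewrite big_nil addr0.
case/andP=> normal_s normalS; rewrite big_cons addrCA.
by apply: normal_span_mon => //; exact: IH.
Qed.

Lemma normal_spanZ c u : normal_span u -> normal_span (c *: u).
Proof.
move=> [v [S [d [Iv uniqS normalS ->]]]].
exists (c *: v), S, (fun s => c * d s); split=> //; first exact: principal_idealZ.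
by rewrite scalerDr scaler_sumr; under [in RHS]eq_bigr => s _ do rewrite -scalerA.
Qed.

(** Induction on the length, and for a given length on the number of letters above
    n: two such letters are moved to the end of the word, where the reduction
    trades them for pairs with at most one such letter. *)
Lemma mon_normal_span s : (1 <= n)%N -> normal_span (mon s).
Proof.
move=> n_gt0.
move: {2}(size s) (leqnn (size s)) => r; elim: r s => [|r IHr] s size_s.
  have -> : s = [::] by apply: size0nil; lia.
  rewrite -[mon _]scale1r -[_ *: _]addr0; apply: normal_span_mon => //.
  exact/normal_span_ideal/principal_ideal0.
have filt_span u : env_filt r u -> normal_span u.
  elim=> [|c s' v size_s' _ IH]; first exact/normal_span_ideal/principal_ideal0.
  by apply: normal_span_add => //; apply: normal_spanZ; exact: IHr.
have perm_span s1 s2 : (size s1 <= r.+1)%N -> perm_eq s1 s2 ->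
    normal_span (mon s2) -> normal_span (mon s1).
  move=> size_s1 p12 N2; rewrite -(subrK (mon s2) (mon s1)).
  apply: normal_span_add => //; apply: filt_span.
  by apply: env_filt_le (mon_perm p12); lia.
have normal_case t : (size t <= r.+1)%N -> (count (ltn n) t <= 1)%N -> normal_span (mon t).
  move=> size_t count_t; apply: (perm_span _ (sort leq t)) => //.
    by rewrite perm_sym perm_sort.
  rewrite -[mon _]scale1r -[_ *: _]addr0; apply: normal_span_mon.
    rewrite /normal sort_sorted /=; last exact: leq_total.
    by rewrite (permP (permEl (perm_sort leq t))).
  exact/normal_span_ideal/principal_ideal0.
move: {2}(count _ s) (leqnn (count (ltn n) s)) => k.
elim: k s size_s => [|k IHk] s size_s count_s.
  by apply: normal_case => //; exact: leq_trans count_s _.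
have [small|big] := leqP (count (ltn n) s) 1; first exact: normal_case.
pose t := [seq i <- s | ~~ (n < i)%N]; pose w := [seq i <- s | (n < i)%N].
have size_w : size w = count (ltn n) s by rewrite size_filter.
have pst : perm_eq s (t ++ w).
  by rewrite perm_sym perm_catC perm_filterC.
have big_w : all (ltn n) w by exact: filter_all.
have {big} : (1 < size w)%N by rewrite size_w.
case: w size_w pst big_w => [//|a [//|b w]] size_w pst /= + _.
case/and3P=> lt_na lt_nb big_w.
apply: (perm_span _ ((t ++ w) ++ [:: a; b])) => //.
  apply: perm_trans pst _; rewrite -catA perm_cat2l.
  by rewrite -[[:: a, b & w]]/([:: a; b] ++ w) perm_catC.
have [c [node [h [nodeP e]]]] := monomial_reduction lt_na lt_nb.
have -> : mon ((t ++ w) ++ [:: a; b]) = mon (t ++ w) * wprod (x ^+ a * y ^+ b).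
  by rewrite mon_cat wprod_mon mon_pair.
rewrite e linearD mulrDr; apply: normal_span_add; last first.
  apply/normal_span_ideal/principal_idealMl; rewrite mulrC.
  apply: principal_ideal_wprod => //; first by lia.
  by rewrite oddD oddM.
rewrite linear_sum mulr_sumr.
elim/big_rec: _ => [|j u _ Nu]; first exact/normal_span_ideal/principal_ideal0.
apply: normal_span_add => //; rewrite linearZ /= -scalerAr; apply: normal_spanZ.
rewrite wprod_mon; have -> : mon (t ++ w) * (ew F (node j) * ew F (a + b - node j)) =
    mon ((t ++ w) ++ [:: node j; (a + b - node j)%N]).
  by rewrite [RHS]mon_cat mon_pair.
have := perm_size pst; rewrite !size_cat /= => size_tw.
apply: IHk; first by rewrite !size_cat /=; lia.
have /permP /(_ (ltn n)) := pst; rewrite !count_cat /= lt_na lt_nb => count_tw.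
by have [_ []] := nodeP j; rewrite leqNgt => /negPf -> /=; lia.
Qed.

Lemma normal_spanT u : (1 <= n)%N -> normal_span u.
Proof.
move=> n_gt0; have [r] := env_filt_exhaustive u.
elim=> [|c s v _ _ IH]; first exact/normal_span_ideal/principal_ideal0.
by apply: normal_span_add => //; apply: normal_spanZ; exact: mon_normal_span.
Qed.

End Spanning.

(** * Independence of the normal monomials: the commutative computation *)

Section SymbolIndependence.
Variables (F : fieldType) (charF0 : [pchar F] =i pred0).
Implicit Types (s : seq nat) (z : nat -> F).

Lemma poly_eq0_nat (p : {poly F}) : (forall k : nat, p.[k%:R] = 0) -> p = 0.
Proof.
move=> p0; apply/eqP; apply: contraT => nzp.
have := @max_poly_roots _ p [seq k%:R | k <- iota 0 (size p)] nzp.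
rewrite size_map size_iota ltnn; move=> /(_ _ _) h; apply: h.
  by apply/allP => _ /mapP [k _ ->]; rewrite /root p0.
by rewrite map_inj_uniq ?iota_uniq //; exact: natr_inj.
Qed.

(** For words of length below K the multiplicities of the letters are the digits
    of the code in base K. *)
Definition base_code (K : nat) s := (\sum_(i <- s) K ^ i)%N.

Lemma base_code_rcons K s a : base_code K (rcons s a) = (base_code K s + K ^ a)%N.
Proof. by rewrite /base_code -cats1 big_cat big_seq1. Qed.

Lemma sorted_leq_rcons s a :
  sorted leq (rcons s a) = all (leq^~ a) s && sorted leq s.
Proof. by rewrite !(sorted_pairwise leq_trans) pairwise_rcons. Qed.

Lemma base_code_inj K s s' : (1 < K)%N -> sorted leq s -> sorted leq s' ->
  (size s < K)%N -> (size s' < K)%N -> base_code K s = base_code K s' -> s = s'.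
Proof.
move=> K_gt1.
have bound u a : sorted leq (rcons u a) -> (size (rcons u a) < K)%N ->
    (base_code K (rcons u a) < K ^ a.+1)%N.
  rewrite sorted_leq_rcons => /andP [/allP ua _] size_u.
  apply: (@leq_ltn_trans (size (rcons u a) * K ^ a)); last first.
    by rewrite expnS ltn_pmul2r // expn_gt0; lia.
  rewrite /base_code -sum1_size big_distrl /= !big_seq; apply: leq_sum => i.
  by rewrite mul1n leq_exp2l // mem_rcons inE => /predU1P [-> //|]; exact: ua.
have code_gt0 u a : (0 < base_code K (rcons u a))%N.
  by rewrite base_code_rcons addn_gt0 expn_gt0; lia.
have max_le u a u' a' : sorted leq (rcons u a) -> (size (rcons u a) < K)%N ->
    base_code K (rcons u a) = base_code K (rcons u' a') -> (a' <= a)%N.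
  move=> su size_u e; rewrite leqNgt; apply/negP => lt_aa'.
  have := bound _ _ su size_u; rewrite e base_code_rcons ltnNge => /negP; apply.
  by apply: leq_trans (leq_addl _ _); rewrite leq_exp2l.
elim/last_ind: s s' => [|s a IH] s'; case/lastP: s' => [|s' a'] //.
- by move=> _ _ _ _ e; have := code_gt0 s' a'; rewrite -e /base_code big_nil.
- by move=> _ _ _ _ e; have := code_gt0 s a; rewrite e /base_code big_nil.
move=> srt srt' sz sz' e.
have ea : a = a'.
  by apply/eqP; rewrite eqn_leq (max_le _ _ _ _ srt' sz' (esym e)) (max_le _ _ _ _ srt sz e).
move: srt srt' sz sz'; rewrite !sorted_leq_rcons !size_rcons -ea.
move=> /andP[_ srt] /andP[_ srt'] sz sz'; congr rcons; apply: IH => //; try lia.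
by apply/eqP; rewrite -(eqn_add2r (K ^ a)) -base_code_rcons e ea base_code_rcons.
Qed.

(** Evaluating at z_i = u^(K^i) turns distinct monomials into distinct powers
    of u. *)
Lemma monomials_free (S : seq (seq nat)) (c : seq nat -> F) :
  uniq S -> all (sorted leq) S ->
  (forall z, \sum_(s <- S) c s * \prod_(i <- s) z i = 0) ->
  forall s, s \in S -> c s = 0.
Proof.
move=> uniqS sortedS S0 s sS.
pose K := (\max_(s <- S) size s).+2.
have sizeK u : u \in S -> (size u < K)%N.
  by move=> uS; rewrite /K ltnS; apply: leqW; exact: leq_bigmax_seq.
pose P : {poly F} := \sum_(u <- S) c u *: 'X^(base_code K u).
have P0 : P = 0.
  apply: poly_eq0_nat => k; rewrite horner_sum -[RHS](S0 (fun i => k%:R ^+ (K ^ i))).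
  apply: eq_bigr => u _; rewrite hornerZ hornerXn; congr (_ * _).
  by rewrite /base_code; elim/big_rec2: _ => [|i x y _ <-]; rewrite ?expr0 ?exprD.
have := coef0 F (base_code K s); rewrite -P0 coef_sum (bigD1_seq s) //=.
rewrite coefZ coefXn eqxx mulr1 big_seq_cond big1 ?addr0 // => u /andP [uS ne].
rewrite coefZ coefXn; case: eqP => [e|]; last by rewrite mulr0.
case/eqP: ne; apply: (@base_code_inj K) => //; try exact: sizeK.
- exact: (allP sortedS).
- exact: (allP sortedS).
Qed.

Variable n : nat.

(** The principal symbol of the vector field t^b d/dt on n-jets over the point
    t0, at the covector xi. *)
Definition symbol (t0 : F) (xi : nat -> F) (b : nat) : F :=
  \sum_(j < n.+1) ('X^b)^`N(j).[t0] * xi j.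

Lemma symbolE t0 xi b :
  symbol t0 xi b = \sum_(j < n.+1) t0 ^+ (b - j) *+ 'C(b, j) * xi j.
Proof.
by apply: eq_bigr => j _; rewrite poly.nderivnXn hornerMn hornerXn.
Qed.

Lemma coef_XsubC_exp (t0 : F) j i :
  (('X - t0%:P) ^+ j)`_i = (- t0) ^+ (j - i) *+ 'C(j, i).
Proof.
elim: j i => [|j IH] i; first by rewrite expr0 coef1; case: i.
rewrite exprS mulrBl coefB coefXM coefCM.
case: i => [|i] /=; first by rewrite IH !bin0 !subn0 !mulr1n sub0r -mulNr -exprS.
rewrite !IH subSS binS mulrnDr addrC; congr (_ + _).
have [lt_ij|le_ji] := ltnP i j; last by rewrite !bin_small ?mulr0n ?mulr0 ?oppr0.
by rewrite mulrnAr -mulNrn -mulNr -exprS subnSK.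
Qed.

(** A covector is a functional on the polynomials of degree at most n, and the
    symbol of t^b d/dt is its value at the Taylor polynomial of X^b at t0. For
    the functional X^i -> z_i the first n + 1 symbols are therefore z_0, ..., z_n
    whatever t0 is. *)
Definition dual_point (z : nat -> F) (t0 : F) (j : nat) : F :=
  \sum_(i < n.+1) (('X - t0%:P) ^+ j)`_i * z i.

Lemma symbol_small z t0 b : (b <= n)%N -> symbol t0 (dual_point z t0) b = z b.
Proof.
move=> le_bn; rewrite symbolE.
transitivity (\sum_(i < n.+1) ('X^b : {poly F})`_i * z i); last first.
  rewrite (bigD1 (Ordinal (le_bn : b < n.+1)%N)) //= coefXn eqxx mul1r big1 ?addr0 //.
  move=> i ne; rewrite coefXn (_ : (i == b :> nat) = false) ?mul0r //.
  by apply: contra_neqF ne => /eqP ?; exact: val_inj.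
have -> : ('X^b : {poly F}) =
    \sum_(j < n.+1) (t0 ^+ (b - j) *+ 'C(b, j)) *: ('X - t0%:P) ^+ j.
  rewrite -(big_mkord xpredT (fun j => (t0 ^+ (b - j) *+ 'C(b, j)) *: ('X - t0%:P) ^+ j)).
  rewrite (@big_cat_nat _ _ _ b.+1) //= [X in _ + X]big_nat_cond [X in _ + X]big1 ?addr0.
    rewrite big_mkord -{1}['X](subrK t0%:P) addrC exprDn; apply: eq_bigr => j _.
    by rewrite -mul_polyC polyCMn rmorphXn mulrnAl.
  by move=> j /andP[/andP[lt_bj _] _]; rewrite bin_small ?mulr0n ?scale0r.
under [RHS]eq_bigr => i _ do rewrite coef_sum big_distrl /=.
rewrite exchange_big /=; apply: eq_bigr => j _; rewrite big_distrr /=.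
by apply: eq_bigr => i _; rewrite coefZ mulrA.
Qed.

Lemma alternating_binomial_sum b m :
  \sum_(j < m.+1) (-1) ^+ j *+ 'C(b.+1, j) = (-1) ^+ m *+ 'C(b, m) :> F.
Proof.
elim: m => [|m IH]; first by rewrite big_ord1 !bin0.
by rewrite big_ord_recr /= IH binS mulrnDr addrCA exprS mulN1r !mulNrn subrr addr0.
Qed.

(** The constant term of the Taylor polynomial is responsible for the power b
    of t0. *)
Lemma symbol_large z b : (n < b)%N -> exists q : {poly F},
  [/\ (size q <= b.+1)%N, q`_b = (-1) ^+ n *+ 'C(b.-1, n) * z 0%N
    & forall t0, symbol t0 (dual_point z t0) b = q.[t0]].
Proof.
move=> lt_nb.
exists (\sum_(j < n.+1) \sum_(i < n.+1)
  ((-1) ^+ (j - i) *+ 'C(j, i) *+ 'C(b, j) * z i) *: 'X^(b - j + (j - i))).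
split.
- apply: leq_trans (size_sum _ _ _) _; apply/bigmax_leqP => j _.
  apply: leq_trans (size_sum _ _ _) _; apply/bigmax_leqP => i _.
  apply: leq_trans (size_scale_leq _ _) _; rewrite size_polyXn ltnS.
  by have := ltn_ord j; lia.
- rewrite coef_sum -[in RHS](prednK (leq_ltn_trans (leq0n n) lt_nb)) /=.
  rewrite -alternating_binomial_sum big_distrl (prednK (leq_ltn_trans (leq0n n) lt_nb)).
  apply: eq_bigr => j _ /=.
  have lt_jb : (j <= b)%N by have := ltn_ord j; lia.
  rewrite coef_sum big_ord_recl coefZ coefXn /= subn0 subnK // eqxx mulr1 bin0 mulr1n.
  rewrite big1 ?addr0 // => i _; rewrite coefZ coefXn /bump /= add1n.
  have [le_ij|lt_ji] := leqP i.+1 j.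
    by rewrite (_ : (b == _) = false) ?mulr0 //; apply/eqP; lia.
  by rewrite bin_small // mulr0n mul0rn !mul0r.
move=> t0; rewrite symbolE horner_sum; apply: eq_bigr => j _.
rewrite horner_sum /dual_point big_distrr /=; apply: eq_bigr => i _.
rewrite hornerZ hornerXn coef_XsubC_exp exprD [(- t0) ^+ _]exprNn.
move: (t0 ^+ (b - j)) (t0 ^+ (j - i)) ((-1) ^+ (j - i)) => u v w.
by move: 'C(b, j) 'C(j, i) => k l; ring.
Qed.

Let lead_neq0 b : (n < b)%N -> (-1) ^+ n *+ 'C(b.-1, n) != 0 :> F.
Proof.
move=> lt_nb; rewrite -mulr_natr mulf_neq0 //; first by rewrite signr_eq0.
by rewrite natr_neq0 // bin_gt0; lia.
Qed.

Let normal_cases s : normal n s ->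
  all (geq n) s \/ exists s' b, [/\ s = rcons s' b, (n < b)%N & all (geq n) s'].
Proof.
case/lastP: s => [|s b]; first by left.
rewrite /normal sorted_leq_rcons -cats1 count_cat /= addn0 => /andP [/andP [sb _]].
have [lt_nb|le_bn] /= := ltnP n b.
  rewrite addn1 ltnS leqn0 => s0; right; exists s, b.
  split=> //; first by rewrite cats1.
  apply/allP => i iS; rewrite /= leqNgt; apply: contraL s0 => lt_ni.
  by rewrite -lt0n -has_count; apply/hasP; exists i.
move=> _; left; rewrite all_cat /= le_bn !andbT.
by apply: sub_all sb => i /= /leq_trans; apply.
Qed.

(** With z fixed the relation is polynomial in t0. Once the words with a letter
    above B are known to have zero coefficients, the coefficient of t0^B only
    involves the words that end in B, and it is a relation between monomials in
    z. *)
Lemma normal_symbols_free (S : seq (seq nat)) (c : seq nat -> F) :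
  uniq S -> all (normal n) S ->
  (forall t0 xi, \sum_(s <- S) c s * \prod_(b <- s) symbol t0 xi b = 0) ->
  forall s, s \in S -> c s = 0.
Proof.
move=> uniqS normalS S0.
have small_prod z t0 s : all (geq n) s ->
    \prod_(b <- s) symbol t0 (dual_point z t0) b = \prod_(b <- s) z b.
  move=> /allP ss; rewrite !big_seq; apply: eq_bigr => b bs.
  by rewrite symbol_small //; exact: ss.
have sorted_normal s : normal n s -> sorted leq s by case/andP.
have big_vanish B : (n < B)%N ->
    (forall s b, rcons s b \in S -> (B < b)%N -> c (rcons s b) = 0) ->
    forall s, rcons s B \in S -> c (rcons s B) = 0.
  move=> lt_nB hB.
  pose T := [seq s <- S | last 0%N s == B].
  suff hT : forall s, s \in T -> c s = 0.
    by move=> s sS; apply: hT; rewrite mem_filter last_rcons eqxx.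
  (* The letter B contributes z_0 to the coefficient of t0^B, so it is replaced by
     a letter 0, at the front to keep the word sorted. *)
  pose f s := 0%N :: rev (behead (rev s)).
  have TE s : s \in T -> exists s',
      [/\ s = rcons s' B, f s = 0%N :: s', all (geq n) s' & s \in S].
    rewrite mem_filter => /andP [/eqP e sS].
    have := allP normalS _ sS; case/normal_cases => [small|[s' [b [es lt_nb small]]]].
      have : B \in 0%N :: s by rewrite -e mem_last.
      by rewrite inE => /predU1P [|/(allP small)] /=; lia.
    exists s'; rewrite es last_rcons in e; rewrite es e; split=> //; last by rewrite -e -es.
    by rewrite /f rev_rcons /= revK.
  have f_inj : {in T &, injective f}.
    move=> s1 s2 /TE [s1' [-> -> _ _]] /TE [s2' [-> -> _ _]] [->] //.
  have uniqT : uniq (map f T) by rewrite map_inj_in_uniq // filter_uniq.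
  pose c' (u : seq nat) := c (rcons (behead u) B).
  have fc s : s \in T -> c' (f s) = c s.
    by case/TE=> s' [-> -> _ _].
  have /monomials_free h : forall z, \sum_(u <- map f T) c' u * \prod_(i <- u) z i = 0.
    move=> z.
    have /boolp.choice [Q QE] : forall b, exists Qb : {poly F},
        [/\ (forall t0, symbol t0 (dual_point z t0) b = Qb.[t0]),
            (b <= n)%N -> Qb = (z b)%:P
          & (n < b)%N -> (size Qb <= b.+1)%N /\
              Qb`_b = (-1) ^+ n *+ 'C(b.-1, n) * z 0%N].
      move=> b; have [le_bn|lt_nb] := leqP b n.
        by exists (z b)%:P; split=> // t0; rewrite symbol_small // hornerC.
      by have [Qb [size_Q lead_Q EQ]] := symbol_large z lt_nb; exists Qb; split.
    pose P : {poly F} := \sum_(s <- S) c s *: \prod_(b <- s) Q b.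
    have P0 : P = 0.
      apply: poly_eq0_nat => k; rewrite horner_sum -[RHS](S0 k%:R (dual_point z k%:R)).
      apply: eq_bigr => s _; rewrite hornerZ horner_prod; congr (_ * _).
      by apply: eq_bigr => b _; have [->] := QE b.
    have Qsmall s : all (geq n) s -> \prod_(b <- s) Q b = (\prod_(b <- s) z b)%:P.
      move=> /allP ss; rewrite rmorph_prod !big_seq; apply: eq_bigr => b bs.
      by have [_ -> //] := QE b; exact: ss.
    have := coef0 F B; rewrite -P0 coef_sum (bigID (fun s => last 0%N s == B)) /=.
    rewrite [X in _ + X]big_seq_cond [X in _ + X]big1 ?addr0 => [|s /andP [sS neB]]; last first.
      rewrite coefZ; have := allP normalS _ sS.
      case/normal_cases => [small|[s' [b [es lt_nb small]]]].
        by rewrite Qsmall // coefC (_ : (B == 0%N) = false) ?mulr0 //; apply/eqP; lia.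
      rewrite es in sS neB *; rewrite last_rcons in neB.
      have [ltBb|ltbB|ebB] := ltngtP B b; last by rewrite ebB eqxx in neB.
        by rewrite hB ?mul0r.
      rewrite -cats1 big_cat big_seq1 /= Qsmall // coefCM.
      have [_ _ /(_ lt_nb) [size_Q _]] := QE b.
      by rewrite [(Q b)`_B]nth_default ?mulr0 //; exact: leq_trans size_Q _.
    rewrite -big_filter -/T => e.
    apply: (mulfI (lead_neq0 lt_nB)); rewrite mulr0 -[RHS]e big_map big_distrr /=.
    rewrite !big_seq; apply: eq_bigr => s sT; rewrite fc //.
    have [s' [es efs small _]] := TE _ sT.
    rewrite efs big_cons coefZ es -cats1 big_cat big_seq1 /= Qsmall // coefCM.
    have [_ _ /(_ lt_nB) [_ ->]] := QE B.
    by rewrite mulrCA; congr (_ * _); rewrite mulrA mulrC.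
  move=> s sT; rewrite -fc //; apply: h => //; last by rewrite map_f.
  apply/allP => _ /mapP [u uT ->]; have [s' [es -> _ uS]] := TE _ uT.
  rewrite /= path_sortedE; last exact: leq_trans.
  have := allP normalS _ uS; rewrite /normal es sorted_leq_rcons => /andP [/andP [_ ->] _].
  by rewrite andbT; apply/allP.
have big_zero s b : rcons s b \in S -> (n < b)%N -> c (rcons s b) = 0.
  pose top := (\max_(s <- S) last 0%N s)%N.
  have top_max u : u \in S -> (last 0%N u <= top)%N by move=> uS; exact: leq_bigmax_seq.
  have [k] : exists k, (top - b <= k)%N by exists (top - b)%N.
  elim: k s b => [|k IH] s b le_k sS lt_nb; apply: big_vanish => // s' b' sS' lt_bb'.
    by have := top_max _ sS'; rewrite last_rcons; lia.
  have := top_max _ sS'; rewrite last_rcons => ?.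
  by apply: IH => //; lia.
pose T := [seq s <- S | all (geq n) s].
have /monomials_free h z : \sum_(s <- T) c s * \prod_(i <- s) z i = 0.
  rewrite -[RHS](S0 0 (dual_point z 0)) [RHS](bigID (fun s => all (geq n) s)) /=.
  rewrite [X in _ = _ + X]big_seq_cond [X in _ = _ + X]big1 ?addr0 => [|s /andP [sS ns]].
    rewrite -[RHS]big_filter !big_seq; apply: eq_bigr => s.
    by rewrite mem_filter => /andP [? _]; rewrite small_prod.
  have := allP normalS _ sS; case/normal_cases => [small|[s' [b [es lt_nb _]]]].
    by rewrite small in ns.
  by rewrite es big_zero ?mul0r // -es.
move=> s sS; have := allP normalS _ sS.
case/normal_cases => [small|[s' [b [es lt_nb _]]]].
  apply: h; rewrite ?filter_uniq ?mem_filter ?small //.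
  by apply/allP => u; rewrite mem_filter => /andP [_ /(allP normalS) /sorted_normal].
by rewrite es big_zero // -es.
Qed.

End SymbolIndependence.

(** * Differential operators of order at most one *)

Section Endomorphisms.
Variables (F : fieldType) (A : algType F).

(** The endomorphisms of the vector space underlying A; its unit is a nonzero
    vector, so that they form a nontrivial ring. *)
Record endo := Endo { endo_fun :> A -> A; endo_linear : linear endo_fun }.
HB.instance Definition _ := boolp.gen_eqMixin endo.
HB.instance Definition _ := boolp.gen_choiceMixin endo.

Lemma endoP (f g : endo) : (forall x, f x = g x) -> f = g.
Proof.
case: f g => [f fL] [g gL] /= /boolp.funext fg; move: fL gL; rewrite {}fg => fL gL.
by congr Endo; exact: boolp.Prop_irrelevance.
Qed.

Lemma endo_add_linear (f g : endo) : linear (fun x => f x + g x).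
Proof. by move=> c x y; rewrite !endo_linear scalerDr addrACA. Qed.
Lemma endo_opp_linear (f : endo) : linear (fun x => - f x).
Proof. by move=> c x y; rewrite endo_linear opprD scalerN. Qed.
Lemma endo_zero_linear : linear (fun _ : A => 0 : A).
Proof. by move=> c x y; rewrite scaler0 addr0. Qed.
Lemma endo_one_linear : linear (fun x : A => x).
Proof. by []. Qed.
Lemma endo_mul_linear (f g : endo) : linear (fun x => f (g x)).
Proof. by move=> c x y; rewrite !endo_linear. Qed.
Lemma endo_scale_linear a (f : endo) : linear (fun x => a *: f x).
Proof. by move=> c x y; rewrite endo_linear scalerDr !scalerA mulrC. Qed.

Definition endo_add f g := Endo (endo_add_linear f g).
Definition endo_opp f := Endo (endo_opp_linear f).
Definition endo_zero := Endo endo_zero_linear.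
Definition endo_one := Endo endo_one_linear.
Definition endo_mul f g := Endo (endo_mul_linear f g).
Definition endo_scale a f := Endo (endo_scale_linear a f).

Lemma endo_addA : associative endo_add.
Proof. by move=> f g h; apply: endoP => x /=; rewrite addrA. Qed.
Lemma endo_addC : commutative endo_add.
Proof. by move=> f g; apply: endoP => x /=; rewrite addrC. Qed.
Lemma endo_add0 : left_id endo_zero endo_add.
Proof. by move=> f; apply: endoP => x /=; rewrite add0r. Qed.
Lemma endo_addN : left_inverse endo_zero endo_opp endo_add.
Proof. by move=> f; apply: endoP => x /=; rewrite addNr. Qed.
HB.instance Definition _ := GRing.isZmodule.Build endo
  endo_addA endo_addC endo_add0 endo_addN.

Lemma endo_fun0 (f : endo) : f 0 = 0.
Proof. by have := endo_linear f (-1) 0 0; rewrite !scaleN1r !addNr. Qed.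
Lemma endo_funD (f : endo) x y : f (x + y) = f x + f y.
Proof. by have := endo_linear f 1 x y; rewrite !scale1r. Qed.
Lemma endo_funZ (f : endo) c x : f (c *: x) = c *: f x.
Proof. by rewrite -[c *: x]addr0 endo_linear endo_fun0 addr0. Qed.

Lemma endo_mulA : associative endo_mul.
Proof. by move=> f g h; apply: endoP. Qed.
Lemma endo_mul1 : left_id endo_one endo_mul.
Proof. by move=> f; apply: endoP. Qed.
Lemma endo_mulr1 : right_id endo_one endo_mul.
Proof. by move=> f; apply: endoP. Qed.
Lemma endo_mulDl : left_distributive endo_mul +%R.
Proof. by move=> f g h; apply: endoP. Qed.
Lemma endo_mulDr : right_distributive endo_mul +%R.
Proof. by move=> f g h; apply: endoP => x /=; rewrite endo_funD. Qed.
Lemma endo_1_neq0 : endo_one != 0.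
Proof.
apply/eqP => /(congr1 (fun f : endo => f 1)) /= e.
by have := oner_neq0 A; rewrite e eqxx.
Qed.
HB.instance Definition _ := GRing.Zmodule_isNzRing.Build endo
  endo_mulA endo_mul1 endo_mulr1 endo_mulDl endo_mulDr endo_1_neq0.

Lemma endo_scaleA a b f : endo_scale a (endo_scale b f) = endo_scale (a * b) f.
Proof. by apply: endoP => x /=; rewrite scalerA. Qed.
Lemma endo_scale1 : left_id 1 endo_scale.
Proof. by move=> f; apply: endoP => x /=; rewrite scale1r. Qed.
Lemma endo_scaleDr : right_distributive endo_scale +%R.
Proof. by move=> a f g; apply: endoP => x /=; rewrite scalerDr. Qed.
Lemma endo_scaleDl f : {morph endo_scale^~ f : a b / a + b}.
Proof. by move=> a b; apply: endoP => x /=; rewrite scalerDl. Qed.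
HB.instance Definition _ := GRing.Zmodule_isLmodule.Build F endo
  endo_scaleA endo_scale1 endo_scaleDr endo_scaleDl.

Lemma endo_scaleAl a (f g : endo) : a *: (f * g) = (a *: f) * g.
Proof. exact: endoP. Qed.
HB.instance Definition _ := GRing.Lmodule_isLalgebra.Build F endo endo_scaleAl.
Lemma endo_scaleAr a (f g : endo) : a *: (f * g) = f * (a *: g).
Proof. by apply: endoP => x; rewrite /= endo_funZ. Qed.
HB.instance Definition _ := GRing.Lalgebra_isAlgebra.Build F endo endo_scaleAr.

Lemma endoBE (f g : endo) x : (f - g) x = f x - g x. Proof. by []. Qed.
Lemma endoME (f g : endo) x : (f * g) x = f (g x). Proof. by []. Qed.
Lemma endoZE a (f : endo) x : (a *: f) x = a *: f x. Proof. by []. Qed.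
Lemma endo1E x : (1 : endo) x = x. Proof. by []. Qed.
Lemma endo0E x : (0 : endo) x = 0. Proof. by []. Qed.

Lemma endo_sumE I (r : seq I) (P : pred I) (f : I -> endo) x :
  (\sum_(i <- r | P i) f i) x = \sum_(i <- r | P i) f i x.
Proof. by elim/big_rec2: _ => // i y g _ <-. Qed.

End Endomorphisms.

Section FirstOrder.
Variables (F : fieldType) (k : nat).
Local Notation A := {mpoly F[k]}.
Implicit Types (c d : 'I_k -> A) (f g p q : A).

Definition mpoly_der c p : A := \sum_j c j * p^`M(j).

Lemma mpoly_der_linear c : linear (mpoly_der c).
Proof.
move=> a p q; rewrite /mpoly_der scaler_sumr -big_split; apply: eq_bigr => j _.
by rewrite /= mderivD mderivZ mulrDr scalerAr.
Qed.
HB.instance Definition _ c := GRing.isLinear.Build F A A *:%R (mpoly_der c)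
  (mpoly_der_linear c).

Lemma mpoly_derM c p q : mpoly_der c (p * q) = mpoly_der c p * q + p * mpoly_der c q.
Proof.
rewrite /mpoly_der mulr_suml mulr_sumr -big_split; apply: eq_bigr => j _.
by rewrite /= mderivM; ring.
Qed.

Lemma mpoly_derX c i : mpoly_der c 'X_i = c i.
Proof.
rewrite /mpoly_der (bigD1 i) //= mderivU eqxx mulr1 big1 ?addr0 // => j ne.
by rewrite mderivU eq_sym (negPf ne) mulr0.
Qed.

Lemma mpoly_der_comm c d p : mpoly_der c (mpoly_der d p) - mpoly_der d (mpoly_der c p)
  = mpoly_der (fun j => mpoly_der c (d j) - mpoly_der d (c j)) p.
Proof.
have e (a b : 'I_k -> A) : mpoly_der a (mpoly_der b p) =
    \sum_j mpoly_der a (b j) * p^`M(j) + \sum_j \sum_i b j * a i * p^`M(j)^`M(i).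
  rewrite {2}/mpoly_der linear_sum -big_split; apply: eq_bigr => j _ /=.
  rewrite mpoly_derM; congr (_ + _).
  by rewrite {1}/mpoly_der mulr_sumr; apply: eq_bigr => i _; rewrite mulrA.
rewrite !e [X in _ - (_ + X)]exchange_big.
rewrite [X in _ - (_ + X)](eq_bigr (fun j => \sum_i d j * c i * p^`M(j)^`M(i))).
  rewrite opprD addrACA subrr addr0 -sumrB; apply: eq_bigr => j _.
  by rewrite mulrBl.
by move=> j _; apply: eq_bigr => i _; rewrite mderiv_comm [c i * _]mulrC.
Qed.

Lemma mpoly_derN c p : mpoly_der (fun j => - c j) p = - mpoly_der c p.
Proof. by rewrite /mpoly_der -sumrN; apply: eq_bigr => j _; rewrite mulNr. Qed.

Lemma mpoly_derNr c p : mpoly_der c (- p) = - mpoly_der c p.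
Proof. exact: linearN. Qed.

Lemma mpoly_derZr c a p : mpoly_der c (a *: p) = a *: mpoly_der c p.
Proof. exact: linearZ. Qed.

Lemma mpoly_der0 p : mpoly_der (fun=> 0) p = 0.
Proof. by rewrite /mpoly_der big1 // => j _; rewrite mul0r. Qed.

Lemma mpoly_derC c a : mpoly_der c a%:MP = 0.
Proof. by rewrite /mpoly_der big1 // => j _; rewrite mderivC mulr0. Qed.

Lemma mpoly_der_delta i p : mpoly_der (fun j => (j == i)%:R) p = p^`M(i).
Proof.
rewrite /mpoly_der (bigD1 i) //= eqxx mul1r big1 ?addr0 // => j /negPf ->.
by rewrite mul0r.
Qed.

Definition first_order_fun c g p : A := mpoly_der c p + g * p.

Lemma first_order_linear c g : linear (first_order_fun c g).
Proof.
move=> a p q; rewrite /first_order_fun linearP mulrDr scalerDr addrACA.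
by rewrite scalerAr.
Qed.

Definition first_order c g : endo {mpoly F[k]} := Endo (first_order_linear c g).

Arguments first_order : simpl never.

Lemma first_orderE c g p : first_order c g p = mpoly_der c p + g * p.
Proof. by []. Qed.

Lemma eq_first_order c d g h : c =1 d -> g = h -> first_order c g = first_order d h.
Proof.
move=> cd ->; apply: endoP => p; rewrite !first_orderE; congr (_ + _).
by apply: eq_bigr => j _; rewrite cd.
Qed.

Lemma first_order_comm c g d h :
  first_order c g * first_order d h - first_order d h * first_order c g =
  first_order (fun j => mpoly_der c (d j) - mpoly_der d (c j))
              (mpoly_der c h - mpoly_der d g).
Proof.
apply: endoP => p; rewrite endoBE !endoME !first_orderE -mpoly_der_comm.
by rewrite !linearD /= !mpoly_derM; ring.
Qed.

Lemma first_orderZ a c g :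
  a *: first_order c g = first_order (fun j => a *: c j) (a *: g).
Proof.
apply: endoP => p; rewrite endoZE !first_orderE scalerDr scalerAl; congr (_ + _).
by rewrite /mpoly_der scaler_sumr; apply: eq_bigr => j _; rewrite scalerAl.
Qed.

Lemma first_order_eq0 c g : c =1 (fun=> 0) -> g = 0 -> first_order c g = 0.
Proof.
move=> c0 ->; apply: endoP => p; rewrite first_orderE mul0r addr0.
by rewrite /mpoly_der big1 // => j _; rewrite c0 mul0r.
Qed.

End FirstOrder.

(** * Representations on functions of jets *)

Section JetRepresentation.
Variables (F : fieldType) (n : nat).
Local Notation A := {mpoly F[n.+2]}.

(** The Taylor coefficients a_1, ..., a_n of a jet. The index 0 of the polynomial
    ring is kept for the base point and the last one for the Fourier dual of the
    coefficient a_(n+1). *)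
Definition jet_var (j : nat) : A :=
  if (0 < j <= n)%N then 'X_(inord j) else 0.

Definition dual_var : A := 'X_ord_max.

(** Composition of jets with the flow of t^(i+1) d/dt moves a_l with velocity
    (l - i) a_(l-i). On the Fourier dual of a_(n+1) only the scaling, i = 0, is a
    derivation. *)
Definition jet_coef (i : nat) (l : 'I_n.+2) : A :=
  if (0 < l <= n)%N then (l - i)%:R *: jet_var (l - i)
  else if (l == ord_max) && (i == 0%N) then - n.+1%:R *: dual_var else 0.

(** The component (n + 1 - i) a_(n+1-i) along a_(n+1) becomes a multiplication
    after the Fourier transform. *)
Definition jet_mul (i : nat) : A :=
  (n.+1 - i)%:R *: (jet_var (n.+1 - i) * dual_var).

Local Notation jet_der i := (mpoly_der (jet_coef i)).

Lemma jet_var0 : jet_var 0 = 0. Proof. by []. Qed.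

Lemma jet_der_var i j : (j <= n)%N ->
  jet_der i (jet_var j) = (j - i)%:R *: jet_var (j - i).
Proof.
rewrite {1}/jet_var => le_jn; have [->|j_gt0] := posnP j.
  by rewrite linear0 sub0n scaler0.
by rewrite le_jn /= mpoly_derX /jet_coef inordK ?j_gt0 ?le_jn // ltnS ltnW.
Qed.

Lemma jet_der_dual i :
  jet_der i dual_var = if i == 0%N then - n.+1%:R *: dual_var else 0.
Proof. by rewrite mpoly_derX /jet_coef /= ltnn /= eqxx. Qed.

Lemma jet_coef_comm i j l :
  jet_der i (jet_coef j l) - jet_der j (jet_coef i l)
  = (i%:R - j%:R) *: jet_coef (i + j) l.
Proof.
rewrite [jet_coef j l]/jet_coef [jet_coef i l]/jet_coef [jet_coef (i + j) l]/jet_coef.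
case: ifP => [/andP [l_gt0 le_ln]|_].
  rewrite !mpoly_derZr !jet_der_var ?(leq_trans (leq_subr _ _)) // -!subnDA.
  rewrite [(j + i)%N]addnC !scalerA -scalerBl.
  have [le_l|lt_l] := leqP l (i + j).
    have -> : (l - (i + j) = 0)%N by lia.
    by rewrite jet_var0 !scaler0.
  congr (_ *: _); rewrite -mulrBl; congr (_ * _).
  by rewrite !natrB; [ring|lia|lia].
case: (l == ord_max); last by rewrite /= !linear0 ?addr0 ?subrr ?scaler0.
case: i j => [|i] [|j] /=.
- by rewrite !subrr scale0r.
- by rewrite linear0 mpoly_derZr jet_der_dual /= !scaler0 subrr.
- by rewrite linear0 mpoly_derZr jet_der_dual /= !scaler0 subrr.
- by rewrite !linear0 ?addr0 ?subrr ?scaler0.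
Qed.

Lemma jet_mul0 : jet_mul 0 = 0.
Proof. by rewrite /jet_mul subn0 /jet_var ltnn andbF mul0r scaler0. Qed.

Lemma jet_mul_comm i j :
  jet_der i (jet_mul j) - jet_der j (jet_mul i) = (i%:R - j%:R) *: jet_mul (i + j).
Proof.
have der_mul k l : (0 < l)%N -> jet_der k (jet_mul l) =
    ((n.+1 - l)%:R * (n.+1 - l - k)%:R) *: (jet_var (n.+1 - l - k) * dual_var)
    + (if k == 0%N then - n.+1%:R *: jet_mul l else 0).
  move=> l_gt0; rewrite /jet_mul linearZ /= mpoly_derM jet_der_var; last by lia.
  rewrite jet_der_dual scalerDr -scalerAl scalerA.
  congr (_ + _).
  case: (k == 0%N); last by rewrite mulr0 scaler0.
  by rewrite -scalerAr !scalerA mulrC.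
case: i j => [|i] [|j].
- by rewrite !subrr scale0r.
- rewrite jet_mul0 linear0 subr0 der_mul //= subn0 add0n /jet_mul !scalerA -scalerDl.
  congr (_ *: _); have [le_jn|lt_nj] := leqP j.+1 n.+1; first by rewrite natrB //; ring.
  have -> : (n.+1 - j.+1 = 0)%N by lia.
  by rewrite mulr0n !mulr0 addr0.
- rewrite jet_mul0 linear0 sub0r der_mul //= subn0 addn0 /jet_mul !scalerA -scalerDl.
  rewrite -scaleNr; congr (_ *: _).
  have [le_jn|lt_nj] := leqP i.+1 n.+1; first by rewrite natrB //; ring.
  have -> : (n.+1 - i.+1 = 0)%N by lia.
  by rewrite mulr0n !mulr0 addr0 oppr0.
rewrite !der_mul //= !addr0 /jet_mul -!subnDA [(j.+1 + _)%N]addnC -scalerBl scalerA.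
have [le_n|lt_n] := leqP n.+1 (i.+1 + j.+1).
  have -> : (n.+1 - (i.+1 + j.+1) = 0)%N by lia.
  by rewrite mulr0n !mulr0 subrr.
congr (_ *: _); rewrite -mulrBl; congr (_ * _).
by rewrite !natrB; [ring|lia|lia].
Qed.

Variables (a k : F).

(** For a = 0 the v_i act by vector fields on jets of order n, for a = 1 they act
    on the Fourier transforms of functions on jets of order n + 1; the scalar k
    twists v_0 by a character. *)
Definition jet_op (i : nat) : endo {mpoly F[n.+2]} :=
  first_order (fun l => - jet_coef i l) ((k *+ (i == 0%N))%:MP - a *: jet_mul i).

Arguments jet_op : simpl never.

Lemma jet_op_lie i j :
  jet_op i * jet_op j - jet_op j * jet_op i = (j%:R - i%:R) *: jet_op (i + j).
Proof.
rewrite /jet_op first_order_comm first_orderZ; apply: eq_first_order => [l|].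
  rewrite !mpoly_derN !mpoly_derNr !opprK jet_coef_comm.
  by rewrite -opprB scaleNr scalerN.
have derB c (e : F) q : mpoly_der c (e%:MP - a *: q) = - (a *: mpoly_der c q).
  by rewrite linearB /= mpoly_derC mpoly_derZr sub0r.
rewrite !mpoly_derN !derB !opprK -scalerBr.
rewrite jet_mul_comm scalerBr !scalerA [a * _]mulrC -[j%:R - i%:R]opprB !mulNr !scaleNr.
rewrite opprK; case: i j => [|i] [|j] /=; rewrite ?mulr0n ?scaler0 ?oppr0 ?add0r //.
by rewrite !mul0r !scale0r oppr0 add0r.
Qed.

Definition base_mul : endo {mpoly F[n.+2]} := first_order (fun=> 0) 'X_ord0.
Definition base_der : endo {mpoly F[n.+2]} := first_order (fun l => (l == ord0)%:R) 0.

Arguments base_mul : simpl never.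
Arguments base_der : simpl never.

Lemma base_mulE p : base_mul p = 'X_ord0 * p.
Proof. by rewrite first_orderE mpoly_der0 add0r. Qed.

Lemma base_derE p : base_der p = p^`M(ord0).
Proof. by rewrite first_orderE mpoly_der_delta mul0r addr0. Qed.

Lemma base_comm : base_der * base_mul - base_mul * base_der = 1.
Proof.
apply: endoP => p; rewrite endoBE !endoME !base_mulE !base_derE endo1E.
by rewrite mderivM mderivU eqxx mul1r addrK.
Qed.

Lemma jet_var_base j : (jet_var j)^`M(ord0) = 0.
Proof.
rewrite /jet_var; case: ifP => [/andP [j_gt0 le_jn]|_]; last exact: mderiv0.
rewrite mderivU (_ : (_ == _) = false) //; apply/negP => /eqP /(congr1 val) /=.
by rewrite inordK ?ltnS ?(leqW le_jn) //; lia.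
Qed.

Lemma dual_var_base : dual_var^`M(ord0) = 0.
Proof. by rewrite mderivU. Qed.

Lemma jet_op_mul i : jet_op i * base_mul = base_mul * jet_op i.
Proof.
apply/eqP; rewrite -subr_eq0 first_order_comm; apply/eqP/first_order_eq0 => [l|].
  by rewrite linear0 mpoly_der0 subr0.
by rewrite mpoly_der0 subr0 mpoly_derX /jet_coef /= oppr0.
Qed.

Lemma jet_op_der i : jet_op i * base_der = base_der * jet_op i.
Proof.
apply/eqP; rewrite -subr_eq0 first_order_comm; apply/eqP/first_order_eq0 => [l|].
  rewrite mpoly_der_delta (_ : (l == ord0)%:R = ((l == ord0)%:R)%:MP); last first.
    by rewrite mpolyC_nat.
  rewrite mpoly_derC sub0r mderivN opprK /jet_coef; case: ifP => _.
    by rewrite mderivZ jet_var_base scaler0.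
  by case: ifP => _; rewrite ?mderiv0 // mderivZ dual_var_base scaler0.
rewrite linear0 sub0r mpoly_der_delta mderivB mderivC sub0r opprK.
by rewrite /jet_mul !mderivZ mderivM jet_var_base dual_var_base mul0r mulr0 addr0 !scaler0.
Qed.

Lemma jet_op_vanish i : (n < i)%N -> jet_op i = 0.
Proof.
move=> lt_ni; apply: first_order_eq0 => [l|].
  rewrite /jet_coef; case: ifP => [/andP [_ le_ln]|_].
    by rewrite (_ : (l - i = 0)%N) ?scale0r ?oppr0 //; lia.
  by rewrite (_ : (i == 0%N) = false) ?andbF ?oppr0 //; lia.
rewrite /jet_mul (_ : (n.+1 - i = 0)%N) ?scale0r ?scaler0 ?subr0; last by lia.
by rewrite (_ : (i == 0%N) = false) ?mulr0n //; lia.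
Qed.

End JetRepresentation.

(** * The kernel is generated by the differentiator *)

Section Derivations.
Variables (F : fieldType) (A : comAlgType F) (ev : {rmorphism A -> F}).
Variables (D : nat -> endo A) (phi : A).
Hypothesis DM : forall b p q, D b (p * q) = D b p * q + p * D b q.
Hypothesis ev_phi : ev phi = 0.

Lemma derivation_pow b m : D b (phi ^+ m.+1) = (phi ^+ m * D b phi) *+ m.+1.
Proof.
elim: m => [|m IH]; first by rewrite expr0 mul1r expr1.
rewrite exprS DM IH [in RHS]mulrS [D b phi * _]mulrC; congr (_ + _).
by rewrite mulrnAr mulrA -exprS.
Qed.

(** Each derivation lowers the power of phi by at most one, and at a zero of phi
    only the terms in which all of them hit a factor phi are visible. *)
Lemma derivation_word s r : (size s <= r)%N -> exists c,
  (\prod_(b <- s) D b) (phi ^+ r) = phi ^+ (r - size s) * c /\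
  ev c = (r ^_ (size s))%:R * \prod_(b <- s) ev (D b phi).
Proof.
elim: s => [|b s IH] /= size_s.
  by exists 1; rewrite !big_nil endo1E subn0 rmorph1 !mulr1.
have [c [e ev_c]] := IH (ltnW size_s).
have [m em] : exists m, (r - size s = m.+1)%N by exists (r - size s).-1; lia.
exists (D b phi * c *+ m.+1 + phi * D b c); split.
  rewrite big_cons endoME e em DM derivation_pow (_ : (r - (size s).+1 = m)%N); last by lia.
  by rewrite exprSr; ring.
rewrite ffactnSr em natrM big_cons rmorphD rmorphMn !rmorphM ev_phi mul0r addr0.
by rewrite ev_c -mulr_natr /=; ring.
Qed.

Lemma derivation_word_low s r : (size s < r)%N ->
  ev ((\prod_(b <- s) D b) (phi ^+ r)) = 0.
Proof.
move=> lt_sr; have [c [-> _]] := derivation_word (ltnW lt_sr).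
by rewrite rmorphM rmorphXn ev_phi expr0n subn_eq0 leqNgt lt_sr mul0r.
Qed.

Lemma derivation_word_top s : ev ((\prod_(b <- s) D b) (phi ^+ size s)) =
  (size s)`!%:R * \prod_(b <- s) ev (D b phi).
Proof.
by have [c [-> ev_c]] := derivation_word (leqnn (size s)); rewrite subnn mul1r ev_c ffactnn.
Qed.

End Derivations.

Section Kernel.
Variables (F : fieldType) (charF0 : [pchar F] =i pred0) (n : nat).
Hypothesis n_gt0 : (1 <= n)%N.
Local Notation A := {mpoly F[n.+2]}.

Local Notation x := ('X_ord0 : {mpoly F[2]}).
Local Notation y := ('X_ord_max : {mpoly F[2]}).

Let vec (i : nat) : endo A := jet_op n 0 0 i.

Let vec_vanish i : (n <= i)%N -> vec i = 0.
Proof.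
move=> le_ni; apply: first_order_eq0 => [l|]; last by rewrite mul0rn scale0r subr0 mpolyC0.
rewrite /jet_coef; case: ifP => [/andP [_ le_ln]|_].
  by rewrite (_ : (l - i = 0)%N) ?scale0r ?oppr0 //; lia.
by rewrite (_ : (i == 0%N) = false) ?andbF ?oppr0 //; lia.
Qed.

Let vecE i p : vec i p = - mpoly_der (jet_coef F i) p.
Proof.
by rewrite /vec first_orderE mpoly_derN mul0rn scale0r subr0 mpolyC0 mul0r addr0.
Qed.

Lemma base_mul_horner (f : {poly F}) p :
  horner_alg (base_mul F n) f p = horner_alg ('X_ord0 : A) f * p.
Proof.
elim/poly_ind: f p => [|f c IH] p; first by rewrite !rmorph0 endo0E mul0r.
rewrite !rmorphD !rmorphM /= !horner_algX !horner_algC base_mulE IH.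
by rewrite mulrDl mulr_algl mulrA.
Qed.

Let jet_fun (i : nat) : endo A := if i is k.+1 then vec k else base_der F n.

Let jet_fun0 p : jet_fun 0 p = p^`M(ord0). Proof. exact: base_derE. Qed.
Let jet_funS i p : jet_fun i.+1 p = - mpoly_der (jet_coef F i) p.
Proof. exact: vecE. Qed.

Let jet_funM i p q : jet_fun i (p * q) = jet_fun i p * q + p * jet_fun i q.
Proof.
case: i => [|i]; first by rewrite !jet_fun0 mderivM.
by rewrite !jet_funS mpoly_derM opprD mulNr mulrN.
Qed.

Let field (b : nat) : endo A :=
  \sum_(i < n.+1) horner_alg (base_mul F n) ('X^b)^`N(i) * jet_fun i.

Let fieldM b p q : field b (p * q) = field b p * q + p * field b q.
Proof.
rewrite /field !endo_sumE mulr_suml mulr_sumr -big_split; apply: eq_bigr => i _ /=.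
by rewrite !base_mul_horner jet_funM; ring.
Qed.

(** The jet of the identity over the point t0. *)
Let pt (t0 : F) (l : 'I_n.+2) : F :=
  if l == 0%N :> nat then t0 else if l == 1%N :> nat then 1 else 0.

(** The function vanishing at the base point with differential xi; the signs
    compensate that v_i acts by the negative of a vector field. *)
Let phi (t0 : F) (xi : nat -> F) : A :=
  \sum_(l < n.+2) (if l == 0%N :> nat then xi 0%N else - xi l) *: ('X_l - (pt t0 l)%:MP).

Let phi_pt t0 xi : (phi t0 xi).@[pt t0] = 0.
Proof.
rewrite /phi raddf_sum big1 // => l _ /=.
by rewrite mevalZ mevalB mevalXU mevalC subrr mulr0.
Qed.

Let mderiv_phi t0 xi (j : 'I_n.+2) :
  (phi t0 xi)^`M(j) = (if j == 0%N :> nat then xi 0%N else - xi j)%:MP.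
Proof.
rewrite /phi raddf_sum (bigD1 j) //= big1 ?addr0 => [|l ne].
  by rewrite mderivZ mderivB mderivC subr0 mderivU eqxx -mul_mpolyC mulr1.
by rewrite mderivZ mderivB mderivC subr0 mderivU (negPf ne) scaler0.
Qed.

Let jet_fun_phi t0 xi i : (i <= n)%N -> (jet_fun i (phi t0 xi)).@[pt t0] = xi i.
Proof.
case: i => [|i] lt_in; first by rewrite jet_fun0 mderiv_phi mevalC.
rewrite jet_funS mevalN /mpoly_der (raddf_sum (meval (pt t0))).
have lt_i : (i.+1 < n.+2)%N by lia.
rewrite (bigD1 (Ordinal lt_i)) //= big1 ?addr0 => [|l ne].
  rewrite mevalM mderiv_phi mevalC /jet_coef /= lt_in subSnn scale1r /jet_var n_gt0.
  by rewrite mevalXU /pt inordK //= mul1r opprK.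
rewrite mevalM /jet_coef; case: ifP => [/andP [l_gt0 le_ln]|_]; last first.
  case: ifP => _; rewrite ?meval0 ?mul0r // mevalZ mevalXU /pt /=.
  by rewrite (_ : (n.+1 == 1)%N = false) ?mulr0 ?mul0r //; lia.
rewrite mevalZ /jet_var; case: ifP => [/andP [h1 h2]|_]; last by rewrite meval0 mulr0 mul0r.
rewrite mevalXU /pt inordK; last by lia.
rewrite (_ : (l - i == 0)%N = false); last by lia.
rewrite (_ : (l - i == 1)%N = false) ?mulr0 ?mul0r //.
by apply: contra_neqF ne => /eqP e; apply: val_inj => /=; lia.
Qed.

Let field_phi t0 xi b : (field b (phi t0 xi)).@[pt t0] = symbol n t0 xi b.
Proof.
rewrite /field endo_sumE raddf_sum; apply: eq_bigr => i _ /=.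
rewrite base_mul_horner mevalM jet_fun_phi; last by rewrite -ltnS.
congr (_ * _); elim/poly_ind: (_^`N(i)) => [|f c IH].
  by rewrite rmorph0 meval0 horner0.
by rewrite rmorphD rmorphM /= horner_algX horner_algC mevalD mevalM IH mevalXU mevalZ
  meval1 mulr1 hornerMXaddC.
Qed.

(** Applied to phi^r and evaluated at the base point, the words shorter than r
    vanish and those of length r become products of symbols. *)
Lemma normal_orbit_free (S : seq (seq nat)) (c : seq nat -> F) :
  uniq S -> all (normal n) S ->
  orbit_hom n charF0 (\sum_(s <- S) c s *: mon F s) = 0 ->
  forall s, s \in S -> c s = 0.
Proof.
move=> uniqS normalS S0.
have [R [_ _ R_in]] := orbit_alg_lift (base_comm F n)
  (jet_op_mul n 0 0) (jet_op_der n 0 0) (jet_op_lie n 0 0) vec_vanish charF0.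
have R_ew b : R (orbit_hom n charF0 (ew F b)) = field b by exact: R_in.
have R_mon s : R (orbit_hom n charF0 (mon F s)) = \prod_(b <- s) field b.
  by rewrite /mon !rmorph_prod; apply: eq_bigr => b _; exact: R_ew.
have R0 p : \sum_(s <- S) c s *: (\prod_(b <- s) field b) p = 0.
  have : R (orbit_hom n charF0 (\sum_(s <- S) c s *: mon F s)) p = 0.
    by rewrite S0 linear0.
  rewrite (linear_sum (orbit_hom n charF0)) (linear_sum R) endo_sumE => e.
  rewrite -[RHS]e; apply: eq_bigr => s _.
  have RZ : R (orbit_hom n charF0 (c s *: mon F s)) =
      c s *: R (orbit_hom n charF0 (mon F s)) by rewrite !linearZ.
  by rewrite -R_mon -endoZE -RZ.
suff h r : (forall s, s \in S -> (r < size s)%N -> c s = 0) ->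
    forall s, s \in S -> size s = r -> c s = 0.
  pose top := (\max_(s <- S) size s)%N.
  have size_top s : s \in S -> (size s <= top)%N by move=> sS; exact: leq_bigmax_seq.
  move=> s; have [k] : exists k, (top - size s <= k)%N by exists (top - size s)%N.
  elim: k s => [|k IH] s le_k sS; apply: (h (size s)) => // s' s'S lt_ss'.
    by have := size_top _ s'S; lia.
  by apply: IH => //; have := size_top _ s'S; lia.
move=> hr.
have : forall s, s \in [seq s <- S | size s == r] -> c s = 0; last first.
  by move=> h s sS e; apply: h; rewrite mem_filter e eqxx.
apply: (@normal_symbols_free F charF0 n) => [||t0 xi].
- exact: filter_uniq.
- by apply/allP => s; rewrite mem_filter => /andP [_ /(allP normalS)].
have := congr1 (meval (pt t0)) (R0 (phi t0 xi ^+ r)); rewrite (raddf_sum (meval (pt t0))) meval0.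
have ev_field s : (size s <= r)%N -> ((\prod_(b <- s) field b) (phi t0 xi ^+ r)).@[pt t0] =
    if size s == r then r`!%:R * \prod_(b <- s) symbol n t0 xi b else 0.
  move=> le_sr; case: eqP => [<-|ne].
    rewrite (derivation_word_top (ev := meval (pt t0)) fieldM (phi_pt t0 xi)).
    by congr (_ * _); apply: eq_bigr => b _; exact: field_phi.
  by rewrite (derivation_word_low (ev := meval (pt t0)) fieldM (phi_pt t0 xi)) //; lia.
move=> e; apply: (mulfI (natr_neq0 charF0 (fact_gt0 r))); rewrite mulr0 -[RHS]e.
rewrite mulr_sumr big_filter [RHS](bigID (fun s => size s == r)) /=.
rewrite [X in _ = _ + X]big_seq_cond [X in _ = _ + X]big1 ?addr0 => [|s /andP [sS ne]]; last first.
  rewrite mevalZ; have [le_sr|lt_rs] := leqP (size s) r; last by rewrite hr ?mul0r.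
  by rewrite ev_field // (negPf ne) mulr0.
apply: eq_bigr => s sz; rewrite mevalZ ev_field ?sz; first by rewrite mulrCA.
by rewrite (eqP sz).
Qed.

(** The normal monomials span modulo the ideal, and they stay independent modulo
    the kernel. *)
Lemma orbit_kernel u : orbit_hom n charF0 u = 0 <->
  principal_ideal (wprod ((x - y) ^+ (2 * n + 2))) u.
Proof.
have zero p : orbit_hom n charF0 (wprod ((x - y) ^+ (2 * n + 2))) * p = 0.
  by have := orbit_hom_vanish charF0 n 1; rewrite mulr1 => ->; rewrite mul0r.
have ideal_zero v : principal_ideal (wprod ((x - y) ^+ (2 * n + 2))) v ->
    orbit_hom n charF0 v = 0.
  move=> [m [a [b ->]]]; rewrite linear_sum big1 // => i _ /=.
  by rewrite !rmorphM -mulrA zero mulr0.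
split; last exact: ideal_zero.
have [v [S [c [Iv uniqS normalS ->]]]] := normal_spanT charF0 u n_gt0.
rewrite linearD /= (ideal_zero v Iv) add0r => S0.
rewrite big_seq big1 ?addr0 // => s sS.
by rewrite (normal_orbit_free uniqS normalS S0 sS) scale0r.
Qed.

End Kernel.

(** * The kernel is not finitely generated on one side *)

Section NotFinitelyGenerated.
Variables (F : fieldType) (charF0 : [pchar F] =i pred0) (n : nat).
Hypothesis n_gt0 : (1 <= n)%N.
Local Notation A := {mpoly F[n.+2]}.
Local Notation U := (envelope (witt F)).

Local Notation x := ('X_ord0 : {mpoly F[2]}).
Local Notation y := ('X_ord_max : {mpoly F[2]}).

(** The shift of v_0 makes it act by 1 on the square of the monomial by which v_n
    acts, see [twisted]: the multiples of that square behave like densities. *)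
Let vec (i : nat) : endo A := jet_op n 1 (1 - (2 * n)%:R) i.

(** After a Fourier transform d/dt is the multiplication by X_0, whose image is
    killed by taking constant terms. *)
Let tau : endo A := - base_der F n.

Let tauE p : tau p = - p^`M(ord0).
Proof. by rewrite -base_derE. Qed.

Let base_tau : base_mul F n * tau - tau * base_mul F n = 1.
Proof. by rewrite /tau mulrN mulNr opprK addrC base_comm. Qed.

Let vec_tau i : vec i * tau = tau * vec i.
Proof. by rewrite /tau mulrN mulNr jet_op_der. Qed.

Let vecE i p : vec i p = - mpoly_der (jet_coef F i) p
  + (((1 - (2 * n)%:R) *+ (i == 0%N))%:MP - jet_mul F n i) * p.
Proof. by rewrite /vec first_orderE mpoly_derN scale1r. Qed.

Let weight : A := jet_var F n 1 * dual_var F n.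

Let vec_top p : vec n p = - (weight * p).
Proof.
rewrite vecE (_ : (n == 0%N) = false); last by lia.
rewrite mulr0n mpolyC0 sub0r /jet_mul subSnn scale1r mulNr.
rewrite /mpoly_der big1 ?oppr0 ?add0r // => l _.
rewrite /jet_coef (_ : (n == 0%N) = false) ?andbF; last by lia.
case: ifP => [/andP [_ le_ln]|_]; last by rewrite mul0r.
by rewrite (_ : (l - n = 0)%N) ?scale0r ?mul0r //; lia.
Qed.

Let weight_base : weight^`M(ord0) = 0.
Proof. by rewrite /weight mderivM jet_var_base dual_var_base mul0r mulr0 addr0. Qed.

Let jet_der_weight i : mpoly_der (jet_coef F i) weight =
  if i == 0%N then - n%:R *: weight else 0.
Proof.
rewrite /weight mpoly_derM jet_der_var // jet_der_dual.
case: i => [|i] /=; last by rewrite subSS sub0n scale0r mul0r mulr0 addr0.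
rewrite subn0 scale1r -scalerAr -[X in X + _]scale1r -scalerDl; congr (_ *: _).
by rewrite -natr1 opprD addrCA subrr addr0.
Qed.

(** The action of v_i conjugated by the square of [weight]. *)
Let twisted (i : nat) (m : A) : A :=
  - mpoly_der (jet_coef F i) m - jet_mul F n i * m + (i == 0%N)%:R * m.

Let vec_weight i m : vec i (weight ^+ 2 * m) = weight ^+ 2 * twisted i m.
Proof.
rewrite vecE /twisted mpoly_derM expr2 mpoly_derM jet_der_weight.
case: i => [|i] /=; last by rewrite !mulr0n !mpolyC0 mul0r mulr0; ring.
rewrite !mulr1n mpolyCB mpolyC_nat -!mul_mpolyC mpolyCN !mpolyC_nat mpolyC1 natrM.
ring.
Qed.

Let tau_weight m : tau (weight ^+ 2 * m) = weight ^+ 2 * tau m.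
Proof.
by rewrite !tauE mderivM expr2 mderivM weight_base mul0r mulr0 addr0 mul0r add0r mulrN.
Qed.

Let tau_horner_weight (f : {poly F}) m :
  horner_alg tau f (weight ^+ 2 * m) = weight ^+ 2 * horner_alg tau f m.
Proof.
elim/poly_ind: f m => [|f c IH] m; first by rewrite !rmorph0 !endo0E mulr0.
rewrite !rmorphD !rmorphM /= !horner_algX !horner_algC.
have Z p : (c%:A : endo A) p = c *: p by [].
by rewrite tau_weight IH !Z mulrDr scalerAr.
Qed.

Let jet_var_const j : (jet_var F n j)@_0 = 0.
Proof.
rewrite /jet_var; case: ifP => _; last exact: mcoeff0.
by rewrite mcoeffX mnm1_eq0.
Qed.

Let dual_var_const : (dual_var F n)@_0 = 0.
Proof. by rewrite mcoeffX mnm1_eq0. Qed.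

Let const_mul (p q : A) : (p * q)@_0 = p@_0 * q@_0.
Proof. exact: (rmorphM (mcoeff 0%MM)). Qed.

Let const_sum k (h : 'I_k -> A) : (\sum_i h i)@_0 = \sum_i (h i)@_0.
Proof. exact: (raddf_sum (mcoeff 0%MM)). Qed.

Let twisted_const i m : (twisted i m)@_0 = (i == 0%N)%:R * m@_0.
Proof.
rewrite /twisted mcoeffD mcoeffB mcoeffN !const_mul.
have -> : (mpoly_der (jet_coef F i) m)@_0 = 0.
  rewrite /mpoly_der const_sum big1 // => l _; rewrite const_mul /jet_coef.
  case: ifP => _; first by rewrite mcoeffZ jet_var_const mulr0 mul0r.
  by case: ifP => _; rewrite ?mcoeff0 ?mcoeffZ ?dual_var_const ?mulr0 mul0r.
rewrite /jet_mul mcoeffZ const_mul jet_var_const mul0r mulr0 mul0r subr0 oppr0 add0r.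
by case: (i == 0%N); rewrite ?mcoeff1 ?eqxx ?mcoeff0.
Qed.

Let weight_mnm : 'X_{1..n.+2} := ((U_(inord 1) + U_(ord_max)) *+ 2)%MM.

Let weightX : weight ^+ 2 = 'X_[weight_mnm].
Proof. by rewrite /weight /weight_mnm /jet_var n_gt0 -mpolyXn mpolyXD. Qed.

Let lead (p : A) : F := p@_weight_mnm.

Let lead_weight m : lead (weight ^+ 2 * m) = m@_0.
Proof. by rewrite /lead weightX mulrC -[X in _@_X]addm0 mcoeffMX. Qed.

(** By [orbit_hom_succ] the ideal maps the module into the multiples of
    weight^2. There f d/dt acts on a density m as the derivative of f m, up to
    terms without constant term, so that [lead] is invariant. *)
Lemma coinvariant_functionals :
  exists act : U -> endo A, exists S : A -> Prop, exists c : F,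
  [/\ [/\ linear act & forall u v, act (u * v) = act u * act v],
      forall u, principal_ideal (wprod ((x - y) ^+ (2 * n + 2))) u -> forall p, S (act u p),
      forall u p, S p -> lead (act u p) = augmentation u * lead p,
      c != 0
    & forall k j, lead (act (wprod ((x - y) ^+ (2 * n + 2) * x ^+ k)) ('X_ord0 ^+ j)) =
        if k == j then c * (-1) ^+ k * k`!%:R else 0].
Proof.
have [R [RE RJ R_in]] := orbit_alg_lift base_tau vec_tau (jet_op_mul n 1 _)
  (jet_op_lie n 1 _) (@jet_op_vanish F n 1 _) charF0.
pose act (u : U) : endo A := R (orbit_hom n.+1 charF0 u).
have actL : linear act by move=> a u v; rewrite /act !linearP.
have actM u v : act (u * v) = act u * act v by rewrite /act !rmorphM.
have RM u v : R (u * v) = R u * R v by exact: rmorphM.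
pose S (p : A) := exists m, p = weight ^+ 2 * m.
have act_in (f : {poly F}) m : exists m',
    act (env_in (f : witt F)) (weight ^+ 2 * m) = weight ^+ 2 * m' /\ m'@_0 = 0.
  exists ('X_ord0 * horner_alg tau f m - horner_alg tau f^`() m
    + \sum_(i < n.+1) twisted i (horner_alg tau f^`N(i.+1) m)); split.
    rewrite /act R_in endo_sumE big_ord_recl nderivn0.
    rewrite mulrDr mulr_sumr; congr (_ + _).
      have -> : horner_alg tau f * jet_image (base_mul F n) vec ord0 =
          base_mul F n * horner_alg tau f - horner_alg tau f^`().
        by rewrite (horner_alg_deriv _ base_tau) addrK.
      by rewrite endoBE endoME !tau_horner_weight base_mulE mulrBr mulrCA.
    apply: eq_bigr => i _; rewrite lift0.
    by rewrite -(horner_alg_comm _ (vec_tau i)) endoME tau_horner_weight vec_weight.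
  rewrite mcoeffD mcoeffB const_sum big_ord_recl big1 => [|i _].
    rewrite twisted_const mul1r poly.nderivn1 const_mul.
    by rewrite mcoeffX mnm1_eq0 mul0r sub0r addr0 addNr.
  by rewrite twisted_const mul0r.
have S_aug u p : S p -> S (act u p) /\ lead (act u p) = augmentation u * lead p.
  apply: (augmentation_action (V := A) (act := fun u => act u)).
  - by move=> u' v' p'; rewrite /act !raddfD.
  - by move=> u' v' p'; rewrite actM.
  - by move=> a p'; rewrite /act !linearZ !rmorph1.
  - by move=> a p' [m ->]; exists (a *: m); rewrite scalerAr.
  - by move=> p' q' [m ->] [m' ->]; exists (m + m'); rewrite mulrDr.
  - by move=> p' q'; rewrite /lead mcoeffD.
  - by move=> a p'; rewrite /lead mcoeffZ.
  - by move=> f p' [m ->]; have [m' [-> _]] := act_in f m; exists m'.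
  - by move=> f p' [m ->]; have [m' [-> m'0]] := act_in f m; rewrite lead_weight.
pose c : F := (-1) ^+ n.+1 *+ 'C(2 * n + 2, n.+1).
have act_diff q p : act (wprod ((x - y) ^+ (2 * n + 2) * q)) p =
    c *: (weight ^+ 2 * horner_alg tau (diag_deriv 0 0 q) p).
  have RZ e u : R (e *: u) = e *: R u by exact: linearZ.
  rewrite /act orbit_hom_succ // RZ !RM RE RJ // endoZE !endoME -/c [jet_image _ _ _]/(vec n).
  by rewrite !vec_top mulrN opprK mulrA -expr2 tau_horner_weight.
exists act, S, c; split.
- by split.
- move=> u [m [a [b ->]]] p; have actD (h : 'I_m -> U) : act (\sum_i h i) = \sum_i act (h i).
    by rewrite /act !linear_sum.
  rewrite actD endo_sumE.
  elim/big_rec: _ => [|i q _ [m' ->]]; first by exists 0; rewrite mulr0.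
  have [m'' e] : S (act (a i * wprod ((x - y) ^+ (2 * n + 2)) * b i) p).
    rewrite !actM !endoME; apply: (S_aug _ _ _).1.
    have := act_diff 1 (act (b i) p); rewrite mulr1 => ->.
    by eexists; rewrite scalerAr.
  by exists (m'' + m'); rewrite mulrDr -e.
- by move=> u p Sp; exact: (S_aug u p Sp).2.
- by rewrite /c -mulr_natr mulf_neq0 ?signr_eq0 // natr_neq0 // bin_gt0; lia.
move=> k j; rewrite act_diff /lead mcoeffZ -/(lead _) lead_weight.
have -> : diag_deriv 0 0 (x ^+ k) = 'X^k :> {poly F}.
  by have := @diag_deriv_mon F 0 0 k 0; rewrite expr0 mulr1 !nderivn0 mulr1.
have -> : (horner_alg tau 'X^k ('X_ord0 ^+ j))@_0 =
    if k == j then (-1) ^+ k * k`!%:R else 0.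
  elim: k j => [|k IH] j.
    rewrite rmorph1 endo1E; case: j => [|j]; first by rewrite mcoeff1 eqxx mul1r.
    by rewrite exprS const_mul mcoeffX mnm1_eq0 mul0r.
  have -> p : horner_alg tau 'X^(k.+1) p = horner_alg tau 'X^k (tau p).
    by rewrite exprSr rmorphM /= horner_algX.
  rewrite tauE.
  case: j => [|j]; first by rewrite mderivC oppr0 endo_fun0 mcoeff0.
  have -> : - ('X_ord0 ^+ j.+1)^`M(ord0) = - j.+1%:R *: 'X_ord0 ^+ j :> A.
    have -> : ('X_ord0 ^+ j.+1)^`M(ord0) = j.+1%:R *: 'X_ord0 ^+ j :> A;
      last by rewrite scaleNr.
    rewrite mpolyXn mderivX mulmnE mnm1E eqxx mul1n mpolyXn; congr (_ *: 'X_[_]).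
    by rewrite mulmS addmC addmK.
  rewrite endo_funZ mcoeffZ IH eqSS; case: eqP => [<-|_]; last by rewrite mulr0.
  by rewrite factS natrM exprS mulN1r !mulNr mulrCA.
by case: (k == j); rewrite ?mulr0 // mulrA.
Qed.

End NotFinitelyGenerated.

Section OneSided.
Variables (F : fieldType) (charF0 : [pchar F] =i pred0) (n : nat).
Hypothesis n_gt0 : (1 <= n)%N.
Local Notation U := (envelope (witt F)).

Local Notation x := ('X_ord0 : {mpoly F[2]}).
Local Notation y := ('X_ord_max : {mpoly F[2]}).

(** Generators of the kernel as a left ideal would bound by their number the rank
    of the pairing of the kernel with the invariant functionals, but this pairing
    contains diagonal matrices of any size. *)
Lemma orbit_kernel_not_left_fg :
  ~ left_fg (fun u : U => orbit_hom n charF0 u = 0).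
Proof.
move=> [m [g gP]].
have [act [S [c [[actL actM] S_ker aug c0 pairing]]]] := coinvariant_functionals charF0 n_gt0.
pose l (p : {mpoly F[n.+2]}) : F := p@_((U_(inord 1) + U_(ord_max)) *+ 2)%MM.
have gker i : orbit_hom n charF0 (g i) = 0.
  apply/gP; exists (fun j => (j == i)%:R); rewrite (bigD1 i) //= eqxx mul1r.
  by rewrite big1 ?addr0 // => j /negPf ->; rewrite mul0r.
have q_ker k : orbit_hom n charF0 (wprod ((x - y) ^+ (2 * n + 2) * x ^+ k)) = 0.
  exact: orbit_hom_vanish.
have [a aP] := boolp.choice (fun k : nat => (gP _).1 (q_ker k)).
have actD k (h : 'I_k -> U) p : act (\sum_i h i) p = \sum_i act (h i) p.
  have act0 : act 0 = 0 by have := actL (-1) 0 0; rewrite !scaleN1r !addNr.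
  rewrite -endo_sumE; congr (endo_fun _ p); elim/big_rec2: _ => // i v u _ <-.
  by have := actL 1 (h i) u; rewrite !scale1r.
pose C : 'M[F]_(m.+1, m) := \matrix_(k, i) augmentation (a k i).
pose G : 'M[F]_(m, m.+1) := \matrix_(i, j) l (act (g i) ('X_ord0 ^+ j)).
have CG : C *m G = diag_mx (\row_k (c * (-1) ^+ k * k`!%:R)).
  apply/matrixP => k j; rewrite !mxE -[RHS]mulr_natr.
  transitivity (l (act (wprod ((x - y) ^+ (2 * n + 2) * x ^+ k)) ('X_ord0 ^+ j))).
    rewrite aP actD /l (raddf_sum (mcoeff _)); apply: eq_bigr => i _; rewrite !mxE.
    rewrite actM endoME; symmetry; apply: aug; apply: S_ker.
    by apply/(orbit_kernel charF0 n_gt0).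
  rewrite [LHS]pairing; have [->|ne] := eqVneq k j; first by rewrite eqxx mulr1.
  rewrite (_ : (k == j :> nat) = false) ?mulr0 //.
  by apply: contra_neqF ne => /eqP ?; exact: val_inj.
have : \rank (C *m G) = m.+1.
  apply: mxrank_unit; rewrite CG unitmxE det_diag unitfE; apply/prodf_neq0 => k _.
  by rewrite mxE !mulf_neq0 ?signr_eq0 ?natr_neq0 ?fact_gt0.
by have := mulmx_max_rank C G => /[swap] ->; rewrite ltnn.
Qed.

(** The antipode fixes the differentiator, whose coefficients are symmetric. *)
Lemma orbit_kernel_antipode u :
  orbit_hom n charF0 u = 0 -> orbit_hom n charF0 (antipode u) = 0.
Proof.
move=> /(orbit_kernel charF0 n_gt0) [m [a [b ->]]].
apply/(orbit_kernel charF0 n_gt0); rewrite linear_sum.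
apply: principal_ideal_sum => i _; rewrite /= !antipodeM.
apply: principal_idealMl; apply: principal_idealMr.
suff -> : antipode (wprod ((x - y) ^+ (2 * n + 2))) = wprod ((x - y) ^+ (2 * n + 2)).
  exact: principal_ideal_gen.
rewrite wprod_sub linear_sum (reindex_inj rev_ord_inj); apply: eq_bigr => j _ /=.
have le_jm : (j <= 2 * n + 2)%N by rewrite -ltnS.
rewrite linearZ /= antipodeM !antipode_in mulrNN subSS subKn // bin_sub //.
congr (_ *: _); congr (_ *+ _).
by rewrite -signr_odd oddB // oddD oddM /= signr_odd.
Qed.

Lemma orbit_kernel_not_right_fg :
  ~ right_fg (fun u : U => orbit_hom n charF0 u = 0).
Proof.
move=> [m [g gP]]; apply: orbit_kernel_not_left_fg.
exists m, (fun i => antipode (g i)) => u; split=> [/orbit_kernel_antipode /gP [a e]|[a ->]].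
  exists (fun i => antipode (a i)); rewrite -[u]antipodeK e linear_sum.
  by apply: eq_bigr => i _; rewrite /= antipodeM.
rewrite -[\sum_i _]antipodeK; apply: orbit_kernel_antipode; apply/gP.
exists (fun i => antipode (a i)); rewrite linear_sum.
by apply: eq_bigr => i _; rewrite /= antipodeM antipodeK.
Qed.

End OneSided.

Theorem theorem1p4 (F : fieldType) (charF0 : [pchar F] =i pred0)
    (n : nat) (hn : (1 <= n)%N) :
  [/\ forall x : envelope (witt F),
        orbit_hom n charF0 x = 0 <->
        principal_ideal
          (differentiator F (2 * n + 2)%N (2 * n + 1)%N%:Z (-1)) x,
      ~ left_fg (fun x : envelope (witt F) => orbit_hom n charF0 x = 0)
    & ~ right_fg (fun x : envelope (witt F) => orbit_hom n charF0 x = 0)].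
Proof.
have -> : differentiator F (2 * n + 2)%N (2 * n + 1)%N%:Z (-1) =
    wprod (('X_ord0 - 'X_ord_max) ^+ (2 * n + 2)).
  by rewrite addn2 addn1 differentiator_wprod.
split=> [u||]; first exact: orbit_kernel.
- exact: orbit_kernel_not_left_fg.
- exact: orbit_kernel_not_right_fg.
Qed.
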